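(* Let $\mathcal{H}$ be a finite-dimensional complex Hilbert space, let $\Theta_1,\Theta_2\in H^\infty(\mathcal{L}(\mathcal{H}))$ be two pure inner functions and let $A:K_{\Theta_1}\to K_{\Theta_2}$ be a bounded linear operator. Then $A$ belongs to $\mathcal{MT}(\Theta_1,\Theta_2)$ if and only if it has one (and all) of the following properties (that is, each of (a)–(d) is individually equivalent to $A\in\mathcal{MT}(\Theta_1,\Theta_2)$): (a) $\langle AS^*f,S^*g\rangle_{L^2(\mathcal{H})}=\langle Af,g\rangle_{L^2(\mathcal{H})}$ for all $f\in K_{\Theta_1}$, $g\in K_{\Theta_2}$ such that $f\perp\mathcal{D}_{\Theta_1}$, $g\perp\mathcal{D}_{\Theta_2}$; (b) $\langle AS^*f,g\rangle_{L^2(\mathcal{H})}=\langle Af,Sg\rangle_{L^2(\mathcal{H})}$ for all $f\in K_{\Theta_1}$, $g\in K_{\Theta_2}$ such that $f\perp\mathcal{D}_{\Theta_1}$, $g\perp\widetilde{\mathcal{D}}_{\Theta_2}$; (c) $\langle ASf,Sg\rangle_{L^2(\mathcal{H})}=\langle Af,g\rangle_{L^2(\mathcal{H})}$ for all $f\in K_{\Theta_1}$, $g\in K_{\Theta_2}$ such that $f\perp\widetilde{\mathcal{D}}_{\Theta_1}$, $g\perp\widetilde{\mathcal{D}}_{\Theta_2}$; (d) $\langle ASf,g\rangle_{L^2(\mathcal{H})}=\langle Af,S^*g\rangle_{L^2(\mathcal{H})}$ for all $f\in K_{\Theta_1}$, $g\in K_{\Theta_2}$ such that $f\perp\widetilde{\mathcal{D}}_{\Theta_1}$,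 $g\perp\mathcal{D}_{\Theta_2}$.
   Context: $\mathcal{H}$ is a finite-dimensional complex Hilbert space, $\mathcal{L}(\mathcal{H})$ is the algebra of linear operators on $\mathcal{H}$, $\mathbb{D}$ is the open unit disk, $\mathbb{T}$ the unit circle with normalized Lebesgue measure $m$. $L^2(\mathcal{H})$ is the Hilbert space of square-integrable $\mathcal{H}$-valued functions on $\mathbb{T}$, $H^2(\mathcal{H})\subset L^2(\mathcal{H})$ the Hardy space of functions whose Fourier coefficients with negative indices vanish; $H^\infty(\mathcal{H})$ the essentially bounded functions in $H^2(\mathcal{H})$. $L^2(\mathcal{L}(\mathcal{H}))$, $H^2(\mathcal{L}(\mathcal{H}))$, $H^\infty(\mathcal{L}(\mathcal{H}))$ are the analogous operator-valued spaces ($\mathcal{L}(\mathcal{H})$ with Hilbert–Schmidt norm for the $L^2$ spaces). Functions in Hardy spaces are identified with their analytic extensions to $\mathbb{D}$. An inner function is $\Theta\in H^\infty(\mathcal{L}(\mathcal{H}))$ whose boundary values $\Theta(z)$ are unitary for a.e. $z\in\mathbb{T}$; it is pure if $\|\Theta(0)\|<1$. The model space is $K_\Theta=H^2(\mathcal{H})\ominus\Theta H^2(\mathcal{H})$, $P_\Theta$ is the orthogonal projection of $L^2(\mathcal{H})$ onto $K_\Theta$, and $K_\Theta^\infty=K_\Theta\cap H^\infty(\mathcal{H})$, which is dense in $K_\Theta$. For $\Phi\in L^2(\mathcal{L}(\mathcal{H}))$, $A_\Phi^{\Theta_1,\Theta_2}f=P_{\Theta_2}(\Phi f)$ for $f\in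 K_{\Theta_1}^\infty$. If this densely defined operator is bounded it is identified with its bounded extension $K_{\Theta_1}\to K_{\Theta_2}$. $\mathcal{MT}(\Theta_1,\Theta_2)$ is the set of all such bounded operators $A_\Phi^{\Theta_1,\Theta_2}$, $\Phi\in L^2(\mathcal{L}(\mathcal{H}))$. $S$ is the shift on $H^2(\mathcal{H})$, $(Sf)(z)=zf(z)$, and $S^*$ is the backward shift, $(S^*f)(z)=\bar z(f(z)-f(0))$. Put $\mathcal{D}_\Theta=\{(I_{\mathcal{H}}-\Theta(z)\Theta(0)^* )x:\ x\in\mathcal{H}\}\subset K_\Theta$ and $\widetilde{\mathcal{D}}_\Theta=\{\bar z(\Theta(z)-\Theta(0))x:\ x\in\mathcal{H}\}\subset K_\Theta$. For $f\in K_\Theta$: $Sf\in K_\Theta$ if and only if $f\perp\widetilde{\mathcal{D}}_\Theta$; and $\bar zf\in K_\Theta$ if and only if $f\perp\mathcal{D}_\Theta$, in which case $S^*f=\bar zf$. *)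

(* Defs.v *)
From HB Require Import structures.
From mathcomp Require Import all_boot all_order all_algebra.
From mathcomp Require Import complex.
From mathcomp Require Import all_classical all_reals all_analysis.
Set Implicit Arguments.
Unset Strict Implicit.
Unset Printing Implicit Defensive.
Import Order.TTheory GRing.Theory Num.Theory.
Local Open Scope classical_set_scope.
Local Open Scope complex_scope.
Local Open Scope ring_scope.

Section Adjoint.
Variables (C : numClosedFieldType) (H : vectType C).
Variable ip : {dot H for Num.conj}.
Implicit Types (x y : H) (T : 'End(H)).

Definition is_adjoint T (T' : 'End(H)) : Prop :=
  forall x y, ip (T x) y = ip x (T' y).

(* The default value is never used: see [adjointP]. *)
Definition adjoint T : 'End(H) := xget 0 [set T' | is_adjoint T T'].

Definition unitary T : Prop :=
  (adjoint T \o T = \1)%VF /\ (T \o adjoint T = \1)%VF.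

Definition lftrace T : C :=
  \sum_i coord (vbasis {:H}) i (T (vbasis {:H})`_i).

Lemma ipZr (a : C) x y : ip x (a *: y) = a^* * ip x y.
Proof. by rewrite linearZr_LR. Qed.

Lemma riesz (phi : {linear H -> C^o}) :
  exists y : H, forall x, ip x y = phi x.
Proof.
pose b := vbasis {:H}.
pose G := \matrix_(i < \dim {:H}, j < \dim {:H}) ip b`_i b`_j.
have Gu : G \in unitmx.
  rewrite -row_free_unit; apply: inj_row_free => v vG0.
  pose u := \sum_i v 0 i *: b`_i.
  have ub j : (j < \dim {:H})%N -> ip u b`_j = 0.
    move=> jn; have := congr1 (fun M : 'rV_ _ => M 0 (Ordinal jn)) vG0.
    rewrite !mxE => <-; rewrite /u linear_sumlz /=; apply: eq_bigr => i _.
    by rewrite linearZl_LR !mxE.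
  have u0 : u = 0.
    apply/eqP; rewrite -(dnorm_eq0 ip) {2}/u linear_sum big1 ?eqxx //= => j _.
    by rewrite linearZr_LR /= ub ?mulr0.
  apply/rowP => i; rewrite mxE.
  have /freeP fb := basis_free (vbasisP {:H}).
  exact: (fb (fun i => v 0 i) u0).
pose c := invmx G *m (\col_i (phi b`_i : C)).
exists (\sum_j (c j 0)^* *: b`_j) => x.
have bP i : (i < \dim {:H})%N -> ip b`_i (\sum_j (c j 0)^* *: b`_j) = phi b`_i.
  move=> iN; have : (G *m c) (Ordinal iN) 0 = phi b`_i.
    by rewrite /c mulmxA mulmxV // mul1mx mxE.
  move=> <-; rewrite linear_sum mxE /=.
  apply: eq_bigr => j _.
  by rewrite [LHS]ipZr conjCK [G _ _]mxE mulrC.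
rewrite (coord_vbasis (memvf x)) linear_sumlz linear_sum /=.
by apply: eq_bigr => i _; rewrite linearZl_LR linearZ /= bP.
Qed.

Lemma ip_inj x y : (forall z, ip z x = ip z y) -> x = y.
Proof.
move=> xy; apply/eqP; rewrite -subr_eq0 -(dnorm_eq0 ip) linearBr /=.
by rewrite xy subrr.
Qed.

Lemma adjointP T : is_adjoint T (adjoint T).
Proof.
rewrite /adjoint; case: xgetP => [T' _ //|no]; exfalso.
have ex y : exists y', forall x, ip x y' = ip (T x) y.
  have lin : linear (fun x => ip (T x) y : C^o).
    by move=> a u v; rewrite linearP /= linearPl.
  pose phi := HB.pack (fun x => ip (T x) y : C^o)
    (GRing.isLinear.Build _ _ _ _ _ lin) : {linear H -> C^o}.
  exact: (riesz phi).
pose g y := projT1 (cid (ex y)).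
have gP y x : ip x (g y) = ip (T x) y by rewrite /g; case: cid.
have lin : linear g.
  move=> a u v; apply: ip_inj => z.
  by rewrite gP !linearDr /= !linearZr_LR /= !gP.
pose gl := HB.pack g (GRing.isLinear.Build _ _ _ _ _ lin) : {linear H -> H}.
by apply: (no (linfun gl)) => x y; rewrite lfunE /= gP.
Qed.

End Adjoint.

Section Circle.
Variable R : realType.

Definition circle := {z : R[i] | `|z| == 1}.

Lemma expit_subproof (t : R) : `|cos t +i* sin t| == 1.
Proof. by rewrite normc_def /= cos2Dsin2 sqrtr1. Qed.

Definition expit (t : measurableTypeR R) : circle :=
  exist _ (cos t +i* sin t) (expit_subproof t).

HB.instance Definition _ := Choice.copy circle {z : R[i] | `|z| == 1}.
HB.instance Definition _ := isPointed.Build circle (expit 0).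

(* The quotient sigma-algebra of the Borel sets of [R] by [expit].  As [expit]
   is continuous and restricts to a Borel isomorphism from [0, 2 pi[ onto the
   circle, these are the Borel sets of the circle. *)
Definition circle_measurable : set (set circle) :=
  [set B | measurable (expit @^-1` B)].

Lemma circle_measurable0 : circle_measurable set0.
Proof. by rewrite /circle_measurable /= preimage_set0. Qed.

Lemma circle_measurableC A : circle_measurable A -> circle_measurable (~` A).
Proof. by rewrite /circle_measurable /= preimage_setC; exact: measurableC. Qed.

Lemma circle_measurable_bigcup (F : (set circle)^nat) :
  (forall k, circle_measurable (F k)) -> circle_measurable (\bigcup_k F k).
Proof.
move=> mF; rewrite /circle_measurable /= preimage_bigcup.
by apply: bigcup_measurable => k _; exact: mF.
Qed.

HB.instance Definition _ := @isMeasurable.Build default_measure_display circle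
  circle_measurable circle_measurable0 circle_measurableC
  circle_measurable_bigcup.

Lemma measurable_expit : measurable_fun setT expit.
Proof. by move=> _ B mB; rewrite setTI. Qed.

HB.instance Definition _ := @isMeasurableFun.Build _ _
  (measurableTypeR R) circle expit measurable_expit.

Lemma twopi_gt0 : 0 < 2 * pi :> R.
Proof. by rewrite mulr_gt0 // pi_gt0. Qed.

(* Normalized Lebesgue measure: the law of [expit U] with [U] uniform on
   [0, 2 pi]. *)
Definition circle_leb : probability circle R :=
  distribution (uniform_prob twopi_gt0) expit.

End Circle.

(* Functions on the circle with values in a finite-dimensional complex vector
   space; measurability and integrals are taken coordinatewise, which does not
   depend on the chosen basis. *)
Section VectorFunctions.
Variables (R : realType) (V : vectType R[i]).
Local Notation m := (circle_leb R).
Implicit Types (f g : circle R -> V) (u : circle R -> R[i]).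

Definition cintegral u : R[i] :=
  (\int[m]_z complex.Re (u z))%R +i* (\int[m]_z complex.Im (u z))%R.

Definition vcoord (i : 'I_(\dim {:V})) (v : V) : R[i] :=
  coord (vbasis {:V}) i v.

Definition vmeasurable f : Prop := forall i,
  measurable_fun setT (fun z => complex.Re (vcoord i (f z))) /\
  measurable_fun setT (fun z => complex.Im (vcoord i (f z))).

Definition vintegral f : V :=
  \sum_i cintegral (fun z => vcoord i (f z)) *: (vbasis {:V})`_i.

Definition ae_equal f g : Prop := {ae m, forall z, f z = g z}.

Definition square_integrable (N : V -> R) f : Prop :=
  vmeasurable f /\ m.-integrable setT (fun z => (N (f z) ^+ 2)%:E).

Definition ess_bounded (N : V -> R) f : Prop :=
  exists M : R, {ae m, forall z, N (f z) <= M}.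

Definition fourier f (n : int) : V :=
  vintegral (fun z => sval z ^ (- n) *: f z).

(* Value at [w] in the open unit disk of the analytic extension of a function
   in a Hardy space, by Cauchy's formula. *)
Definition disk_value f (w : R[i]) : V :=
  vintegral (fun z => (1 - w * (sval z)^*)^-1 *: f z).

Definition forward_shift f : circle R -> V := fun z => sval z *: f z.

Definition backward_shift f : circle R -> V :=
  fun z => (sval z)^* *: (f z - disk_value f 0).

End VectorFunctions.

Section Hardy.
Variables (R : realType) (H : vectType R[i]) (ip : {dot H for Num.conj}).
Local Notation m := (circle_leb R).
Local Notation T := (circle R).
Implicit Types (f g h : T -> H) (Th Phi : T -> 'End(H)).

Definition hnorm (x : H) : R := Num.sqrt (complex.Re (ip x x)).

Definition opnorm (B : 'End(H)) : R :=
  sup [set hnorm (B x) | x in [set x | hnorm x <= 1]].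

Definition hsnorm (B : 'End(H)) : R :=
  Num.sqrt (complex.Re (lftrace (adjoint ip B \o B)%VF)).

Definition L2 : set (T -> H) := [set f | square_integrable hnorm f].

Definition H2 : set (T -> H) :=
  [set f | L2 f /\ forall n : int, n < 0 -> fourier f n = 0].

Definition Hinf : set (T -> H) := [set f | H2 f /\ ess_bounded hnorm f].

Definition L2op : set (T -> 'End(H)) :=
  [set Phi | square_integrable hsnorm Phi].

Definition H2op : set (T -> 'End(H)) :=
  [set Phi | L2op Phi /\ forall n : int, n < 0 -> fourier Phi n = 0].

Definition Hinfop : set (T -> 'End(H)) :=
  [set Phi | H2op Phi /\ ess_bounded opnorm Phi].

Definition L2ip f g : R[i] := cintegral (fun z => ip (f z) (g z)).

Definition L2norm f : R := Num.sqrt (complex.Re (L2ip f f)).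

Definition L2ortho f (D : set (T -> H)) : Prop := forall g, D g -> L2ip f g = 0.

Definition inner Th : Prop :=
  Hinfop Th /\ {ae m, forall z, unitary ip (Th z)}.

Definition pure Th : Prop := opnorm (disk_value Th 0) < 1.

Definition op_mul Phi f : T -> H := fun z => Phi z (f z).

Definition model_space Th : set (T -> H) :=
  [set f | H2 f /\ L2ortho f [set op_mul Th h | h in H2]].

Definition model_space_inf Th : set (T -> H) := model_space Th `&` Hinf.

(* [g] is a representative of the orthogonal projection of [h] onto [K]. *)
Definition is_projection (K : set (T -> H)) h g : Prop :=
  K g /\ L2ortho (fun z => h z - g z) K.

Definition defect Th : set (T -> H) :=
  [set f | exists x : H,
     f = (fun z => x - Th z (adjoint ip (disk_value Th 0) x))].

Definition codefect Th : set (T -> H) :=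
  [set f | exists x : H,
     f = (fun z => (sval z)^* *: (Th z x - disk_value Th 0 x))].

(* Elements of [L2] are represented by functions, so an operator between model
   spaces is a map of functions that is compatible with almost everywhere
   equality; its values outside of [model_space Th1] are irrelevant. *)
Definition bounded_operator Th1 Th2 (A : (T -> H) -> (T -> H)) : Prop :=
  [/\ forall f, model_space Th1 f -> model_space Th2 (A f),
      forall f g, model_space Th1 f -> model_space Th1 g ->
        ae_equal f g -> ae_equal (A f) (A g),
      forall (a : R[i]) f g, model_space Th1 f -> model_space Th1 g ->
        ae_equal (A (fun z => a *: f z + g z)) (fun z => a *: A f z + A g z)
    & exists M : R, forall f, model_space Th1 f -> L2norm (A f) <= M * L2norm f].

(* The bounded operators [A] that extend [f |-> P_{Th2} (Phi f)], defined on
   the dense subspace [model_space_inf Th1], for some [Phi]. *)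
Definition MT Th1 Th2 : set ((T -> H) -> (T -> H)) :=
  [set A | bounded_operator Th1 Th2 A /\
     exists2 Phi, L2op Phi & forall f, model_space_inf Th1 f ->
       is_projection (model_space Th2) (op_mul Phi f) (A f)].

End Hardy.

(* Main.v *)
Require Import Defs.
From HB Require Import structures.
From mathcomp Require Import all_boot all_order all_algebra.
From mathcomp Require Import complex.
From mathcomp Require Import all_classical all_reals all_analysis.
From mathcomp Require Import measurable_realfun ring lra.
Set Implicit Arguments.
Unset Strict Implicit.
Unset Printing Implicit Defensive.
Import Order.TTheory GRing.Theory Num.Theory.
Import numFieldNormedType.Exports.
Local Open Scope classical_set_scope.
Local Open Scope complex_scope.
Local Open Scope ring_scope.

(** A function [f] in [K_Theta] is orthogonal to [D_Theta] iff [f(0) = 0], and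
    [f |-> z^-1 f] maps these functions bijectively onto the part of [K_Theta]
    orthogonal to the codefect space.  Hence (a)-(d) all say that
    [<A S^*f, S^*g> = <A f, g>] whenever [f(0) = g(0) = 0].

    If [A] has a symbol, this holds for bounded [f] because multiplication by
    the symbol commutes with multiplication by [z]; purity makes [1 - T T^*]
    invertible for [T = Theta_1(0)], so that subtracting a reproducing kernel at
    the origin projects a bounded dense subset of [K_Theta1] onto a bounded
    dense subset of the functions vanishing at the origin.

    Conversely, if the form [t(f, g) = <A f, g> - <A S^*f, S^*g>] vanishes when
    [f(0) = g(0) = 0], then purity and the Riesz representation theorem give
    [t(f, g) = <Psi f(0), g> + <f, X g(0)>] with [Psi] and [X] valued in [H^2].
    Summing [t(S^*^n f, S^*^n g)] over [n < N] telescopes, and the remainder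
    tends to [0] since [S^*^N g] does: [A] has the symbol [Psi + X^*].

    Fourier inversion rests on the fact that a function with vanishing Fourier
    coefficients integrates to [0] over every arc. *)

(** * Measurability and integration of complex functions on the circle *)

Section ComplexIntegral.
Variable R : realType.
Local Notation m := (circle_leb R).
Local Notation T := (circle R).
Implicit Types (u v w : T -> R[i]) (g h : T -> R) (a : R[i]).

(** A symbol is only in [L2op], so it multiplies bounded functions only, and each passage to the
    whole model space needs explicit bounded approximants. They are projected monomials: Theta^* z^n
    x has no frequency above [n], so the projection of z^n x differs from it by Theta times a
    polynomial and is bounded ([pmono]). This gives the density of the bounded functions and, with
    Riesz-Fischer, the representation theorem on the model space ([K_riesz]).

    The two halves of the symbol arise differently. Split f into a kernel function at the origin
    with the value f(0) and a part vanishing there. On the kernel part, t is written with A and with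
    multiplication by z, the adjoint of S^* on H^2; this gives Psi explicitly. On the vanishing
    part, t depends on g only through g(0); no adjoint of A is at hand, so X comes from representing
    a bounded functional.

    Functions equal almost everywhere are not identified. Hence the inner product is only
    semidefinite, A is linear only up to null sets, and identities are stated through the form. *)

Definition cmeasurable u : Prop :=
  measurable_fun setT (fun z => complex.Re (u z)) /\
  measurable_fun setT (fun z => complex.Im (u z)).

Definition cintegrable u : Prop :=
  m.-integrable setT (fun z => (complex.Re (u z))%:E) /\
  m.-integrable setT (fun z => (complex.Im (u z))%:E).

Lemma ReM (x y : R[i]) : complex.Re (x * y) =
  complex.Re x * complex.Re y - complex.Im x * complex.Im y.
Proof. by case: x => ? ?; case: y. Qed.

Lemma ImM (x y : R[i]) : complex.Im (x * y) =
  complex.Re x * complex.Im y + complex.Im x * complex.Re y.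
Proof. by case: x => ? ?; case: y. Qed.

Lemma ReD (x y : R[i]) : complex.Re (x + y) = complex.Re x + complex.Re y.
Proof. by case: x => ? ?; case: y. Qed.

Lemma ImD (x y : R[i]) : complex.Im (x + y) = complex.Im x + complex.Im y.
Proof. by case: x => ? ?; case: y. Qed.

Lemma ReC (x : R[i]) : complex.Re x^* = complex.Re x.
Proof. by case: x. Qed.

Lemma ImC (x : R[i]) : complex.Im x^* = - complex.Im x.
Proof. by case: x. Qed.

Lemma complex_ext (x y : R[i]) : complex.Re x = complex.Re y ->
  complex.Im x = complex.Im y -> x = y.
Proof. by case: x => ? ?; case: y => ? ? /= -> ->. Qed.

Lemma measurable_fun_integrable g :
  m.-integrable setT (EFin \o g) -> measurable_fun setT g.
Proof. by move=> /measurable_int/measurable_EFinP. Qed.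

Lemma cintegrable_measurable u : cintegrable u -> cmeasurable u.
Proof. by move=> [/measurable_fun_integrable ? /measurable_fun_integrable ?]. Qed.

Lemma cmeasurable_cst a : cmeasurable (fun=> a).
Proof. by split; exact: measurable_cst. Qed.

Lemma cmeasurableD u v : cmeasurable u -> cmeasurable v ->
  cmeasurable (fun z => u z + v z).
Proof.
move=> [? ?] [? ?]; split.
- by under eq_fun do rewrite ReD; exact: measurable_funD.
- by under eq_fun do rewrite ImD; exact: measurable_funD.
Qed.

Lemma cmeasurableM u v : cmeasurable u -> cmeasurable v ->
  cmeasurable (fun z => u z * v z).
Proof.
move=> [? ?] [? ?]; split.
- by under eq_fun do rewrite ReM;
    apply: measurable_funB; exact: measurable_funM.
- by under eq_fun do rewrite ImM;
    apply: measurable_funD; exact: measurable_funM.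
Qed.

Lemma cmeasurableC u : cmeasurable u -> cmeasurable (fun z => (u z)^*).
Proof.
move=> [? ?]; split.
- by under eq_fun do rewrite ReC.
- by under eq_fun do rewrite ImC; exact: measurableT_comp.
Qed.

Lemma cmeasurable_sum (I : Type) (s : seq I) (F : I -> T -> R[i]) :
  (forall i, cmeasurable (F i)) ->
  cmeasurable (fun z => \sum_(i <- s) F i z).
Proof.
move=> mF; elim: s => [|i s IH].
  by under eq_fun do rewrite big_nil; exact: cmeasurable_cst.
by under eq_fun do rewrite big_cons; exact: cmeasurableD.
Qed.

(** The sigma-algebra of the circle is the quotient by [expit], so the claim reduces to the
    continuity of [cos] and [sin]. *)
Lemma cmeasurable_val : cmeasurable (fun z : T => sval z).
Proof.
split=> _ B mB; rewrite setTI.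
- have := continuous_measurable_fun (@continuous_cos R).
  by move=> /(_ measurableT _ mB); rewrite setTI.
- have := continuous_measurable_fun (@continuous_sin R).
  by move=> /(_ measurableT _ mB); rewrite setTI.
Qed.

Lemma circle_mulC (z : T) : sval z * (sval z)^* = 1.
Proof. by rewrite -normCK (eqP (svalP z)) expr1n. Qed.

Lemma circle_neq0 (z : T) : sval z != 0.
Proof. by rewrite -normr_eq0 (eqP (svalP z)) oner_eq0. Qed.

Lemma circle_inv (z : T) : (sval z)^-1 = (sval z)^*.
Proof. by apply: (mulfI (circle_neq0 z)); rewrite circle_mulC divff ?circle_neq0. Qed.

Lemma circle_exprC (z : T) (n : int) : (sval z ^ n)^* = sval z ^ (- n).
Proof.
rewrite -exprz_inv circle_inv; apply: (rmorphXz (@Num.conj R[i])).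
by rewrite unitfE circle_neq0.
Qed.

Lemma cmeasurable_exprz (n : int) : cmeasurable (fun z : T => sval z ^ n).
Proof.
have nP k : cmeasurable (fun z : T => sval z ^+ k).
  elim: k => [|k IH]; first by under eq_fun do rewrite expr0; exact: cmeasurable_cst.
  by under eq_fun do rewrite exprS; apply: cmeasurableM => //; exact: cmeasurable_val.
case: n => k; first exact: nP.
under eq_fun do rewrite NegzE -circle_exprC.
by apply: cmeasurableC; exact: nP.
Qed.

Lemma cintegrable_scale a u : cintegrable u -> cintegrable (fun z => a * u z).
Proof.
move=> [iu1 iu2]; split.
- under eq_fun do rewrite ReM EFinB !EFinM.
  by apply: integrableB => //; exact: integrableZl.
- under eq_fun do rewrite ImM EFinD !EFinM.
  by apply: integrableD => //; exact: integrableZl.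
Qed.

Lemma cintegrableD u v : cintegrable u -> cintegrable v ->
  cintegrable (fun z => u z + v z).
Proof.
move=> [? ?] [? ?]; split.
- by under eq_fun do rewrite ReD EFinD; exact: integrableD.
- by under eq_fun do rewrite ImD EFinD; exact: integrableD.
Qed.

Lemma cintegralD u v : cintegrable u -> cintegrable v ->
  cintegral (fun z => u z + v z) = cintegral u + cintegral v.
Proof.
move=> [? ?] [? ?]; apply: complex_ext; rewrite /cintegral ?ReD ?ImD /=.
- by under eq_Rintegral do rewrite ReD; rewrite RintegralD.
- by under eq_Rintegral do rewrite ImD; rewrite RintegralD.
Qed.

Lemma integrable_scale (c : R) g : m.-integrable setT (EFin \o g) ->
  m.-integrable setT (EFin \o (fun z => c * g z)).
Proof.
by move=> ig; rewrite (_ : _ \o _ = (fun z => c%:E * (g z)%:E)%E)//; exact: integrableZl.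
Qed.

Lemma integrable_addr g h : m.-integrable setT (EFin \o g) ->
  m.-integrable setT (EFin \o h) ->
  m.-integrable setT (EFin \o (fun z => g z + h z)).
Proof.
by move=> ig ih; rewrite (_ : _ \o _ = (fun z => (g z)%:E + (h z)%:E)%E)//; exact: integrableD.
Qed.

Lemma integrable_normr g : m.-integrable setT (EFin \o g) ->
  m.-integrable setT (EFin \o (fun z => `|g z|)).
Proof.
move=> ig; have mg := measurable_fun_integrable ig.
apply: (le_integrable measurableT _ _ ig).
  by apply/measurable_EFinP; exact: measurableT_comp.
by move=> z _ /=; rewrite normr_id.
Qed.

Lemma cintegralZ a u : cintegrable u ->
  cintegral (fun z => a * u z) = a * cintegral u.
Proof.
move=> [i1 i2]; apply: complex_ext; rewrite /cintegral ?ReM ?ImM /=.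
- under eq_Rintegral do rewrite ReM.
  by rewrite RintegralB ?RintegralZl//; exact: integrable_scale.
- under eq_Rintegral do rewrite ImM.
  by rewrite RintegralD ?RintegralZl//; exact: integrable_scale.
Qed.

Lemma cintegral_conj u : cintegrable u ->
  cintegral (fun z => (u z)^*) = (cintegral u)^*.
Proof.
move=> [i1 i2]; apply: complex_ext; rewrite /cintegral ?ReC ?ImC /=.
- by under eq_Rintegral do rewrite ReC.
- under eq_Rintegral do rewrite ImC -mulN1r.
  by rewrite RintegralZl// mulN1r.
Qed.

Lemma cintegrable_sum (I : Type) (s : seq I) (F : I -> T -> R[i]) :
  (forall i, cintegrable (F i)) -> cintegrable (fun z => \sum_(i <- s) F i z).
Proof.
move=> iF; elim: s => [|i s IH].
  by under eq_fun do rewrite big_nil; split; exact: integrable0.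
by under eq_fun do rewrite big_cons; exact: cintegrableD.
Qed.

Lemma cintegral_sum (I : Type) (s : seq I) (F : I -> T -> R[i]) :
  (forall i, cintegrable (F i)) ->
  cintegral (fun z => \sum_(i <- s) F i z) = \sum_(i <- s) cintegral (F i).
Proof.
move=> iF; elim: s => [|i s IH].
  under eq_fun do rewrite big_nil; rewrite big_nil; apply: complex_ext => /=;
  by rewrite Rintegral_cst// mul0r.
under eq_fun do rewrite big_cons; rewrite cintegralD// ?IH ?big_cons//.
exact: cintegrable_sum.
Qed.

Lemma integrable_le g h : measurable_fun setT g ->
  m.-integrable setT (EFin \o h) -> (forall z, `|g z| <= h z) ->
  m.-integrable setT (EFin \o g).
Proof.
move=> mg ih gh; apply: le_integrable ih => //; first exact/measurable_EFinP.
by move=> z _ /=; rewrite lee_fin; apply: le_trans (gh z) (ler_norm _).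
Qed.

(** The pointwise comparison is made with [max(|h|, |g|)], which dominates [|g|] everywhere and
    equals [|h|] almost everywhere. *)
Lemma integrable_le_ae g h : measurable_fun setT g ->
  m.-integrable setT (EFin \o h) -> {ae m, forall z, `|g z| <= h z} ->
  m.-integrable setT (EFin \o g).
Proof.
move=> mg ih gh; apply/integrableP; split; first exact/measurable_EFinP.
have mh := measurable_fun_integrable ih.
have : (\int[m]_x `|(EFin \o (fun z => Num.max `|h z|%R `|g z|%R)) x| < +oo)%E.
  rewrite (@ae_eq_integral _ _ _ _ _ (fun x => `|(h x)%:E|%E))//.
  - by move/integrableP: ih => [].
  - apply: measurableT_comp => //; apply/measurable_EFinP.
    by apply: measurable_maxr; exact: measurableT_comp.
  - by apply: measurableT_comp => //; exact/measurable_EFinP.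
  - apply: filterS gh => z gz _ /=; rewrite max_l ?normr_id//.
    exact: le_trans gz (ler_norm _).
apply: le_lt_trans; apply: ge0_le_integral => //.
- by apply: measurableT_comp => //; exact/measurable_EFinP.
- apply: measurableT_comp => //; apply/measurable_EFinP.
  by apply: measurable_maxr; exact: measurableT_comp.
- move=> z _; rewrite !abse_EFin lee_fin.
  apply: le_trans (ler_norm _); rewrite /= /Order.max; case: ifPn => //.
  by rewrite -leNgt.
Qed.

End ComplexIntegral.

(** * Completeness of the real L^2 space along fast Cauchy sequences *)

Section L2Scalar.
Variable R : realType.
Local Notation m := (circle_leb R).
Local Notation T := (circle R).
Implicit Types (g h : T -> R).

Lemma limn_esup_EFin (u : nat -> R) (l : R) :
  u @ \oo --> l -> limn_esup (EFin \o u) = l%:E.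
Proof.
move=> ul; have ul' : (EFin \o u) @ \oo --> l%:E.
  by apply/cvg_EFin => //; exact: nearW.
rewrite is_cvg_limn_esupE; last by apply/cvg_ex; exists l%:E.
exact/cvg_lim.
Qed.

Lemma limn_einf_le (u : nat -> \bar R) (c : \bar R) :
  (forall n, (u n <= c)%E) -> (limn_einf u <= c)%E.
Proof.
move=> uc; rewrite limn_einf_lim; apply: lime_le; first exact: is_cvg_einfs.
apply: nearW => n; apply: le_trans (uc n).
by apply: ereal_inf_lbound; exists n => /=.
Qed.

Lemma sum_half_le k : \sum_(0 <= n < k) 2^-1 ^+ n <= 2 :> R.
Proof.
suff -> : \sum_(0 <= n < k) 2^-1 ^+ n = 2 - 2 * 2^-1 ^+ k :> R.
  by rewrite lerBlDr lerDl mulr_ge0// exprn_ge0.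
elim: k => [|k IH]; first by rewrite big_nil expr0; lra.
rewrite big_nat_recr//= IH exprS; lra.
Qed.

(* A squared bound [4^-n] on consecutive differences telescopes through
   [(x + y)^2 <= 2 x^2 + 2 y^2]. *)
Lemma fast_cauchy_bound (g : nat -> T -> R) :
  (forall n, measurable_fun setT (g n)) ->
  (forall n, (\int[m]_z ((g n.+1 z - g n z) ^+ 2)%:E <= (4^-1 ^+ n)%:E)%E) ->
  forall k n, (\int[m]_z ((g (n + k)%N z - g n z) ^+ 2)%:E <= (4 * 4^-1 ^+ n)%:E)%E.
Proof.
move=> mg gg; elim=> [|k IH] n.
  rewrite addn0; under eq_integral do rewrite subrr expr0n /=.
  by rewrite integral0 lee_fin mulr_ge0// exprn_ge0.
have mB i j : measurable_fun setT (fun z => (g i z - g j z) ^+ 2).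
  by apply: measurable_funX; exact: measurable_funB.
have m2 i j : measurable_fun setT (fun z => (2%:E * ((g i z - g j z) ^+ 2)%:E)%E).
  by under eq_fun do rewrite -EFinM; apply/measurable_EFinP; apply: measurable_funM.
apply: (@le_trans _ _ (\int[m]_z
  (2%:E * ((g n.+1 z - g n z) ^+ 2)%:E + 2%:E * ((g (n.+1 + k)%N z - g n.+1 z) ^+ 2)%:E))%E).
  apply: ge0_le_integral => //.
  - by move=> z _; rewrite lee_fin sqr_ge0.
  - exact/measurable_EFinP.
  - by apply: emeasurable_funD.
  - move=> z _; rewrite -!EFinM -EFinD lee_fin addSnnS.
    set x := g n z; set y := g n.+1 z; set w := g _ z.
    by have := sqr_ge0 (w - y - (y - x)); nra.
rewrite ge0_integralD//; [|by move=> z _; rewrite -EFinM lee_fin mulr_ge0// sqr_ge0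
                          |by move=> z _; rewrite -EFinM lee_fin mulr_ge0// sqr_ge0].
rewrite !ge0_integralZl_EFin//; [|by move=> z _; rewrite lee_fin sqr_ge0|exact/measurable_EFinP
  |by move=> z _; rewrite lee_fin sqr_ge0|exact/measurable_EFinP].
(* The constant [4] is the fixed point of the recursion: 2 + 2 * 4 / 4 = 4. *)
apply: (@le_trans _ _ (2%:E * (4^-1 ^+ n)%:E + 2%:E * (4 * 4^-1 ^+ n.+1)%:E)%E).
  by apply: leeD; apply: lee_pmul => //; apply: integral_ge0 => z _; rewrite lee_fin sqr_ge0.
by rewrite -!EFinM -EFinD lee_fin exprS; have : (0:R) <= 4^-1 ^+ n by []; lra.
Qed.

Lemma integral_circle_cst (c : R) : (\int[m]_z c%:E = c%:E)%E.
Proof.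
rewrite integral_cst//; transitivity (c%:E * 1)%E; last by rewrite mule1.
by congr (_ * _)%E; exact: probability_setT.
Qed.

(** For an increment d, |d| <= (2^-n + 2^n d^2) / 2, and the measure is a probability, so the n-th
    increment has integral at most 2^-n in absolute value. The series of absolute increments then
    has integral at most 2, is finite almost everywhere, and the telescoping series converges
    absolutely there. *)
Lemma ae_cvg_fast_cauchy (g : nat -> T -> R) :
  (forall n, measurable_fun setT (g n)) ->
  (forall n, (\int[m]_z ((g n.+1 z - g n z) ^+ 2)%:E <= (4^-1 ^+ n)%:E)%E) ->
  {ae m, forall z, cvgn (g ^~ z)}.
Proof.
move=> mg gg.
have md n : measurable_fun setT (fun z => (`|g n.+1 z - g n z|)%:E).
  by apply/measurable_EFinP; apply: measurableT_comp => //; exact: measurable_funB.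
have d1 n : (\int[m]_z (`|g n.+1 z - g n z|)%:E <= (2^-1 ^+ n)%:E)%E.
  apply: (@le_trans _ _ (\int[m]_z ((2^-1 * 2^-1 ^+ n)%:E +
      (2^-1 * 2 ^+ n)%:E * ((g n.+1 z - g n z) ^+ 2)%:E))%E).
    apply: ge0_le_integral => //.
    - under eq_fun do rewrite -EFinM; apply: emeasurable_funD => //.
      by apply/measurable_EFinP; apply: measurable_funM => //;
        apply: measurable_funX; exact: measurable_funB.
    - move=> z _; rewrite -EFinM -EFinD lee_fin.
      set x := g n.+1 z - g n z.
      have : (2 ^+ n : R) * 2^-1 ^+ n = 1 by rewrite -exprMn divff// expr1n.
      set p := 2 ^+ n; set q := 2^-1 ^+ n => pq.
      have p0 : 0 < p by rewrite exprn_gt0.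
      have -> : q = p^-1 by apply: (mulfI (lt0r_neq0 p0)); rewrite pq divff// lt0r_neq0.
      rewrite -(real_normK (num_real x)).
      have := sqr_ge0 (1 - p * `|x|) => h.
      rewrite -(ler_pM2l p0).
      rewrite [leRHS](_ : _ = 2^-1 * (1 + (p * `|x|) ^+ 2)); last by field; rewrite lt0r_neq0.
      nra.
  rewrite ge0_integralD//; last 2 first.
  - move=> z _; rewrite -EFinM lee_fin; apply: mulr_ge0; last exact: sqr_ge0.
    by apply: mulr_ge0 => //; exact: exprn_ge0.
  - have : measurable_fun setT (EFin \o
        (fun z => (2^-1 * 2 ^+ n) * (g n.+1 z - g n z) ^+ 2)); last by [].
    by apply/measurable_EFinP; apply: measurable_funM => //;
        apply: measurable_funX; exact: measurable_funB.
  rewrite integral_circle_cst ge0_integralZl_EFin//; last 2 first.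
  - by move=> z _; rewrite lee_fin sqr_ge0.
  - by apply/measurable_EFinP; apply: measurable_funX; exact: measurable_funB.
  apply: (@le_trans _ _ ((2^-1 * 2^-1 ^+ n)%:E + (2^-1 * 2 ^+ n)%:E * (4^-1 ^+ n)%:E)%E).
    by apply: leeD => //; apply: lee_pmul => //;
      [apply: integral_ge0 => z _; rewrite lee_fin sqr_ge0].
  rewrite -EFinM -EFinD lee_fin -mulrA -exprMn.
  rewrite (_ : 2 / 4 = 2^-1 :> R); last by field.
  by rewrite -mulrDl (_ : 2^-1 + 2^-1 = 1 :> R) ?mul1r//; field.
have S2 : (\int[m]_z (\sum_(0 <= n <oo) (`|g n.+1 z - g n z|)%:E) <= 2%:E)%E.
  rewrite integral_nneseries//.
  apply: lime_le; first by apply: is_cvg_nneseries => n _ _; apply: integral_ge0.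
  apply: nearW => k; apply: (@le_trans _ _ (\sum_(0 <= n < k) (2^-1 ^+ n)%:E)%E).
    by apply: lee_sum => n _.
  by rewrite sumEFin lee_fin sum_half_le.
have : {ae m, forall z, setT z -> (\sum_(0 <= n <oo) (`|g n.+1 z - g n z|)%:E)%E \is a fin_num}.
  apply: integrable_ae => //; apply/integrableP; split.
    by apply: ge0_emeasurable_sum.
  apply: (le_lt_trans _ (ltry 2)); apply: le_trans S2.
  by under eq_integral do rewrite gee0_abs ?nneseries_ge0//.
apply: filterS => z /(_ I) fz.
have : cvgn (series (fun n => `|g n.+1 z - g n z|)).
  apply: nnseries_is_cvg => //.
  by rewrite ltey_eq fz.
move=> /normed_cvg/cvg_ex[l sl].
apply/cvg_ex; exists (l + g 0%N z).
have -> : g ^~ z = (fun n => series (fun k => g k.+1 z - g k z) n + g 0%N z).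
  by apply/funext => n; rewrite /series /= telescope_sumr// subrK.
by apply: cvgD => //; exact: cvg_cst.
Qed.

(** The limit is almost everywhere pointwise; the rate follows from Fatou's lemma applied to the
    tails bounded by [fast_cauchy_bound]. *)
Lemma L2_complete_real (g : nat -> T -> R) :
  (forall n, measurable_fun setT (g n)) ->
  (forall n, (\int[m]_z ((g n.+1 z - g n z) ^+ 2)%:E <= (4^-1 ^+ n)%:E)%E) ->
  exists2 f : T -> R, measurable_fun setT f &
  forall n, (\int[m]_z ((f z - g n z) ^+ 2)%:E <= (4 * 4^-1 ^+ n)%:E)%E.
Proof.
move=> mg gg.
have aecvg := ae_cvg_fast_cauchy mg gg.
(* The upper limit is defined and measurable everywhere, also where the sequence diverges; [fine]
   then makes it real-valued. *)
pose F z := limn_esup (EFin \o (g ^~ z)).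
have mF : measurable_fun setT F.
  by apply: measurable_fun_limn_esup => n; exact/measurable_EFinP.
exists (fine \o F); first exact: measurableT_comp.
move=> n.
have mB k : measurable_fun setT (fun z => ((g (n + k)%N z - g n z) ^+ 2)%:E).
  by apply/measurable_EFinP; apply: measurable_funX; exact: measurable_funB.
apply: (@le_trans _ _ (\int[m]_z limn_einf (fun k => ((g (n + k)%N z - g n z) ^+ 2)%:E))%E).
  rewrite le_eqVlt; apply/orP; left; apply/eqP; apply: ae_eq_integral => //.
  - by apply/measurable_EFinP; apply: measurable_funX; apply: measurable_funB => //;
      exact: measurableT_comp.
  - under eq_fun do rewrite /limn_einf; apply: measurableT_comp => //.
    by apply: measurable_fun_limn_esup => k; exact: measurableT_comp.
  - apply: (filterS _ aecvg) => z /cvg_ex[l gl] _ /=.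
    rewrite /F (limn_esup_EFin gl) /=.
    have gn : (fun k => ((g (n + k)%N z - g n z) ^+ 2)%:E) @ \oo --> ((l - g n z) ^+ 2)%:E.
      apply/cvg_EFin; first exact: nearW.
      have gl' : (fun k => g (n + k)%N z) @ \oo --> l.
        rewrite (_ : (fun k => _) = (fun k => g (k + n)%N z)); last first.
          by apply/funext => k; rewrite addnC.
        by rewrite (cvg_shiftn n (g ^~ z)).
      have : (fun k => g (n + k)%N z - g n z) @ \oo --> l - g n z.
        by apply: cvgB => //; exact: cvg_cst.
      by move=> h; apply: cvgM.
    by rewrite is_cvg_limn_einfE; [apply/esym/cvg_lim|apply/cvg_ex; eexists; exact: gn].
apply: le_trans; first by apply: fatou => // k z _; rewrite lee_fin sqr_ge0.
by apply: limn_einf_le => k; exact: fast_cauchy_bound.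
Qed.

End L2Scalar.

(** * Integrals over the circle as integrals over [0, 2 pi]; orthogonality of the characters *)

Section CircleMeasure.
Variable R : realType.
Local Notation m := (circle_leb R).
Local Notation T := (circle R).
Local Notation mu := (@lebesgue_measure R).
Local Notation I := `[0, 2 * pi]%classic.
Implicit Types (g : T -> R) (u : T -> R[i]).

Lemma integral_circle_ge0 (f : T -> \bar R) : measurable_fun setT f ->
  (forall z, 0 <= f z)%E ->
  (\int[m]_z f z = ((2 * pi)^-1)%:E * \int[mu]_(t in I) f (expit t))%E.
Proof.
move=> mf f0; rewrite /circle_leb ge0_integral_distribution//.
have mfe : measurable_fun setT (f \o @expit R).
  exact: measurableT_comp mf (@measurable_expit R).
rewrite (integral_uniform _ mfe) ?subr0// => x.
exact: f0.
Qed.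

Lemma integrable_circle g : m.-integrable setT (EFin \o g) ->
  mu.-integrable I (EFin \o (g \o @expit R)).
Proof.
move=> /integrableP[/measurable_EFinP mg ig]; apply/integrableP; split.
  apply/measurable_EFinP; apply: measurable_funTS.
  by apply: measurableT_comp => //; exact: measurable_expit.
move: ig; rewrite integral_circle_ge0//; last first.
  by apply: measurableT_comp => //; exact/measurable_EFinP.
rewrite /comp; set x := (\int[mu]_(t in I) _)%E.
have : (0 <= x)%E by exact: integral_ge0.
case: x => [r _ _|_|//]; first exact: ltry.
by rewrite mulry gtr0_sg ?invr_gt0 ?twopi_gt0// mul1e ltxx.
Qed.

(** The change of variables holds for nonnegative functions, so it is applied to the positive and
    the negative part; integrability lets [fine] commute with their difference. *)
Lemma integral_circle g : m.-integrable setT (EFin \o g) ->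
  \int[m]_z g z = (2 * pi)^-1 * \int[mu]_(t in I) g (expit t).
Proof.
move=> ig; have ig' := integrable_circle ig.
have mg := measurable_int _ ig.
have mI : @measurable _ (measurableTypeR R) I by exact: measurable_itv.
set c := (2 * pi)^-1.
pose h := EFin \o (g \o @expit R).
have E1 : (\int[m]_z (g z)%:E =
    c%:E * (\int[mu]_(t in I) h^\+ t) - c%:E * (\int[mu]_(t in I) h^\- t))%E.
  rewrite integralE (integral_circle_ge0 (measurable_funepos mg))//.
  rewrite (integral_circle_ge0 (measurable_funeneg mg)); last first.
    by move=> z; exact: funeneg_ge0.
  by congr (_ - _)%E; congr (_ * _)%E; apply: eq_integral => t _;
    rewrite ?funeposE ?funenegE.
have E2 : (\int[mu]_(t in I) (g (expit t))%:E =
    (\int[mu]_(t in I) h^\+ t) - (\int[mu]_(t in I) h^\- t))%E.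
  by rewrite integralE.
have fp := integrable_pos_fin_num mI ig'.
have fn := integrable_neg_fin_num mI ig'.
rewrite /Rintegral E1 E2 -(fineK fp) -(fineK fn) -!EFinM -!EFinB /=.
by rewrite mulrBr.
Qed.

Lemma FTC_derive (f F : R -> R) (a b : R) : a < b ->
  (forall x : R, is_derive x (1:R) F (f x)) -> continuous f ->
  \int[mu]_(t in `[a, b]) f t = F b - F a.
Proof.
move=> ab dF cf.
have cF : continuous F.
  by move=> x; apply: differentiable_continuous; apply/derivable1_diffP; case: (dF x).
rewrite /Rintegral (@continuous_FTC2 _ f F)//.
- exact: continuous_subspaceT.
- split.
  + by move=> x _; case: (dF x).
  + exact/cvg_at_right_filter/cF.
  + exact/cvg_at_left_filter/cF.
- by move=> x _; rewrite derive1E; apply: derive_val.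
Qed.

Lemma expit_exprn (t : R) (n : nat) :
  sval (expit t) ^+ n = cos (n%:R * t) +i* sin (n%:R * t).
Proof.
elim: n => [|n IH]; first by rewrite mul0r cos0 sin0 expr0.
rewrite exprS IH -natr1 mulrDl mul1r cosD sinD /=.
by apply: complex_ext; rewrite ?ReM ?ImM /=; ring.
Qed.

Lemma cos_sin_2pin (n : nat) :
  cos (n%:R * (2 * pi) : R) = 1 /\ sin (n%:R * (2 * pi) : R) = 0.
Proof.
have [c s] : cos (2 * pi : R) = 1 /\ sin (2 * pi : R) = 0.
  split; first by have := @cosD2pi R 0; rewrite add0r cos0 mulr_natl.
  by have := @sinD2pi R 0; rewrite add0r sin0 mulr_natl.
elim: n => [|n [IH1 IH2]]; first by rewrite mul0r cos0 sin0.
by rewrite -natr1 mulrDl mul1r cosD sinD c s IH1 IH2; split; ring.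
Qed.

Lemma integral_cos_sin (n : nat) : (0 < n)%N ->
  \int[mu]_(t in I) cos (n%:R * t) = 0 /\ \int[mu]_(t in I) sin (n%:R * t) = 0.
Proof.
move=> n0; have nn : n%:R != 0 :> R by rewrite pnatr_eq0 -lt0n.
have dm (x : R) : is_derive x (1:R) ( *%R n%:R) (n%:R : R).
  have h := is_deriveZ (n%:R : R) (is_derive_id x (1 : R)).
  by apply: is_derive_eq h _; rewrite /GRing.scale /= mulr1.
have cm : continuous ( *%R n%:R : R -> R) by exact: mulrl_continuous.
have [c s] := cos_sin_2pin n.
split.
- have dF (x : R) : is_derive x (1:R) (fun t => n%:R^-1 * sin (n%:R * t)) (cos (n%:R * x)).
    have h := @is_derive1_comp _ sin ( *%R n%:R) x _ _ (is_derive_sin _) (dm x).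
    have h' := is_deriveZ (n%:R^-1 : R) h.
    by apply: is_derive_eq h' _; rewrite /GRing.scale /= mulrCA mulVf ?mulr1.
  rewrite (FTC_derive (twopi_gt0 R) dF); first by rewrite mulr0 sin0 s; ring.
  by move=> x; apply: continuous_comp; [exact: cm|exact: continuous_cos].
- have dF (x : R) : is_derive x (1:R) (fun t => - n%:R^-1 * cos (n%:R * t)) (sin (n%:R * x)).
    have h := @is_derive1_comp _ cos ( *%R n%:R) x _ _ (is_derive_cos _) (dm x).
    have h' := is_deriveZ (- n%:R^-1 : R) h.
    by apply: is_derive_eq h' _; rewrite /GRing.scale /= mulrA mulrNN mulrAC mulVf ?mul1r.
  rewrite (FTC_derive (twopi_gt0 R) dF); first by rewrite mulr0 cos0 c; ring.
  by move=> x; apply: continuous_comp; [exact: cm|exact: continuous_sin].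
Qed.

Lemma integrable_bounded g (M : R) : measurable_fun setT g ->
  (forall z, `|g z| <= M) -> m.-integrable setT (EFin \o g).
Proof.
move=> mg gM; apply: (@integrable_le _ _ (cst M)) => //.
by apply: finite_measure_integrable_cst.
Qed.

Lemma normr_Re (x : R[i]) : `|complex.Re x| <= complex.Re `|x|.
Proof.
rewrite normc_def /= -sqrtr_sqr; apply: ler_wsqrtr.
by rewrite lerDl sqr_ge0.
Qed.

Lemma normr_Im (x : R[i]) : `|complex.Im x| <= complex.Re `|x|.
Proof.
rewrite normc_def /= -sqrtr_sqr; apply: ler_wsqrtr.
by rewrite lerDr sqr_ge0.
Qed.

Lemma norm_exprz (z : T) (n : int) : `|sval z ^ n| = 1.
Proof.
by case: n => n; rewrite ?NegzE -?exprnN ?normfV normrX (eqP (svalP z)) expr1n ?invr1.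
Qed.

Lemma cintegrable_bounded u (M : R) : cmeasurable u ->
  (forall z, complex.Re `|u z| <= M) -> cintegrable u.
Proof.
move=> [mu1 mu2] uM; split.
- by apply: (integrable_bounded (M := M) mu1) => z; apply: le_trans (normr_Re _) (uM z).
- by apply: (integrable_bounded (M := M) mu2) => z; apply: le_trans (normr_Im _) (uM z).
Qed.

Lemma cintegrable_exprz (n : int) : cintegrable (fun z : T => sval z ^ n).
Proof.
apply: (cintegrable_bounded (M := 1)); first exact: cmeasurable_exprz.
by move=> z; rewrite norm_exprz.
Qed.

Lemma cintegral_exprz (n : int) :
  cintegral (fun z : T => sval z ^ n) = (n == 0)%:R.
Proof.
have nP k : cintegral (fun z : T => sval z ^+ k) = (k == 0)%:R.
  have [i1 i2] := cintegrable_exprz k.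
  apply: complex_ext => /=.
  - rewrite (integral_circle i1); under eq_Rintegral do rewrite -exprnP expit_exprn /=.
    case: k {i1 i2} => [|k]; last by rewrite (integral_cos_sin _).1// mulr0.
    under eq_Rintegral do rewrite mul0r cos0.
    rewrite Rintegral_cst//= lebesgue_measure_itv /= lte_fin twopi_gt0 -EFinB /= subr0.
    by rewrite mul1r mulVf// gt_eqF// twopi_gt0.
  - rewrite (integral_circle i2); under eq_Rintegral do rewrite -exprnP expit_exprn /=.
    case: k {i1 i2} => [|k]; last by rewrite (integral_cos_sin _).2// mulr0.
    under eq_Rintegral do rewrite mul0r sin0.
    by rewrite Rintegral_cst//= mul0r mulr0.
case: n => k; first exact: nP.
rewrite NegzE; under eq_fun do rewrite -circle_exprC.
by rewrite cintegral_conj ?nP ?conjC0//; exact: cintegrable_exprz.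
Qed.

End CircleMeasure.

(** * Polynomials converging pointwise to a step function *)

Section StepPolynomial.
Variable R : realType.
Implicit Types (x y r : R).

Lemma bernoulli_sub x n : 0 <= x <= 1 -> 1 - n%:R * x <= (1 - x) ^+ n.
Proof.
move=> /andP[x0 x1]; elim: n => [|n IH]; first by rewrite mul0r subr0 expr0.
rewrite exprS; apply: (@le_trans _ _ ((1 - x) * (1 - n%:R * x))).
  rewrite -natr1 -subr_ge0.
  rewrite (_ : _ - _ = n%:R * x ^+ 2); last by ring.
  by rewrite mulr_ge0// sqr_ge0.
by apply: ler_wpM2l => //; rewrite subr_ge0.
Qed.

(** By Bernoulli, (1 - x)^n (1 + n x) <= (1 - x)^n (1 + x)^n = (1 - x^2)^n <= 1. *)
Lemma bernoulli_inv x n : 0 <= x <= 1 -> (1 - x) ^+ n <= (1 + n%:R * x)^-1.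
Proof.
move=> /andP[x0 x1].
have h : 1 + n%:R * x <= (1 + x) ^+ n.
  elim: n => [|n IH]; first by rewrite mul0r addr0 expr0.
  rewrite exprS; apply: (@le_trans _ _ ((1 + x) * (1 + n%:R * x))).
    rewrite -natr1 -subr_ge0 (_ : _ - _ = n%:R * x ^+ 2); last by ring.
    by rewrite mulr_ge0// sqr_ge0.
  by apply: ler_wpM2l => //; rewrite addr_ge0.
have p0 : 0 < 1 + n%:R * x by rewrite ltr_pwDl// mulr_ge0.
rewrite -[leRHS]mul1r ler_pdivlMr//.
apply: (@le_trans _ _ ((1 - x) ^+ n * (1 + x) ^+ n)).
  by apply: ler_wpM2l => //; rewrite exprn_ge0// subr_ge0.
rewrite -exprMn; apply: exprn_ile1; nra.
Qed.

(** With s the square root of r, the geometric sum gives n s^n <= 1 / (1 - s), and n r^n = (n s^n)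
    s^n. *)
Lemma cvg_natr_expr r : 0 <= r < 1 -> (fun n => n%:R * r ^+ n) @ \oo --> (0 : R).
Proof.
move=> /andP[r0 r1].
pose s := Num.sqrt r.
have s0 : 0 <= s by exact: sqrtr_ge0.
have sr : s ^+ 2 = r by rewrite sqr_sqrtr.
have s1 : s < 1 by rewrite -(@ltr_pXn2r _ 2) ?nnegrE// sr expr1n.
have ns n : n%:R * s ^+ n <= (1 - s)^-1.
  rewrite -[leRHS]mul1r ler_pdivlMr ?subr_gt0//.
  apply: (@le_trans _ _ (1 - s ^+ n)); last by rewrite gerBl exprn_ge0.
  elim: n => [|n IH]; first by rewrite !mul0r expr0 subrr.
  have h : 0 <= (1 - s) * (1 - s ^+ n.+1).
    by apply: mulr_ge0; rewrite subr_ge0; [exact: ltW|exact: exprn_ile1 s0 (ltW s1)].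
  rewrite -natr1; have := ler_wpM2l s0 IH; move: h; rewrite !exprS.
  set p := s ^+ n; lra.
apply: (@squeeze_cvgr _ _ _ _ (fun=> 0) (fun n => (1 - s)^-1 * s ^+ n)).
- apply: nearW => n; apply/andP; split.
    by rewrite mulr_ge0// exprn_ge0.
  rewrite -sr -exprM mul2n -addnn exprD mulrA.
  by apply: ler_wpM2r => //; exact: exprn_ge0.
- exact: cvg_cst.
- rewrite -(mulr0 (1 - s)^-1); apply: cvgM; first exact: cvg_cst.
  by apply: cvg_expr; rewrite ger0_norm.
Qed.

(** The polynomials of the elementary proof of Stone-Weierstrass. Everything hinges on (n 2^n) y^n =
    n (2 y)^n, which tends to 0 for y < 1/2 and to infinity for y >= 1/2; the extra factor n decides
    the case y = 1/2, so that the limit is the indicator of a closed half-line. *)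
Definition step_poly y n : R := 1 - (1 - y ^+ n) ^+ (n * 2 ^ n).

Lemma step_poly_itv y n : 0 <= y <= 1 -> 0 <= step_poly y n <= 1.
Proof.
move=> /andP[y0 y1].
have a0 : 0 <= 1 - y ^+ n by rewrite subr_ge0 exprn_ile1.
have a1 : 1 - y ^+ n <= 1 by rewrite gerBl exprn_ge0.
by rewrite /step_poly subr_ge0 exprn_ile1//= gerBl exprn_ge0.
Qed.

Lemma cvg_step_poly y : 0 <= y <= 1 ->
  (step_poly y) @ \oo --> ((2^-1 <= y)%R%:R : R).
Proof.
move=> /andP[y0 y1].
have yn n : 0 <= y ^+ n <= 1 by rewrite exprn_ge0//= exprn_ile1.
have [hy|hy] := leP.
- rewrite -[X in _ --> X]subr0; apply: cvgB; first exact: cvg_cst.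
  apply: (@squeeze_cvgr _ _ _ _ (fun=> 0) (fun n => (n.+1%:R)^-1)).
  + apply: nearW => n; apply/andP; split.
      by rewrite exprn_ge0// subr_ge0; case/andP: (yn n).
    apply: le_trans (bernoulli_inv _ (yn n)) _.
    rewrite ler_pV2 ?inE ?unitfE; last 2 first.
    * by rewrite gt_eqF//= ltr_pwDl// mulr_ge0//; case/andP: (yn n).
    * by rewrite gt_eqF//=.
    rewrite -nat1r lerD2l natrM -mulrA ler_peMr// natrX -exprMn.
    by apply: exprn_ege1; rewrite -ler_pdivrMl// mulr1.
  + exact: cvg_cst.
  + exact: cvg_harmonic.
- have ry : 0 <= 2 * y < 1.
    by rewrite mulr_ge0//=; rewrite -ltr_pdivlMl// mulr1.
  apply: (@squeeze_cvgr _ _ _ _ (fun=> 0) (fun n => n%:R * (2 * y) ^+ n)).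
  + apply: nearW => n; apply/andP; split.
      by have /andP[] := step_poly_itv n (introT andP (conj y0 y1)).
    rewrite /step_poly lerBlDr -lerBlDl.
    apply: le_trans (bernoulli_sub _ (yn n)).
    by rewrite natrM natrX exprMn mulrA.
  + exact: cvg_cst.
  + exact: cvg_natr_expr.
Qed.

End StepPolynomial.

(** * Multipliers of functions with vanishing Fourier coefficients *)

Section Multipliers.
Variable R : realType.
Local Notation m := (circle_leb R).
Local Notation T := (circle R).
Implicit Types (p q : T -> R) (u : T -> R[i]).

Definition null_coef u : Prop :=
  cintegrable u /\ forall n : int, cintegral (fun z => sval z ^ n * u z) = 0.

(* The multipliers of null-coefficient functions form an algebra that contains
   the trigonometric polynomials and is closed under bounded pointwise limits,
   so it contains the indicators of arcs. *)
Definition multiplier p : Prop :=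
  [/\ measurable_fun setT p, exists M, forall z, `|p z| <= M
    & forall u, null_coef u -> null_coef (fun z => (p z)%:C * u z)].

Lemma cintegrable_boundedM p (M : R) u : measurable_fun setT p ->
  (forall z, `|p z| <= M) -> cintegrable u ->
  cintegrable (fun z => (p z)%:C * u z).
Proof.
move=> mp pM iu; have [mu1 mu2] := cintegrable_measurable iu.
have b (g : T -> R) : measurable_fun setT g -> m.-integrable setT (EFin \o g) ->
    m.-integrable setT (EFin \o (fun z => p z * g z)).
  move=> mg ig; apply: (integrable_le (h := fun z => M * `|g z|)).
  - exact: measurable_funM.
  - by apply: integrable_scale; exact: integrable_normr.
  - by move=> z; rewrite normrM ler_wpM2r.
case: iu => i1 i2; split.
- under eq_fun do rewrite ReM /= mul0r subr0; exact: (b _ mu1 i1).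
- under eq_fun do rewrite ImM /= mul0r addr0; exact: (b _ mu2 i2).
Qed.

Lemma cintegrable_exprzM (n : int) u : cintegrable u ->
  cintegrable (fun z => sval z ^ n * u z).
Proof.
move=> iu.
have [m1 m2] := cmeasurable_exprz R n.
have b1 (z : T) : `|complex.Re (sval z ^ n)| <= 1.
  by apply: le_trans (normr_Re _) _; rewrite norm_exprz.
have b2 (z : T) : `|complex.Im (sval z ^ n)| <= 1.
  by apply: le_trans (normr_Im _) _; rewrite norm_exprz.
have := cintegrableD (cintegrable_boundedM m1 b1 iu)
  (cintegrable_scale 'i%C (cintegrable_boundedM m2 b2 iu)).
congr cintegrable; apply/funext => z.
by rewrite [in RHS](complexE (sval z ^ n)) mulrDl mulrA.
Qed.

Lemma null_coefZ (a : R[i]) u : null_coef u -> null_coef (fun z => a * u z).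
Proof.
move=> [iu u0]; split; first exact: cintegrable_scale.
move=> n; under eq_fun do rewrite mulrCA.
by rewrite cintegralZ ?u0 ?mulr0//; exact: cintegrable_exprzM.
Qed.

Lemma null_coefD u v : null_coef u -> null_coef v ->
  null_coef (fun z => u z + v z).
Proof.
move=> [iu u0] [iv v0]; split; first exact: cintegrableD.
move=> n; under eq_fun do rewrite mulrDr.
by rewrite cintegralD ?u0 ?v0 ?addr0//; exact: cintegrable_exprzM.
Qed.

Lemma null_coef_shift (k : int) u : null_coef u ->
  null_coef (fun z => sval z ^ k * u z).
Proof.
move=> [iu u0]; split; first exact: cintegrable_exprzM.
move=> n; under eq_fun do rewrite mulrA -expfzDr ?circle_neq0//.
exact: u0.
Qed.

Lemma multiplier_cst (c : R) : multiplier (cst c).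
Proof.
split; [exact: measurable_cst|by exists `|c| => z|].
by move=> u; exact: (null_coefZ c%:C).
Qed.

Lemma multiplierD p q : multiplier p -> multiplier q ->
  multiplier (fun z => p z + q z).
Proof.
move=> [mp [M pM] up] [mq [N qN] uq]; split; first exact: measurable_funD.
  by exists (M + N) => z; apply: le_trans (ler_normD _ _) (lerD _ _).
move=> u nu; under eq_fun do rewrite rmorphD mulrDl.
by apply: null_coefD; [exact: up|exact: uq].
Qed.

Lemma multiplierM p q : multiplier p -> multiplier q ->
  multiplier (fun z => p z * q z).
Proof.
move=> [mp [M pM] up] [mq [N qN] uq]; split; first exact: measurable_funM.
  by exists (M * N) => z; rewrite normrM ler_pM.
move=> u nu; under eq_fun do rewrite rmorphM -mulrA.
by apply: up; exact: uq.
Qed.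

Lemma multiplierX p n : multiplier p -> multiplier (fun z => p z ^+ n).
Proof.
move=> mp; elim: n => [|n IH].
  by under eq_fun do rewrite expr0; exact: multiplier_cst.
by under eq_fun do rewrite exprS; exact: multiplierM.
Qed.

Lemma multiplier_Re : multiplier (fun z => complex.Re (sval z)).
Proof.
split; first by case: (cmeasurable_val R).
  by exists 1 => z; apply: le_trans (normr_Re _) _; rewrite (eqP (svalP z)).
move=> u nu.
have := null_coefZ (2^-1)%:C (null_coefD (null_coef_shift 1 nu) (null_coef_shift (-1) nu)).
congr null_coef; apply/funext => z.
rewrite -mulrDl mulrA -exprz_inv !expr1z circle_inv; congr (_ * _).
case: z => -[a b] /= _; apply: complex_ext; rewrite ?ReM ?ImM /=; lra.
Qed.

Lemma multiplier_Im : multiplier (fun z => complex.Im (sval z)).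
Proof.
split; first by case: (cmeasurable_val R).
  by exists 1 => z; apply: le_trans (normr_Im _) _; rewrite (eqP (svalP z)).
move=> u nu.
have := null_coefZ (2^-1 *i) (null_coefD (null_coef_shift (-1) nu)
  (null_coefZ (-1) (null_coef_shift 1 nu))).
congr null_coef; apply/funext => z.
rewrite [in LHS]mulrA -mulrDl mulrA -exprz_inv !expr1z circle_inv; congr (_ * _).
case: z => -[a b] /= _; apply: complex_ext; rewrite ?ReM ?ImM /=; lra.
Qed.

(** Dominated convergence with the majorant M |u| carries the vanishing of each Fourier coefficient
    to the limit, separately for real and imaginary parts. *)
Lemma multiplier_lim (p_ : nat -> T -> R) p (M : R) :
  (forall n, multiplier (p_ n)) -> (forall n z, `|p_ n z| <= M) ->
  (forall z, p_ ^~ z @ \oo --> p z) -> multiplier p.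
Proof.
move=> mp pM pc.
have mfp : measurable_fun setT p.
  apply: (@measurable_fun_cvg _ _ _ _ p_) => //.
  by move=> n; case: (mp n).
have pM' z : `|p z| <= M.
  have : (fun n => `|p_ n z|) @ \oo --> `|p z| by apply: cvg_norm; exact: pc.
  by move=> h; rewrite -(cvg_lim _ h)//; apply: limr_le;
     [apply/cvg_ex; eexists; exact: h|apply: nearW => n].
split => //; first by exists M.
move=> u nu; split; first exact: (cintegrable_boundedM mfp pM' nu.1).
move=> n.
have dom (g : T -> R) : m.-integrable setT (EFin \o g) ->
    (forall k, \int[m]_z (p_ k z * g z) = 0) -> \int[m]_z (p z * g z) = 0.
  move=> ig g0; have mg := measurable_fun_integrable ig.
  have [] := @dominated_convergence _ _ _ m setT measurableT
    (fun k z => (p_ k z * g z)%:E) (fun z => (p z * g z)%:E)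
    (fun z => (M * `|g z|)%:E).
  - move=> k; apply/measurable_EFinP; apply: measurable_funM => //.
    by case: (mp k).
  - by apply/measurable_EFinP; exact: measurable_funM.
  - apply: aeW => z _; apply/cvg_EFin; first exact: nearW.
    by apply: cvgM; [exact: pc|exact: cvg_cst].
  - by apply: integrable_scale; exact: integrable_normr.
  - by apply: aeW => z k _; rewrite /= lee_fin normrM ler_wpM2r.
  move=> _ _ h; rewrite /Rintegral -(cvg_lim _ h)//.
  (* A real integral is [fine] of the extended one and would also be 0 if the latter were infinite;
     finiteness is therefore checked before [g0] is transferred. *)
  have e : (fun k => \int[m]_z (p_ k z * g z)%:E)%E = cst 0%E.
    apply/funext => k; move: (g0 k); rewrite /Rintegral => e.
    have : (\int[m]_z (p_ k z * g z)%:E)%E \is a fin_num.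
      apply: integrable_fin_num => //.
      apply: (@integrable_le _ (fun z => p_ k z * g z) (fun z => M * `|g z|)).
      + by apply: measurable_funM => //; case: (mp k).
      + by apply: integrable_scale; exact: integrable_normr.
      + by move=> z; rewrite normrM ler_wpM2r.
    by move=> /fineK <-; rewrite e.
  by rewrite e lim_cst.
have [i1 i2] := cintegrable_exprzM n nu.1.
have key k : cintegral (fun z => (p_ k z)%:C * (sval z ^ n * u z)) = 0.
  have [_ _ /(_ _ nu)[_ /(_ n)]] := mp k.
  by under eq_fun do rewrite mulrCA.
apply: complex_ext => /=; under eq_Rintegral do rewrite mulrCA.
- under eq_Rintegral do rewrite ReM /= mul0r subr0.
  apply: dom => // k; have := congr1 (@complex.Re R) (key k) => /=.
  by under eq_Rintegral do rewrite ReM /= mul0r subr0.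
- under eq_Rintegral do rewrite ImM /= mul0r addr0.
  apply: dom => // k; have := congr1 (@complex.Im R) (key k) => /=.
  by under eq_Rintegral do rewrite ImM /= mul0r addr0.
Qed.

(** The affine change y = (1 + q) / 2 maps [-1, 1] to [0, 1] and turns q >= 0 into y >= 1/2, the
    threshold of [step_poly]; polynomials in a multiplier are multipliers. *)
Lemma multiplier_indic q : multiplier q -> (forall z, `|q z| <= 1) ->
  multiplier (fun z => (0 <= q z)%R%:R).
Proof.
move=> mq q1; pose y z := 2^-1 * (1 + q z).
have my : multiplier y.
  by apply: multiplierM; [exact: multiplier_cst|apply: multiplierD => //; exact: multiplier_cst].
have y01 z : 0 <= y z <= 1 by have := q1 z; rewrite ler_norml /y; lra.
apply: (@multiplier_lim (fun n z => step_poly (y z) n) _ 1).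
- move=> n; rewrite /step_poly.
  have mN (r : T -> R) : multiplier r -> multiplier (fun z => 1 - r z).
    move=> mr; apply: multiplierD; first exact: multiplier_cst.
    under eq_fun do rewrite -mulN1r.
    by apply: multiplierM => //; exact: multiplier_cst.
  exact: (mN _ (multiplierX _ (mN _ (multiplierX _ my)))).
- by move=> n z; rewrite ger0_norm; case/andP: (step_poly_itv n (y01 z)).
- move=> z; have -> : (0 <= q z) = (2^-1 <= y z) by rewrite /y; apply/idP/idP; lra.
  exact: cvg_step_poly.
Qed.

End Multipliers.

(** * A function with vanishing Fourier coefficients vanishes almost everywhere *)

Section FourierUniqueness.
Variable R : realType.
Local Notation m := (circle_leb R).
Local Notation T := (circle R).
Local Notation mu := (@lebesgue_measure R).
Local Notation I := `[0, 2 * pi]%classic.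
Implicit Types (g : T -> R) (p q : T -> R) (u : T -> R[i]).

(** At [expit t] this function is sin (a - t), so its sign singles out a half circle ending at the
    angle a. *)
Lemma multiplier_sin (a : R) :
  multiplier (fun z : T => sin a * complex.Re (sval z) - cos a * complex.Im (sval z)).
Proof.
under eq_fun do rewrite -mulNr.
apply: multiplierD; apply: multiplierM; try exact: multiplier_cst.
- exact: multiplier_Re.
- exact: multiplier_Im.
Qed.

Lemma multiplier_half (a : R) :
  multiplier (fun z : T => (0 <= sin a * complex.Re (sval z) - cos a * complex.Im (sval z))%R%:R).
Proof.
apply: multiplier_indic; first exact: multiplier_sin.
move=> [[x y] /= h]; move: h; rewrite normc_def /= => /eqP/(congr1 (@complex.Re R)) /= h.
have h2 : x ^+ 2 + y ^+ 2 = 1.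
  by rewrite -[LHS]sqr_sqrtr ?h ?expr1n// addr_ge0 ?sqr_ge0.
have h3 : (cos a) ^+ 2 + (sin a) ^+ 2 = 1 by exact: cos2Dsin2.
rewrite -(@ler_pXn2r _ 2) ?nnegrE// expr1n real_normK ?num_real//.
(* The two squares sum to 1: a rotation preserves the length of the unit vector (x, y). *)
have : 0 <= (sin a * y + cos a * x) ^+ 2 by exact: sqr_ge0.
suff -> : (sin a * y + cos a * x) ^+ 2 = 1 - (sin a * x - cos a * y) ^+ 2.
  by rewrite subr_ge0.
rewrite -[1]mulr1 -{1}h2 -h3; ring.
Qed.

(* [sin (a - t) >= 0] and [sin (t - b) >= 0] cut out the arc from [b] to [a]. *)
Lemma null_coef_arc u (a b : R) (J : set R) : null_coef u ->
  measurable (J : set (measurableTypeR R)) -> J `<=` I ->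
  (forall t : R, t \in `]0, 2 * pi[ ->
     (J t <-> (0 <= sin (a - t)) /\ (0 <= sin (t - b)))) ->
  \int[mu]_(t in J) complex.Re (u (expit t)) = 0.
Proof.
move=> nu mJ JI Jab.
(* Shifting by [pi] reverses the half circle: sin (b + pi - t) = sin (t - b). The coefficient of
   index 0 of the product is the integral over the arc, up to normalization. *)
have [_ _ /(_ _ nu)[i0 /(_ 0)]] := multiplierM (multiplier_half a) (multiplier_half (b + pi)).
under eq_fun do rewrite expr0z mul1r.
case: i0 => i0 _ /(congr1 (@complex.Re R)) /=.
rewrite (integral_circle i0) => /eqP; rewrite mulf_eq0 invr_eq0 gt_eqF ?twopi_gt0//= => /eqP.
have [iu _] := nu.1.
have iI := integrable_circle iu.
have mI : @measurable _ (measurableTypeR R) I by exact: measurable_itv.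
have mF : measurable_fun I (fun t : measurableTypeR R => complex.Re (u (expit t))).
  by move/measurable_int/measurable_EFinP: iI.
rewrite (_ : J = I `&` J); last by rewrite setIidr.
rewrite Rintegral_mkcondr => e0; rewrite -[RHS]e0; congr fine.
apply: ae_eq_integral => //.
- apply/measurable_EFinP; apply/measurable_restrict => //.
  by apply: measurable_funS mF => //; exact: subIsetl.
- by move/measurable_int: (integrable_circle i0).
(* [J] is described only inside the open interval; the two endpoints form a null set. *)
have : mu [set 0; 2 * pi] = 0.
  have /countable_lebesgue_measure0 : countable [set 0; 2 * pi : R] by exact: finite_set_countable.
  by [].
move=> e; exists [set 0; 2 * pi]; split => //.
  by apply: measurableU; exact: measurable_set1.
move=> t /= /not_implyP[It].
apply: contra_notP => /not_orP[t0 tpi].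
have tI : t \in `]0, 2 * pi[.
  move: It; rewrite /= !in_itv /= => /andP[x0 x1].
  by rewrite !lt_neqAle x0 x1 !andbT eq_sym; apply/andP; split; apply/eqP.
congr EFin; rewrite patchE /=.
have e1 : sin a * cos t - cos a * sin t = sin (a - t) by rewrite sinB.
have e2 : sin (b + pi) * cos t - cos (b + pi) * sin t = sin (t - b).
  by rewrite sinDpi cosDpi sinB; ring.
rewrite ReM /= e1 e2 mul0r subr0.
case: ifPn => [/set_mem/(Jab _ tI)[-> ->]|]; first by rewrite !mul1r.
rewrite notin_setE => nJ.
case: leP => h1; last by rewrite !mul0r.
case: leP => h2; last by rewrite mulr0 !mul0r.
by case: nJ; apply/(Jab _ tI).
Qed.

(** Two half circles meet in an arc of length at most [pi], so intervals starting at 0 are reached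
    only up to [pi]; past it, the starting point is moved to [pi] in [null_coef_arc2]. *)
Lemma null_coef_arc1 u (a : R) : null_coef u -> 0 < a <= pi ->
  \int[mu]_(t in `[0, a]) complex.Re (u (expit t)) = 0.
Proof.
move=> nu /andP[a0 api].
apply: (@null_coef_arc u a 0) => //.
  by move=> t /=; rewrite !in_itv /= => /andP[-> h] /=; lra.
move=> t; rewrite /= !in_itv /= subr0 => /andP[t0 t2].
rewrite (ltW t0) /=; split=> [ta|[h1 h2]].
  by rewrite !sin_ge0_pi//; lra.
have tp : t <= pi.
  rewrite leNgt; apply/negP => tp; move: h2; rewrite leNgt => /negP; apply.
  rewrite -[t](subrK pi) sinDpi oppr_lt0.
  by apply: sin_gt0_pi; lra.
rewrite leNgt; apply/negP => ta; move: h1; rewrite leNgt => /negP; apply.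
rewrite -opprB sinN oppr_lt0.
by apply: sin_gt0_pi; lra.
Qed.

Lemma null_coef_arc2 u (a : R) : null_coef u -> pi < a < 2 * pi ->
  \int[mu]_(t in `[pi, a]) complex.Re (u (expit t)) = 0.
Proof.
move=> nu /andP[api a2].
have p0 := pi_gt0 R.
apply: (@null_coef_arc u a pi) => //.
  by move=> t /=; rewrite !in_itv /= => /andP[h1 h2] /=; lra.
move=> t; rewrite /= !in_itv /= => /andP[t0 t2].
split=> [/andP[pt ta]|[h1 h2]].
  by rewrite !sin_ge0_pi//; lra.
have tp : pi <= t.
  rewrite leNgt; apply/negP => tp; move: h2; rewrite leNgt => /negP; apply.
  by rewrite -opprB sinN oppr_lt0; apply: sin_gt0_pi; lra.
rewrite tp /= leNgt; apply/negP => ta; move: h1; rewrite leNgt => /negP; apply.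
rewrite -opprB sinN oppr_lt0.
by apply: sin_gt0_pi; lra.
Qed.

(** Lebesgue differentiation: almost everywhere [f] is the derivative of its primitive based at [a],
    and that primitive vanishes near each point of the interval. *)
Lemma ae_eq0_integral_itv (f : R -> R) (a b : R) :
  mu.-integrable setT (EFin \o f) ->
  (forall x, a < x < b -> \int[mu]_(t in `[a, x]) f t = 0) ->
  {ae mu, forall t, a < t < b -> f t = 0}.
Proof.
move=> fi f0.
have locf : locally_integrable [set: R] f   by apply: open_integrable_locally => //; exact: openT.
have fa y : mu.-integrable [set` Interval (BLeft a) (BRight y)] (EFin \o f).
  by apply: integrableS fi.
apply: (@filterS _ _ (ae_filter_ringOfSetsType mu) _ _ _ (FTC1 fa locf)).
move=> x h /andP[ax xb].
have [_ <-] := h ax.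
rewrite derive1E -(derive_cst (0 : R) x (1 : R)).
apply: near_eq_derive.
near=> y; rewrite f0//; apply/andP; split.
- by near: y; exact: lt_nbhsr.
- by near: y; exact: lt_nbhsl.
Unshelve. all: by end_near. Qed.

Lemma null_coef_Re u : null_coef u -> {ae m, forall z, complex.Re (u z) = 0}.
Proof.
move=> nu; have [iu _] := nu.1.
have mu0 := measurable_fun_integrable iu.
have iI := integrable_circle iu.
have mI : @measurable _ (measurableTypeR R) I by exact: measurable_itv.
(* Extension by zero, since the differentiation lemma asks for integrability on the whole line. *)
pose f := (fun t : R => complex.Re (u (expit t))) \_ I.
have fi : mu.-integrable setT (EFin \o f).
  by rewrite /f -restrict_EFin; apply/(integrable_mkcond _ mI).
have p0 := pi_gt0 R.
have fJ (c x : R) : 0 <= c -> x <= 2 * pi -> \int[mu]_(t in `[c, x]) f t =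
    \int[mu]_(t in `[c, x]) complex.Re (u (expit t)).
  move=> c0 x2; apply: eq_Rintegral => t; rewrite inE /= in_itv /= => /andP[ct tx].
  by rewrite /f patchE mem_set//= in_itv /=; lra.
have h1 : {ae mu, forall t, 0 < t < pi -> f t = 0}.
  apply: ae_eq0_integral_itv => // x /andP[x0 xp].
  by rewrite fJ ?null_coef_arc1//; lra.
have h2 : {ae mu, forall t, pi < t < 2 * pi -> f t = 0}.
  apply: ae_eq0_integral_itv => // x /andP[x0 xp].
  by rewrite fJ ?null_coef_arc2//; lra.
have h3 : {ae mu, forall t : R, ~ [set 0; pi; 2 * pi] t}.
  exists [set 0; pi; 2 * pi]; split.
  - by apply: measurableU; [apply: measurableU|]; exact: measurable_set1.
  - by apply: countable_lebesgue_measure0; exact: finite_set_countable.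
  - by move=> t /= /contrapT.
have : (\int[m]_z `|(complex.Re (u z))%:E| = 0)%E.
  rewrite integral_circle_ge0//; last first.
    by apply: measurableT_comp => //; exact/measurable_EFinP.
  rewrite (@ae_eq_integral _ _ _ _ _ (cst 0%E)) ?integral0 ?mule0//.
  - by move/measurable_int: iI => h; exact: measurableT_comp h.
  - apply: (@filterS3 _ _ (ae_filter_ringOfSetsType mu) _ _ _ _ _ h1 h2 h3).
    move=> t {}h1 {}h2 {}h3 It.
    move: (It); rewrite /= in_itv /= => /andP[t0 t2].
    have -> : complex.Re (u (expit t)) = f t by rewrite /f patchE mem_set.
    have [tp|tp|tp] := ltgtP t pi.
    + rewrite h1 ?normr0// tp andbT lt_neqAle t0 andbT eq_sym.
      by apply/eqP => e; apply: h3; left; left.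
    + rewrite h2 ?normr0// tp /= lt_neqAle t2 andbT.
      by apply/eqP => e; apply: h3; right.
    + by exfalso; apply: h3; left; right.
move/ae_eq_integral_abs => /(_ measurableT).
have mE : measurable_fun setT (fun z : T => (complex.Re (u z))%:E) by exact/measurable_EFinP.
by move=> /(_ mE); apply: filterS => z /(_ Logic.I) [].
Qed.

(** The imaginary part is the real part of -i u, which has vanishing coefficients as well. *)
Lemma null_coef_eq0 u : null_coef u -> {ae m, forall z, u z = 0}.
Proof.
move=> nu; have h1 := null_coef_Re nu.
have := null_coef_Re (null_coefZ (- 'i%C) nu).
move: h1; apply: filterS2 => z h1; rewrite ReM /= => h2.
by apply: complex_ext => //=; move: h2; rewrite oppr0 mul0r sub0r; lra.
Qed.

End FourierUniqueness.

(** * Positive semidefinite sesquilinear forms *)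

Section SemiInner.
Variables (R : realType) (E : lmodType R[i]).

(** Definiteness is left out on purpose: on [L2t] a function that vanishes almost everywhere has
    norm zero without being 0. The same record serves for the inner product of [H]. *)
Record sform := SForm {
  sform_fun :> E -> E -> R[i];
  sformP : forall (a : R[i]) f g h,
    sform_fun (a *: f + g) h = a * sform_fun f h + sform_fun g h;
  sformC : forall f g, sform_fun f g = (sform_fun g f)^*;
  sform_ge0 : forall f, 0 <= sform_fun f f }.

Variable b : sform.
Implicit Types (f g h : E) (a : R[i]).

Definition snorm f : R := Num.sqrt (complex.Re (b f f)).

Lemma sformDl f g h : b (f + g) h = b f h + b g h.
Proof. by rewrite -[f]scale1r sformP mul1r scale1r. Qed.

Lemma sform0l h : b 0 h = 0.
Proof. by apply: (addrI (b 0 h)); rewrite -sformDl !addr0. Qed.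

Lemma sformZl a f h : b (a *: f) h = a * b f h.
Proof. by rewrite -[a *: f]addr0 sformP sform0l addr0. Qed.

Lemma sformNl f h : b (- f) h = - b f h.
Proof. by rewrite -scaleN1r sformZl mulN1r. Qed.

Lemma sformBl f g h : b (f - g) h = b f h - b g h.
Proof. by rewrite sformDl sformNl. Qed.

Lemma sformDr f g h : b h (f + g) = b h f + b h g.
Proof. by rewrite sformC sformDl rmorphD /= -!sformC. Qed.

Lemma sform0r h : b h 0 = 0.
Proof. by rewrite sformC sform0l conjC0. Qed.

Lemma sformZr a f h : b h (a *: f) = a^* * b h f.
Proof. by rewrite sformC sformZl rmorphM /= -sformC. Qed.

Lemma sformNr f h : b h (- f) = - b h f.
Proof. by rewrite sformC sformNl rmorphN /= -sformC. Qed.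

Lemma sformBr f g h : b h (f - g) = b h f - b h g.
Proof. by rewrite sformDr sformNr. Qed.

Lemma sform_suml (I : Type) (s : seq I) (F : I -> E) h :
  b (\sum_(i <- s) F i) h = \sum_(i <- s) b (F i) h.
Proof.
elim: s => [|i s IH]; first by rewrite !big_nil sform0l.
by rewrite !big_cons sformDl IH.
Qed.

Lemma sform_sumr (I : Type) (s : seq I) (F : I -> E) h :
  b h (\sum_(i <- s) F i) = \sum_(i <- s) b h (F i).
Proof.
elim: s => [|i s IH]; first by rewrite !big_nil sform0r.
by rewrite !big_cons sformDr IH.
Qed.

Lemma Re_sform_ge0 f : 0 <= complex.Re (b f f).
Proof. by have := sform_ge0 b f; rewrite lecE => /andP[]. Qed.

Lemma sformE f : b f f = (complex.Re (b f f))%:C.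
Proof.
have := sform_ge0 b f; rewrite lecE => /andP[/eqP /= im _].
by apply: complex_ext.
Qed.

Lemma snorm_ge0 f : 0 <= snorm f.
Proof. exact: sqrtr_ge0. Qed.

Lemma snorm_sqr f : snorm f ^+ 2 = complex.Re (b f f).
Proof. by rewrite sqr_sqrtr// Re_sform_ge0. Qed.

Lemma sform_snorm f : b f f = (snorm f ^+ 2)%:C.
Proof. by rewrite sformE snorm_sqr. Qed.

Lemma Re_sformDD f g : complex.Re (b (f + g) (f + g)) =
  complex.Re (b f f) + complex.Re (b g g) + 2 * complex.Re (b f g).
Proof.
by rewrite sformDl !sformDr !ReD [b g f]sformC ReC; ring.
Qed.

Lemma snorm_pythagoras f g : b f g = 0 ->
  snorm (f + g) ^+ 2 = snorm f ^+ 2 + snorm g ^+ 2.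
Proof. by move=> fg; rewrite !snorm_sqr Re_sformDD fg /= mulr0 addr0. Qed.

Lemma snorm_le_orthoD f g : b f g = 0 -> snorm f <= snorm (f + g).
Proof.
move=> fg; rewrite -(@ler_pXn2r _ 2) ?nnegrE ?snorm_ge0//.
by rewrite snorm_pythagoras// lerDl sqr_ge0.
Qed.

(** The norm of [R[i]] takes its values in [R[i]]; the modulus as a real number is the real part of
    that norm. *)
Lemma cabs_sqr a : complex.Re `|a| ^+ 2 = complex.Re a ^+ 2 + complex.Im a ^+ 2.
Proof. by rewrite normc_def /= sqr_sqrtr// addr_ge0// sqr_ge0. Qed.

Lemma cabs_ge0 a : 0 <= complex.Re `|a|.
Proof. by rewrite normc_def /= sqrtr_ge0. Qed.

Lemma cabsD a c : complex.Re `|a + c| <= complex.Re `|a| + complex.Re `|c|.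
Proof. by have := ler_normD a c; rewrite lecE => /andP[_]; rewrite ReD. Qed.

Lemma cabsB a c : complex.Re `|a - c| <= complex.Re `|a| + complex.Re `|c|.
Proof. by rewrite -(normrN c); exact: cabsD. Qed.

Lemma cabs_eq0 a : complex.Re `|a| <= 0 -> a = 0.
Proof.
move=> a0; apply/eqP; rewrite -normr_eq0; apply/eqP; apply: complex_ext => /=.
  by apply/eqP; rewrite eq_le a0 cabs_ge0.
by [].
Qed.

Lemma cabs_real (r : R) : 0 <= r -> complex.Re `|r%:C| = r.
Proof. by move=> r0; rewrite normc_def /= expr0n addr0 sqrtr_sqr ger0_norm. Qed.

Lemma snormZ a f : snorm (a *: f) = complex.Re `|a| * snorm f.
Proof.
have <- : Num.sqrt ((complex.Re `|a| * snorm f) ^+ 2) = complex.Re `|a| * snorm f.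
  by rewrite sqrtr_sqr ger0_norm// mulr_ge0 ?cabs_ge0 ?snorm_ge0.
congr Num.sqrt; rewrite sformZl sformZr mulrA -normCK sform_snorm exprMn.
have -> : `|a| = (complex.Re `|a|)%:C by apply: complex_ext => //=; rewrite normc_def.
by rewrite -rmorphXn -rmorphM.
Qed.

Lemma snormN f : snorm (- f) = snorm f.
Proof. by rewrite /snorm sformNl sformNr opprK. Qed.

Lemma snormB f g : snorm (f - g) = snorm (g - f).
Proof. by rewrite -snormN opprB. Qed.

Lemma snorm0 : snorm 0 = 0.
Proof. by rewrite /snorm sform0l /= sqrtr0. Qed.

(** Positivity at t f - x g, with x = b f g and t real, gives a quadratic polynomial in t; it is
    evaluated at its minimum X / A, where X = |x|^2. *)
Lemma cauchy_schwarz f g : complex.Re `|b f g| <= snorm f * snorm g.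
Proof.
rewrite -(@ler_pXn2r _ 2) ?nnegrE ?mulr_ge0 ?snorm_ge0 ?cabs_ge0//.
rewrite exprMn !snorm_sqr cabs_sqr.
set x := b f g; set A := complex.Re (b f f); set B := complex.Re (b g g).
have A0 : 0 <= A := Re_sform_ge0 f.
have B0 : 0 <= B := Re_sform_ge0 g.
have q (t : R) : 0 <= A * t ^+ 2 - 2 * t * (complex.Re x ^+ 2 + complex.Im x ^+ 2)
    + B * (complex.Re x ^+ 2 + complex.Im x ^+ 2).
  have := Re_sform_ge0 (t%:C *: f - x *: g).
  rewrite sformBl !sformBr !sformZl !sformZr [b g f]sformC -/x.
  rewrite [b f f]sformE [b g g]sformE -/A -/B.
  case: x => x1 x2; rewrite /= => h; apply: le_trans h _.
  by rewrite le_eqVlt; apply/orP; left; apply/eqP => /=; ring.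
set X := complex.Re x ^+ 2 + complex.Im x ^+ 2 in q *.
have X0 : 0 <= X by rewrite addr_ge0 ?sqr_ge0.
have [->//|Xn] := eqVneq X 0; first by rewrite mulr_ge0.
have Xp : 0 < X by rewrite lt0r Xn.
(* For a semidefinite form A = 0 does not make f zero; the polynomial is then affine in t and equals
   -X at t = (B + 1) / 2, a contradiction. *)
have [A00|An] := eqVneq A 0.
  have := q ((B + 1) / 2); rewrite A00; nra.
have Ap : 0 < A by rewrite lt0r An.
have := q (X / A).
rewrite (_ : _ + _ = X / A * (A * B - X)); last by field.
by rewrite pmulr_rge0 ?divr_gt0// subr_ge0.
Qed.

Lemma snormD f g : snorm (f + g) <= snorm f + snorm g.
Proof.
rewrite -(@ler_pXn2r _ 2) ?nnegrE ?addr_ge0 ?snorm_ge0//.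
rewrite snorm_sqr Re_sformDD -!snorm_sqr sqrrD.
have := le_trans (le_trans (ler_norm _) (normr_Re (b f g))) (cauchy_schwarz f g).
by rewrite mulr2n; lra.
Qed.

Lemma snorm0_sform f g : snorm f = 0 -> b f g = 0.
Proof.
move=> f0; have := cauchy_schwarz f g; rewrite f0 mul0r => h.
exact: cabs_eq0.
Qed.

Lemma snorm_sqrD f g : snorm (f + g) ^+ 2 <= 2 * snorm f ^+ 2 + 2 * snorm g ^+ 2.
Proof.
have h := snormD f g; have := snorm_ge0 (f + g).
set x := snorm f in h *; set y := snorm g in h *; set w := snorm _ in h *.
by move=> w0; have := sqr_ge0 (x - y); nra.
Qed.

(** The common ending of the density arguments: instead of taking limits of vectors, a fixed scalar
    is bounded by a multiple of a null sequence. *)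
Lemma eq0_of_cvg (a : R[i]) (M : R) (e : nat -> R) : e @ \oo --> (0 : R) ->
  (forall n, complex.Re `|a| <= M * e n) -> a = 0.
Proof.
move=> e0 h; apply: cabs_eq0.
have Me : (fun n => M * e n) @ \oo --> (0 : R).
  by rewrite -(mulr0 M); apply: cvgM => //; exact: cvg_cst.
by rewrite -(cvg_lim _ Me)//; apply: limr_ge; [apply/cvg_ex; exists 0|exact: nearW].
Qed.

End SemiInner.

(** * Frames, trace and Hilbert-Schmidt norm in finite dimension *)

Section FiniteDimensional.
Variables (R : realType) (H : vectType R[i]) (ip : {dot H for Num.conj}).
Implicit Types (x y : H) (B : 'End(H)).

Lemma dot_sformP (a : R[i]) x y w : ip (a *: x + y) w = a * ip x w + ip y w.
Proof. by rewrite linearPl. Qed.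

Lemma dot_sformC x y : ip x y = (ip y x)^*.
Proof. by rewrite hermC expr0 mul1r. Qed.

Lemma dot_sform_ge0 x : 0 <= ip x x.
Proof. exact: dnorm_ge0. Qed.

Definition ipS : sform H := SForm dot_sformP dot_sformC dot_sform_ge0.

Lemma dot_sform x y : ip x y = ipS x y.
Proof. by []. Qed.

Lemma hnormE x : hnorm ip x = snorm ipS x.
Proof. by []. Qed.

Lemma hnorm_eq0 x : hnorm ip x = 0 -> x = 0.
Proof.
move=> x0; apply/eqP; rewrite -(dnorm_eq0 ip).
by rewrite -[ip x x]/(ipS x x) sform_snorm -hnormE x0 expr0n.
Qed.

(* [s] is a maximal orthonormal family. *)
Lemma parseval_frame :
  exists s : seq H, forall x, x = \sum_(v <- s) ip x v *: v.
Proof.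
pose P k := `[< exists2 s : seq H, size s = k & orthonormal ip s >].
have P0 : exists k, P k by exists 0%N; apply/asboolP; exists [::].
have Pb k : P k -> (k <= \dim {:H})%N.
  move=> /asboolP[s <- /orthonormal_free].
  by rewrite /free => /eqP <-; rewrite dimvS// subvf.
case: (ex_maxnP P0 Pb) => k /asboolP[s sk so] kmax.
exists s => x; pose y := x - \sum_(v <- s) ip x v *: v.
have [/eqP|yn] := eqVneq y 0; first by rewrite subr_eq0 => /eqP.
exfalso.
have /orthonormalP[us so'] := so.
have ys v : v \in s -> ip y v = 0.
  move=> vs; rewrite /y !dot_sform sformBl sform_suml.
  rewrite (eq_big_seq (fun w => ip x w * (w == v)%:R)); last first.
    by move=> w ws; rewrite sformZl -dot_sform (so' w v).
  rewrite (bigD1_seq v)//= eqxx mulr1 big1 ?addr0 ?subrr// => w /negbTE ->.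
  by rewrite mulr0.
pose e := (hnorm ip y)^-1%:C *: y.
have : P k.+1.
  apply/asboolP; exists (e :: s); first by rewrite /= sk.
  have yn0 : hnorm ip y != 0 by apply: contra_neq yn; exact: hnorm_eq0.
  have ee : ip e e = 1.
    rewrite dot_sform sform_snorm snormZ -hnormE cabs_real ?invr_ge0 ?sqrtr_ge0//.
    by rewrite mulVf// expr1n.
  have es v : v \in s -> ip e v = 0.
    by move=> vs; rewrite dot_sform sformZl -dot_sform ys// mulr0.
  have ne v : v \in s -> e != v.
    move=> vs; apply/eqP => ev; have := es v vs; rewrite -ev ee => /eqP.
    by rewrite oner_eq0.
  apply/orthonormalP; split.
    rewrite /= us andbT; apply/negP => /es; rewrite ee => /eqP.
    by rewrite oner_eq0.
  move=> v w; rewrite !inE => /orP[/eqP->|vs] /orP[/eqP->|ws].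
  - by rewrite eqxx ee.
  - by rewrite es// (negbTE (ne _ ws)).
  - by rewrite dot_sformC es// conjC0 eq_sym (negbTE (ne _ vs)).
  - exact: so'.
by move=> /kmax; rewrite ltnn.
Qed.

Lemma frame_ip (s : seq H) : (forall x, x = \sum_(v <- s) ip x v *: v) ->
  forall x y, ip x y = \sum_(v <- s) ip x v * (ip y v)^*.
Proof.
move=> sx x y; rewrite {1}(sx x) dot_sform sform_suml.
by apply: eq_bigr => v _; rewrite sformZl [ipS v y]sformC.
Qed.

Lemma frame_hnorm (s : seq H) : (forall x, x = \sum_(v <- s) ip x v *: v) ->
  forall x, hnorm ip x ^+ 2 = \sum_(v <- s)
    (complex.Re (ip x v) ^+ 2 + complex.Im (ip x v) ^+ 2).
Proof.
move=> sx x; rewrite hnormE snorm_sqr /= (frame_ip sx).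
elim: s {sx} => [|v s IH]; first by rewrite !big_nil.
by rewrite !big_cons ReD IH ReM ReC ImC; ring.
Qed.

(** The hypothesis gives reconstruction rather than orthonormality, so Pythagoras is replaced by
    absorption: expand one factor of <w, w>, bound each product by half the sum of squares,
    recognize the sum of the |<w, v>|^2 as the squared norm of w, and move half of it to the
    left. *)
Lemma frame_synthesis (s : seq H) : (forall x, x = \sum_(v <- s) ip x v *: v) ->
  forall c : H -> R[i], hnorm ip (\sum_(v <- s) c v *: v) ^+ 2 <=
  \sum_(v <- s) (complex.Re (c v) ^+ 2 + complex.Im (c v) ^+ 2).
Proof.
move=> sx c; set w := \sum_(v <- s) _.
have : hnorm ip w ^+ 2 <= 2^-1 * (\sum_(v <- s) (complex.Re (c v) ^+ 2 + complex.Im (c v) ^+ 2))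
    + 2^-1 * hnorm ip w ^+ 2.
  rewrite [X in _ <= _ + _ * X](frame_hnorm sx) hnormE snorm_sqr {1}/w sform_suml.
  rewrite -mulrDr -big_split /= mulr_sumr.
  elim: (s) => [|v s' IH]; first by rewrite !big_nil.
  rewrite !big_cons ReD lerD// dot_sform sformZl [ipS v w]sformC -dot_sform.
  case: (c v) => c1 c2; case: (ip w v) => d1 d2 /=.
  by have := sqr_ge0 (c1 - d1); have := sqr_ge0 (c2 - d2); nra.
by set X := \sum_(v <- s) _; lra.
Qed.

Lemma lftrace_frame (s : seq H) : (forall x, x = \sum_(v <- s) ip x v *: v) ->
  forall B, lftrace B = \sum_(v <- s) ip (B v) v.
Proof.
move=> sx B; rewrite /lftrace.
transitivity (\sum_(i < \dim {:H}) \sum_(v <- s) ip (B (vbasis {:H})`_i) v * coord (vbasis {:H}) i v).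
  apply: eq_bigr => i _; rewrite {1}(sx (B _)) linear_sum /=.
  by apply: eq_bigr => v _; rewrite linearZ.
rewrite exchange_big /=; apply: eq_bigr => v _.
rewrite [in RHS](_ : B v = \sum_(i < \dim {:H}) coord (vbasis {:H}) i v *: B (vbasis {:H})`_i).
  rewrite dot_sform sform_suml.
  by apply: eq_bigr => i _; rewrite sformZl mulrC.
rewrite {1}(coord_vbasis (memvf v)) linear_sum /=.
by apply: eq_bigr => i _; rewrite linearZ.
Qed.

Lemma hsnorm_frame (s : seq H) : (forall x, x = \sum_(v <- s) ip x v *: v) ->
  forall B, hsnorm ip B ^+ 2 = \sum_(v <- s) hnorm ip (B v) ^+ 2.
Proof.
move=> sx B; rewrite /hsnorm (lftrace_frame sx).
have e : complex.Re (\sum_(v <- s) ip ((adjoint ip B \o B)%VF v) v) =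
    \sum_(v <- s) hnorm ip (B v) ^+ 2.
  elim: (s) => [|v s' IH]; first by rewrite !big_nil.
  rewrite !big_cons ReD IH hnormE snorm_sqr /=; congr (complex.Re _ + _).
  by rewrite comp_lfunE dot_sformC -adjointP -dot_sformC.
by rewrite sqr_sqrtr// e sumr_ge0// => v _; rewrite sqr_ge0.
Qed.

Lemma csq_ip_le x y : complex.Re (ip x y) ^+ 2 + complex.Im (ip x y) ^+ 2 <=
  hnorm ip x ^+ 2 * hnorm ip y ^+ 2.
Proof.
rewrite -cabs_sqr -exprMn ler_pXn2r ?nnegrE ?mulr_ge0 ?sqrtr_ge0 ?cabs_ge0//.
exact: (cauchy_schwarz ipS).
Qed.

Lemma adjoint_ip B x y : ip (adjoint ip B x) y = ip x (B y).
Proof. by rewrite dot_sformC -adjointP -dot_sformC. Qed.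

(** The squared Hilbert-Schmidt norms of B and of its adjoint agree by exchanging a double sum; each
    frame coefficient of B x is the product of x with a column of the adjoint, to which
    Cauchy-Schwarz applies. *)
Lemma hnorm_le_hsnorm B x : hnorm ip (B x) <= hsnorm ip B * hnorm ip x.
Proof.
have [s sx] := parseval_frame.
rewrite -(@ler_pXn2r _ 2) ?nnegrE ?mulr_ge0 ?sqrtr_ge0//.
rewrite exprMn (hsnorm_frame sx).
have -> : \sum_(v <- s) hnorm ip (B v) ^+ 2 = \sum_(w <- s) hnorm ip (adjoint ip B w) ^+ 2.
  under eq_bigr do rewrite (frame_hnorm sx).
  rewrite exchange_big /=; apply: eq_bigr => w _; rewrite (frame_hnorm sx).
  by apply: eq_bigr => v _; rewrite adjoint_ip dot_sformC ReC ImC sqrrN.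
rewrite (frame_hnorm sx) mulr_suml; apply: ler_sum => w _.
by rewrite adjointP mulrC; exact: csq_ip_le.
Qed.

Lemma unitary_hnorm B x : unitary ip B -> hnorm ip (B x) = hnorm ip x.
Proof.
move=> [u _]; rewrite /hnorm adjointP -comp_lfunE u.
by rewrite id_lfunE.
Qed.

End FiniteDimensional.

(** * The space of square-integrable vector functions with its semi-inner product *)

Section VectorL2.
Variables (R : realType) (H : vectType R[i]) (ip : {dot H for Num.conj}).
Local Notation m := (circle_leb R).
Local Notation T := (circle R).
Local Notation hn := (hnorm ip).
Implicit Types (f g : T -> H) (x y : H).

Lemma vmeasurable_linear (V : vectType R[i]) (f : T -> V) (phi : {linear V -> R[i]^o}) :
  vmeasurable f -> cmeasurable (fun z => phi (f z) : R[i]).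
Proof.
move=> mf.
have e z : phi (f z) = \sum_(i < \dim {:V}) vcoord i (f z) * phi (vbasis {:V})`_i.
  rewrite {1}(coord_vbasis (memvf (f z))) linear_sum /=.
  by apply: eq_bigr => i _; rewrite linearZ.
under eq_fun do rewrite e.
apply: cmeasurable_sum => i; apply: cmeasurableM; last exact: cmeasurable_cst.
exact: mf.
Qed.

(** Each coordinate functional is an inner product with a fixed vector, by [riesz]; this frees
    measurability from the chosen basis. *)
Lemma vmeasurable_ip f : vmeasurable f <-> forall x, cmeasurable (fun z => ip (f z) x).
Proof.
split=> [mf x|mf i].
  have lin : linear (fun y => ip y x : R[i]^o) by move=> a u v; rewrite linearPl.
  pose phi := HB.pack (fun y => ip y x : R[i]^o)
    (GRing.isLinear.Build _ _ _ _ _ lin) : {linear H -> R[i]^o}.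
  exact: (vmeasurable_linear phi mf).
have lin : linear (fun y => vcoord i y : R[i]^o) by move=> a u v; rewrite /vcoord linearP.
pose phi := HB.pack (fun y => vcoord i y : R[i]^o)
    (GRing.isLinear.Build _ _ _ _ _ lin) : {linear H -> R[i]^o}.
have [y yP] := riesz ip phi.
have := mf y; congr cmeasurable; apply/funext => z.
by rewrite yP.
Qed.

Lemma cmeasurable_ip2 f g : vmeasurable f -> vmeasurable g ->
  cmeasurable (fun z => ip (f z) (g z)).
Proof.
move=> /vmeasurable_ip mf /vmeasurable_ip mg; have [s sx] := parseval_frame ip.
under eq_fun do rewrite (frame_ip sx).
by apply: cmeasurable_sum => v; apply: cmeasurableM => //; exact: cmeasurableC.
Qed.

Lemma measurable_hnorm2 f : vmeasurable f -> measurable_fun setT (fun z => hn (f z) ^+ 2).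
Proof.
move=> mf; under eq_fun do rewrite hnormE snorm_sqr.
by have [] := cmeasurable_ip2 mf mf.
Qed.

Lemma vmeasurable_lin (a : R[i]) f g : vmeasurable f -> vmeasurable g ->
  vmeasurable (fun z => a *: f z + g z).
Proof.
move=> /vmeasurable_ip mf /vmeasurable_ip mg; apply/vmeasurable_ip => x.
under eq_fun do rewrite linearPl.
apply: (@cmeasurableD _ (fun z => a * ip (f z) x) (fun z => ip (g z) x)) => //.
by apply: (@cmeasurableM _ (fun=> a)) => //; exact: cmeasurable_cst.
Qed.

Lemma vmeasurable_scale (u : T -> R[i]) f : cmeasurable u -> vmeasurable f ->
  vmeasurable (fun z => u z *: f z).
Proof.
move=> mu /vmeasurable_ip mf; apply/vmeasurable_ip => x.
by under eq_fun do rewrite linearZl_LR /=; exact: cmeasurableM.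
Qed.

Lemma vmeasurable_cst x : vmeasurable (fun _ : T => x).
Proof. by apply/vmeasurable_ip => y; exact: cmeasurable_cst. Qed.

Lemma L2_le f g (M : R) : vmeasurable f -> L2 ip g ->
  {ae m, forall z, hn (f z) ^+ 2 <= M * hn (g z) ^+ 2} -> L2 ip f.
Proof.
move=> mf [mg ig] fg; split => //.
apply: (integrable_le_ae (h := fun z => M * hn (g z) ^+ 2)).
- exact: measurable_hnorm2.
- exact: integrable_scale.
- by apply: filterS fg => z; rewrite ger0_norm ?sqr_ge0.
Qed.

Lemma L2_lin (a : R[i]) f g : L2 ip f -> L2 ip g -> L2 ip (fun z => a *: f z + g z).
Proof.
move=> [mf jf] [mg jg]; split; first exact: vmeasurable_lin.
apply: (integrable_le (h := fun z => 2 * complex.Re `|a| ^+ 2 * hn (f z) ^+ 2 + 2 * hn (g z) ^+ 2)).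
- by apply: measurable_hnorm2; exact: vmeasurable_lin.
- by apply: integrable_addr; exact: integrable_scale.
- move=> z; rewrite ger0_norm ?sqr_ge0// !hnormE.
  apply: le_trans (snorm_sqrD _ _ _) _.
  by rewrite snormZ exprMn mulrA.
Qed.

Lemma L2_0 : L2 ip (fun=> 0).
Proof.
split; first exact: vmeasurable_cst.
under eq_fun do rewrite hnormE snorm0 expr0n /=.
exact: integrable0.
Qed.

Lemma L2_cst x : L2 ip (fun=> x).
Proof.
split; first exact: vmeasurable_cst.
by apply: finite_measure_integrable_cst.
Qed.

Lemma cintegrable_ip f g : L2 ip f -> L2 ip g ->
  cintegrable (fun z => ip (f z) (g z)).
Proof.
move=> [mf jf] [mg jg].
have [m1 m2] := cmeasurable_ip2 mf mg.
have ih : m.-integrable setT (EFin \o (fun z => hn (f z) ^+ 2 + hn (g z) ^+ 2)).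
  exact: integrable_addr.
have b z : complex.Re `|ip (f z) (g z)| <= hn (f z) ^+ 2 + hn (g z) ^+ 2.
  apply: le_trans (cauchy_schwarz (ipS ip) _ _) _; rewrite -!hnormE.
  have := sqr_ge0 (hn (f z) - hn (g z)).
  by have := sqr_ge0 (hn (f z)); have := sqr_ge0 (hn (g z)); nra.
split.
- by apply: (integrable_le m1 ih) => z; apply: le_trans (normr_Re _) (b z).
- by apply: (integrable_le m2 ih) => z; apply: le_trans (normr_Im _) (b z).
Qed.

Definition L2pred : {pred (T -> H)} := mem (L2 ip).

Lemma L2_submod_closed : submod_closed L2pred.
Proof.
split; first by rewrite inE; exact: L2_0.
by move=> a f g; rewrite !inE => hf hg; exact: L2_lin.
Qed.

HB.instance Definition _ := GRing.isSubmodClosed.Build _ _ L2pred L2_submod_closed.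

(** Functions rather than classes, as in the statement, where operators act on functions. As a
    submodule of all functions, it is a module over [R[i]] on which an [sform] can be put. *)
Record L2t := mkL2t { L2fun :> T -> H; L2funP : L2fun \in L2pred }.

HB.instance Definition _ := [isSub for L2fun].
HB.instance Definition _ := [Choice of L2t by <:].
HB.instance Definition _ := [SubChoice_isSubLmodule of L2t by <:].

Implicit Types F G K : L2t.

Lemma L2tP F : L2 ip F.
Proof. by have := L2funP F; rewrite inE. Qed.

Definition toL2 f (hf : L2 ip f) : L2t := mkL2t (mem_set hf).

Lemma L2t_eq F G : (forall z, F z = G z) -> F = G.
Proof. by move=> FG; apply/val_inj/funext. Qed.

Lemma L2tD F G z : (F + G) z = F z + G z.
Proof. by []. Qed.

Lemma L2tZ (a : R[i]) F z : (a *: F) z = a *: F z.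
Proof. by []. Qed.

Lemma L2tB F G z : (F - G) z = F z - G z.
Proof. by []. Qed.

Lemma L2t_sum (I : Type) (s : seq I) (A : I -> L2t) z :
  (\sum_(i <- s) A i) z = \sum_(i <- s) A i z.
Proof. by elim: s => [|i s IH]; rewrite ?big_nil ?big_cons// L2tD IH. Qed.

Definition L2b F G : R[i] := L2ip ip F G.

Lemma L2b_P (a : R[i]) F G K : L2b (a *: F + G) K = a * L2b F K + L2b G K.
Proof.
rewrite /L2b /L2ip -cintegralZ; last exact: cintegrable_ip (L2tP F) (L2tP K).
rewrite -cintegralD; last exact: cintegrable_ip (L2tP G) (L2tP K).
  by congr cintegral; apply/funext => z; rewrite L2tD L2tZ linearPl.
by apply: cintegrable_scale; exact: cintegrable_ip (L2tP F) (L2tP K).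
Qed.

Lemma L2b_C F G : L2b F G = (L2b G F)^*.
Proof.
rewrite /L2b /L2ip -cintegral_conj; last exact: cintegrable_ip (L2tP G) (L2tP F).
by congr cintegral; apply/funext => z; rewrite -dot_sformC.
Qed.

Lemma L2ip_hnorm f : L2ip ip f f = (\int[m]_z (hn (f z) ^+ 2))%:C.
Proof.
rewrite /L2ip /cintegral; apply: complex_ext => /=.
- by apply: eq_Rintegral => z _; rewrite hnormE snorm_sqr.
- transitivity (\int[m]_z (0 : R)); last by rewrite Rintegral_cst// mul0r.
  by apply: eq_Rintegral => z _; rewrite dot_sform sform_snorm.
Qed.

Lemma L2b_ge0 F : 0 <= L2b F F.
Proof.
by rewrite /L2b L2ip_hnorm ler0c; apply: Rintegral_ge0 => z _; exact: sqr_ge0.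
Qed.

Definition L2form : sform L2t := SForm L2b_P L2b_C L2b_ge0.

Lemma L2bE F G : L2form F G = L2ip ip F G.
Proof. by []. Qed.

Lemma L2norm_snorm F : L2norm ip F = snorm L2form F.
Proof. by []. Qed.

Lemma L2form_integral F : snorm L2form F ^+ 2 = \int[m]_z (hn (F z) ^+ 2).
Proof. by rewrite snorm_sqr L2bE L2ip_hnorm. Qed.

Lemma snorm_integral F : ((snorm L2form F ^+ 2)%:E = \int[m]_z (hn (F z) ^+ 2)%:E)%E.
Proof.
rewrite L2form_integral /Rintegral fineK//; apply: integrable_fin_num => //.
by have [] := L2tP F.
Qed.

Lemma snorm_eq0_ae F : snorm L2form F = 0 <-> {ae m, forall z, F z = 0}.
Proof.
have [mF jF] := L2tP F.
have mE : measurable_fun setT (fun z => (hn (F z) ^+ 2)%:E).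
  by apply/measurable_EFinP; exact: measurable_hnorm2.
split=> [F0|F0].
  have : (\int[m]_z `|(hn (F z) ^+ 2)%:E| = 0)%E.
    under eq_integral do rewrite gee0_abs ?lee_fin ?sqr_ge0//.
    by rewrite -snorm_integral F0 expr0n.
  move/ae_eq_integral_abs => /(_ measurableT mE); apply: filterS => z /(_ Logic.I) [] /eqP.
  by rewrite sqrf_eq0 => /eqP; exact: hnorm_eq0.
apply/eqP; rewrite -sqrf_eq0 L2form_integral /Rintegral.
rewrite (@ae_eq_integral _ _ _ _ _ (cst 0%E))// ?integral0//.
by apply: filterS F0 => z -> _; rewrite hnormE snorm0 expr0n.
Qed.

Lemma ae_equal_snorm F G : ae_equal F G <-> snorm L2form (F - G) = 0.
Proof.
rewrite snorm_eq0_ae; split; apply: filterS => z; rewrite L2tB.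
- by move=> ->; rewrite subrr.
- by move=> /eqP; rewrite subr_eq0 => /eqP.
Qed.

Lemma ae_equal_sform F G K : ae_equal F G -> L2form F K = L2form G K.
Proof.
move=> /ae_equal_snorm FG; apply/eqP; rewrite -subr_eq0 -sformBl.
by rewrite (snorm0_sform K FG).
Qed.

End VectorL2.

(** * Shifts, Fourier coefficients, Riesz-Fischer and Fourier expansion *)

Section L2Operators.
Variables (R : realType) (H : vectType R[i]) (ip : {dot H for Num.conj}).
Local Notation m := (circle_leb R).
Local Notation T := (circle R).
Local Notation hn := (hnorm ip).
Local Notation L := (L2t ip).
Local Notation b := (L2form ip).
Implicit Types (f g : T -> H) (x y : H) (F G : L).

Lemma L2_unimodular (u : T -> R[i]) f : cmeasurable u -> (forall z, `|u z| = 1) ->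
  L2 ip f -> L2 ip (fun z => u z *: f z).
Proof.
move=> mu u1 hf; apply: (L2_le (M := 1) _ hf).
  by apply: (vmeasurable_scale ip) => //; case: hf.
by apply: aeW => z; rewrite !hnormE snormZ u1 !mul1r.
Qed.

Lemma L2_exprz (n : int) f : L2 ip f -> L2 ip (fun z => sval z ^ n *: f z).
Proof.
apply: L2_unimodular; first exact: cmeasurable_exprz.
by move=> z; exact: norm_exprz.
Qed.

Definition zshift (n : int) F : L := toL2 (L2_exprz n (L2tP F)).

Lemma zshift_linear n : linear (zshift n).
Proof.
move=> a F G; apply: L2t_eq => z.
change (sval z ^ n *: (a *: F z + G z) = a *: (sval z ^ n *: F z) + sval z ^ n *: G z).
by rewrite scalerDr !scalerA mulrC.
Qed.

HB.instance Definition _ n := GRing.isLinear.Build R[i] L L _ (zshift n) (zshift_linear n).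

Lemma zshiftB n F G : zshift n (F - G) = zshift n F - zshift n G.
Proof. exact: linearB. Qed.

Lemma zshift0 F : zshift 0 F = F.
Proof. by apply: L2t_eq => z /=; rewrite expr0z scale1r. Qed.

Lemma zshift_add n k F : zshift n (zshift k F) = zshift (n + k) F.
Proof. by apply: L2t_eq => z /=; rewrite scalerA expfzDr ?circle_neq0. Qed.

Lemma sform_zshift n F G : b (zshift n F) (zshift n G) = b F G.
Proof.
rewrite !L2bE; congr cintegral; apply/funext => z /=.
rewrite dot_sform sformZl sformZr mulrA circle_exprC -expfzDr ?circle_neq0//.
by rewrite subrr expr0z mul1r.
Qed.

Lemma sform_zshift_adj n F G : b (zshift n F) G = b F (zshift (- n) G).
Proof. by rewrite -(sform_zshift n F) zshift_add subrr zshift0. Qed.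

Lemma snorm_zshift n F : snorm b (zshift n F) = snorm b F.
Proof. by rewrite /snorm sform_zshift. Qed.

Definition cstL x : L := toL2 (L2_cst ip x).

Lemma cstL_linear : linear cstL.
Proof. by move=> a x y; apply: L2t_eq. Qed.

HB.instance Definition _ := GRing.isLinear.Build R[i] H L _ cstL cstL_linear.

Lemma sform_zshift_cst n k x y : b (zshift n (cstL x)) (zshift k (cstL y)) = (n == k)%:R * ip x y.
Proof.
rewrite L2bE /L2ip -subr_eq0 -cintegral_exprz.
transitivity (cintegral (fun z : T => ip x y * sval z ^ (n - k))).
  congr cintegral; apply/funext => z /=.
  rewrite dot_sform sformZl sformZr mulrA circle_exprC -expfzDr ?circle_neq0//.
  by rewrite mulrC.
by rewrite cintegralZ 1?mulrC//; exact: cintegrable_exprz.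
Qed.

Lemma snorm_cstL x : snorm b (cstL x) = hn x.
Proof.
rewrite /snorm /hnorm; congr (Num.sqrt (complex.Re _)).
by have := sform_zshift_cst 0 0 x x; rewrite !zshift0 eqxx mul1r.
Qed.

Lemma vintegral_linear (V : vectType R[i]) (f : T -> V) (phi : {linear V -> R[i]^o}) :
  (forall i, cintegrable (fun z => vcoord i (f z))) ->
  phi (vintegral f) = cintegral (fun z => phi (f z) : R[i]).
Proof.
move=> jf; rewrite /vintegral linear_sum /=.
transitivity (cintegral (fun z => \sum_(i < \dim {:V}) phi (vbasis {:V})`_i * vcoord i (f z))).
  rewrite cintegral_sum; last by move=> i; exact: cintegrable_scale.
  by apply: eq_bigr => i _; rewrite linearZ cintegralZ//= mulrC.
congr cintegral; apply/funext => z.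
rewrite [in RHS](coord_vbasis (memvf (f z))) linear_sum.
by apply: eq_bigr => i _; rewrite linearZ mulrC.
Qed.

Lemma L2_vcoord f i : L2 ip f -> cintegrable (fun z => vcoord i (f z)).
Proof.
move=> hf.
have lin : linear (fun y => vcoord i y : R[i]^o) by move=> a u v; rewrite /vcoord linearP.
pose phi := HB.pack (fun y => vcoord i y : R[i]^o)
    (GRing.isLinear.Build _ _ _ _ _ lin) : {linear H -> R[i]^o}.
have [y yP] := riesz ip phi.
have := cintegrable_ip hf (L2_cst ip y); congr cintegrable; apply/funext => z.
by rewrite yP.
Qed.

Lemma vintegral_ip f x : L2 ip f -> ip (vintegral f) x = cintegral (fun z => ip (f z) x).
Proof.
move=> hf.
have lin : linear (fun y => ip y x : R[i]^o) by move=> a u v; rewrite linearPl.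
pose phi := HB.pack (fun y => ip y x : R[i]^o)
    (GRing.isLinear.Build _ _ _ _ _ lin) : {linear H -> R[i]^o}.
by rewrite -[LHS]/(phi _) vintegral_linear// => i; exact: L2_vcoord.
Qed.

Definition fcoef (n : int) F : H := fourier F n.

Local Notation fc F n := (fcoef n F).

(** The bridge by which computations with coefficients become computations with the form. *)
Lemma ip_fc F n x : ip (fc F n) x = b F (zshift n (cstL x)).
Proof.
rewrite /fcoef /fourier vintegral_ip; last exact: L2_exprz (L2tP F).
rewrite L2bE; congr cintegral; apply/funext => z /=.
by rewrite !dot_sform sformZl sformZr circle_exprC.
Qed.

Lemma ip_injl x y : (forall w, ip x w = ip y w) -> x = y.
Proof.
by move=> h; apply: (ip_inj (ip := ip)) => w; rewrite dot_sformC h -dot_sformC.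
Qed.

Lemma fc_linear n : linear (fcoef n).
Proof.
move=> a F G; apply: ip_injl => w.
by rewrite linearPl /= !ip_fc sformP.
Qed.

HB.instance Definition _ n := GRing.isLinear.Build R[i] L H _ (fcoef n) (fc_linear n).

Lemma fcD F G n : fc (F + G) n = fc F n + fc G n.
Proof. exact: (linearD (fcoef n)). Qed.

Lemma fcB F G n : fc (F - G) n = fc F n - fc G n.
Proof. exact: (linearB (fcoef n)). Qed.

Lemma fc_sum (I : Type) (s : seq I) (A : I -> L) n :
  fc (\sum_(i <- s) A i) n = \sum_(i <- s) fc (A i) n.
Proof. exact: (linear_sum (fcoef n)). Qed.

Lemma fc_zshift k F n : fc (zshift k F) n = fc F (n - k).
Proof. by apply: ip_injl => w; rewrite !ip_fc sform_zshift_adj zshift_add addrC. Qed.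

Lemma fc_cstL x n : fc (cstL x) n = (n == 0)%:R *: x.
Proof.
apply: ip_injl => w; rewrite ip_fc -[cstL x]zshift0 sform_zshift_cst eq_sym.
by rewrite linearZl_LR.
Qed.

Lemma fc_ae F G n : ae_equal F G -> fc F n = fc G n.
Proof. by move=> FG; apply: ip_injl => w; rewrite !ip_fc (ae_equal_sform _ FG). Qed.

Lemma fc_eq0 F : (forall n, fc F n = 0) -> snorm b F = 0.
Proof.
move=> F0; apply/snorm_eq0_ae.
have [s sx] := parseval_frame ip.
have h v : {ae m, forall z, ip (F z) v = 0}.
  apply: null_coef_eq0; split.
    exact: cintegrable_ip (L2tP F) (L2_cst ip v).
  move=> n; have := congr1 (fun x => ip x v) (F0 (- n)).
  rewrite dot_sform [in RHS]dot_sform sform0l -dot_sform ip_fc L2bE => <-.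
  congr cintegral; apply/funext => z /=.
  by rewrite dot_sform [in RHS]dot_sform sformZr circle_exprC opprK.
have : {ae m, forall z, \sum_(v <- s) ip (F z) v *: v = 0}.
  elim: (s) => [|v s' IH]; first by apply: aeW => z; rewrite big_nil.
  by apply: filterS2 (h v) IH => z h1 h2; rewrite big_cons h1 h2 scale0r addr0.
by apply: filterS => z; rewrite -sx.
Qed.

Definition trigsum (y : nat -> H) (N : nat) : L := \sum_(n < N) zshift n%:Z (cstL (y n)).

Lemma trigsumS (y : nat -> H) N : trigsum y N.+1 = trigsum y N + zshift N%:Z (cstL (y N)).
Proof. by rewrite /trigsum big_ord_recr. Qed.

Lemma fc_trigsum_neg (y : nat -> H) N (n : int) : n < 0 -> fc (trigsum y N) n = 0.
Proof.
move=> n0; rewrite fc_sum big1// => i _; rewrite fc_zshift fc_cstL.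
rewrite subr_eq0 (_ : n == _ = false) ?scale0r//.
by apply/negbTE; rewrite neq_lt (lt_le_trans n0).
Qed.

Lemma fc_trigsum (y : nat -> H) N (n : nat) : fc (trigsum y N) n%:Z = (n < N)%:R *: y n.
Proof.
elim: N => [|N IH]; first by rewrite /trigsum big_ord0 (linear0 (fcoef _)) scale0r.
rewrite trigsumS fcD IH fc_zshift fc_cstL subr_eq0 eqz_nat ltnS.
have [->|nN] := eqVneq n N; first by rewrite ltnn leqnn scale0r add0r.
by rewrite scale0r addr0 [in RHS]leq_eqVlt (negbTE nN).
Qed.

Lemma snorm_trigsumB (y : nat -> H) N k :
  snorm b (trigsum y (N + k) - trigsum y N) ^+ 2 = \sum_(N <= n < N + k) hn (y n) ^+ 2.
Proof.
elim: k => [|k IH]; first by rewrite addn0 subrr snorm0 expr0n big_geq.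
rewrite addnS trigsumS addrAC snorm_pythagoras.
  by rewrite IH snorm_zshift snorm_cstL big_nat_recr//= leq_addr.
rewrite -ip_fc fcB !fc_trigsum ltnn ltnNge leq_addr /= scale0r subrr.
by rewrite dot_sform sform0l.
Qed.

Lemma snorm_trigsum (y : nat -> H) N : snorm b (trigsum y N) ^+ 2 = \sum_(0 <= n < N) hn (y n) ^+ 2.
Proof.
by have := snorm_trigsumB y 0 N; rewrite add0n {2}/trigsum big_ord0 subr0.
Qed.

Lemma integrable_of_le (g : T -> R) (c : R) : measurable_fun setT g ->
  (forall z, 0 <= g z) -> (\int[m]_z (g z)%:E <= c%:E)%E ->
  m.-integrable setT (EFin \o g) /\ \int[m]_z g z <= c.
Proof.
move=> mg g0 gc; have jg : m.-integrable setT (EFin \o g).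
  apply/integrableP; split; first exact/measurable_EFinP.
  apply: le_lt_trans (ltry c); apply: le_trans gc.
  by under eq_integral do rewrite gee0_abs ?lee_fin//.
split => //; rewrite -lee_fin /Rintegral fineK//.
exact: integrable_fin_num jg.
Qed.

Lemma integrable_sumr (I : eqType) (s : seq I) (g : I -> T -> R) (c : R) :
  (forall i, i \in s -> m.-integrable setT (EFin \o g i) /\ \int[m]_z g i z <= c) ->
  m.-integrable setT (EFin \o (fun z => \sum_(i <- s) g i z)) /\
  \int[m]_z (\sum_(i <- s) g i z) <= c *+ size s.
Proof.
elim: s => [_|i s IH h].
  split; first by under eq_fun do rewrite big_nil; exact: integrable0.
  by under eq_Rintegral do rewrite big_nil; rewrite Rintegral_cst// mul0r.
have [i1 i2] := h i (mem_head _ _).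
have [|s1 s2] := IH; first by move=> j js; apply: h; rewrite inE js orbT.
split.
  rewrite (_ : (fun z => _) = (fun z => g i z + \sum_(j <- s) g j z)).
    exact: integrable_addr.
  by apply/funext => z; rewrite big_cons.
under eq_Rintegral do rewrite big_cons.
by rewrite RintegralD// /= mulrS lerD.
Qed.

(** The scalar result is applied to the real and the imaginary part of each frame coefficient, and
    the limit is synthesized from the scalar limits. *)
Lemma L2t_complete (F : nat -> L) :
  (forall n, snorm b (F n.+1 - F n) ^+ 2 <= 4^-1 ^+ n) ->
  exists G : L, exists D : R, forall n, snorm b (G - F n) ^+ 2 <= D * 4^-1 ^+ n.
Proof.
move=> FF; have [s sx] := parseval_frame ip.
have vF n : vmeasurable (F n) by case: (L2tP (F n)).
have mF n v : cmeasurable (fun z => ip (F n z) v) by move: (vF n) => /(vmeasurable_ip ip).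
(* [pr] is the real or the imaginary part. The coefficient is bounded by the norm only for members
   of the frame; other vectors get a dummy function, so that [choice] yields a total map. *)
have lim (pr : R[i] -> R) : (forall a c, pr (a - c) = pr a - pr c) ->
    (forall v n, measurable_fun setT (fun z => pr (ip (F n z) v))) ->
    (forall v x, v \in s -> pr (ip x v) ^+ 2 <= hn x ^+ 2) ->
    forall v, exists g : T -> R, v \in s -> measurable_fun setT g /\
      forall n, (\int[m]_z ((g z - pr (ip (F n z) v)) ^+ 2)%:E <= (4 * 4^-1 ^+ n)%:E)%E.
  move=> prB mp prle v; have [vs|//] := boolP (v \in s); last by exists (fun=> 0).
  have [//|n|g mg gP] := @L2_complete_real R (fun n z => pr (ip (F n z) v)).
    apply: (@le_trans _ _ (snorm b (F n.+1 - F n) ^+ 2)%:E); last by rewrite lee_fin.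
    rewrite snorm_integral; apply: ge0_le_integral => //.
    - by move=> z _; rewrite lee_fin sqr_ge0.
    - by apply/measurable_EFinP; apply: measurable_funX; exact: measurable_funB.
    - by apply/measurable_EFinP; apply: measurable_hnorm2; case: (L2tP (F n.+1 - F n)).
    - move=> z _; rewrite lee_fin -prB L2tB.
      have -> : ip (F n.+1 z) v - ip (F n z) v = ip (F n.+1 z - F n z) v.
        by rewrite !dot_sform -sformBl.
      exact: prle.
  by exists g.
have prle v x : v \in s -> complex.Re (ip x v) ^+ 2 + complex.Im (ip x v) ^+ 2 <= hn x ^+ 2.
  move=> vs; rewrite (frame_hnorm sx) (big_rem v)//= lerDl sumr_ge0// => w _.
  by rewrite addr_ge0 ?sqr_ge0.
have [||v x vs|g gP] := choice (lim (@complex.Re R) _ _ _).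
- by move=> [? ?] [? ?].
- by move=> v n; case: (mF n v).
- by apply: le_trans (prle v x vs); rewrite lerDl sqr_ge0.
have [||v x vs|h hP] := choice (lim (@complex.Im R) _ _ _).
- by move=> [? ?] [? ?].
- by move=> v n; case: (mF n v).
- by apply: le_trans (prle v x vs); rewrite lerDr sqr_ge0.
pose G0 z : H := \sum_(v <- s) (g v z +i* h v z) *: v.
have vG0 : vmeasurable G0.
  apply/(vmeasurable_ip ip) => x; rewrite /G0.
  under eq_fun do rewrite dot_sform sform_suml big_seq.
  rewrite (_ : (fun z => _) = (fun z => \sum_(v <- s)
    ((if v \in s then g v z +i* h v z else 0) * ip v x))); last first.
    by apply/funext => z; rewrite -big_seq; apply: eq_big_seq => v vs; rewrite sformZl vs.
  apply: cmeasurable_sum => v; apply: cmeasurableM; last exact: cmeasurable_cst.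
  have [vs|_] := boolP (v \in s); last exact: cmeasurable_cst.
  by split; [case: (gP v vs)|case: (hP v vs)].
pose q n v z := (g v z - complex.Re (ip (F n z) v)) ^+ 2 + (h v z - complex.Im (ip (F n z) v)) ^+ 2.
have qle n z : hn (G0 z - F n z) ^+ 2 <= \sum_(v <- s) q n v z.
  rewrite {1}(sx (F n z)) /G0 -sumrB.
  under [X in hn X]eq_bigr do rewrite -scalerBl.
  apply: le_trans (frame_synthesis sx _) _; rewrite le_eqVlt; apply/orP; left; apply/eqP.
  by apply: eq_bigr => v _; rewrite /q; case: (ip (F n z) v).
have qint n : m.-integrable setT (EFin \o (fun z => \sum_(v <- s) q n v z)) /\
    \int[m]_z (\sum_(v <- s) q n v z) <= (8 * 4^-1 ^+ n) *+ size s.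
  apply: integrable_sumr => v vs; have [mg gn] := gP v vs; have [mh hh] := hP v vs.
  have [m1 m2] := mF n v.
  have ma : measurable_fun setT (fun z => (g v z - complex.Re (ip (F n z) v)) ^+ 2).
    by apply: measurable_funX; exact: measurable_funB.
  have mb : measurable_fun setT (fun z => (h v z - complex.Im (ip (F n z) v)) ^+ 2).
    by apply: measurable_funX; exact: measurable_funB.
  have [a1 a2] := integrable_of_le ma (fun z => sqr_ge0 _) (gn n).
  have [b1 b2] := integrable_of_le mb (fun z => sqr_ge0 _) (hh n).
  split; first exact: integrable_addr.
  rewrite /q RintegralD//; move: a2 b2; lra.
(* The differences are controlled, not [G0] itself: [G0] is square-integrable because [G0 - F 0] and
   [F 0] are. *)
have hG0 n : L2 ip (fun z => G0 z - F n z).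
  have vGF : vmeasurable (fun z => G0 z - F n z).
    rewrite (_ : (fun z => _) = (fun z => (-1) *: F n z + G0 z)).
      exact: (vmeasurable_lin ip).
    by apply/funext => z; rewrite scaleN1r addrC.
  split => //; apply: (integrable_le _ (qint n).1); first exact: measurable_hnorm2.
  by move=> z; rewrite ger0_norm ?sqr_ge0.
have hG : L2 ip G0.
  have := L2_lin 1 (hG0 0%N) (L2tP (F 0%N)); congr (L2 ip).
  by apply/funext => z; rewrite scale1r subrK.
(* Each frame vector contributes 4 for the real and 4 for the imaginary part. *)
exists (toL2 hG); exists (8 *+ size s) => n.
rewrite L2form_integral mulrnAl; apply: le_trans (qint n).2.
apply: le_Rintegral => //.
- by have [] := L2tP (toL2 hG - F n).
- exact: (qint n).1.
- by move=> z _; rewrite L2tB; exact: qle.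
Qed.

(** [L2t_complete] asks for squared increments of size 4^-k, so a subsequence of the partial sums is
    taken; the tail bound then controls the whole sequence by the nearest earlier member of it. *)
Lemma riesz_fischer (y : nat -> H) (C : R) :
  (forall N, \sum_(0 <= n < N) hn (y n) ^+ 2 <= C) ->
  exists W : L, (fun N => snorm b (W - trigsum y N)) @ \oo --> (0 : R).
Proof.
move=> yC; pose s := series (fun n => hn (y n) ^+ 2).
have sE N : s N = \sum_(0 <= n < N) hn (y n) ^+ 2 by [].
have nd : nondecreasing_seq s.
  by apply: nondecreasing_series => n _ _; exact: sqr_ge0.
have cs : cvgn s.
  by apply: nondecreasing_is_cvgn => //; exists C => _ [N _ <-]; exact: yC.
have sl n : s n <= limn s by exact: nondecreasing_cvgn_le.
have diff N k : snorm b (trigsum y (N + k) - trigsum y N) ^+ 2 = s (N + k)%N - s N.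
  by rewrite snorm_trigsumB !sE (@big_cat_nat _ _ _ N 0 (N + k))//= ?leq_addr// addrAC subrr add0r.
have ex (j : nat) : exists N, forall n, (N <= n)%N -> limn s - s n <= 4^-1 ^+ j.
  have /cvgrPdist_le /(_ (4^-1 ^+ j)) := cs.
  move=> /(_ _)[|N _ h]; first by rewrite exprn_gt0.
  exists N => n Nn; have := h n Nn; rewrite ger0_norm ?subr_ge0//.
have [N' N'P] := choice ex.
(* Summing the indices makes [N] nondecreasing while keeping [N k] at least [N' k]. *)
pose N k := (\sum_(i < k.+1) N' i)%N.
have NP k n : (N k <= n)%N -> limn s - s n <= 4^-1 ^+ k.
  move=> Nn; apply: N'P; apply: leq_trans Nn.
  by rewrite /N big_ord_recr /= leq_addl.
have Nle k : (N k <= N k.+1)%N by rewrite {2}/N big_ord_recr /= leq_addr.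
have d k n : (N k <= n)%N -> snorm b (trigsum y n - trigsum y (N k)) ^+ 2 <= 4^-1 ^+ k.
  move=> kn; have := diff (N k) (n - N k)%N; rewrite subnKC// => ->.
  by apply: le_trans (NP k _ (leqnn _)); rewrite lerD2r.
have [W [D WD]] := @L2t_complete (fun k => trigsum y (N k)) (fun k => d k _ (Nle k)).
exists W.
have bnd k n : (N k <= n)%N -> snorm b (W - trigsum y n) ^+ 2 <= (2 * D + 2) * 4^-1 ^+ k.
  move=> kn; rewrite -(subrK (trigsum y (N k)) W) -addrA.
  have h1 := snorm_sqrD b (W - trigsum y (N k)) (trigsum y (N k) - trigsum y n).
  have h2 := WD k; have := d k n kn; rewrite snormB => h3.
  by apply: le_trans h1 _; move: h2 h3; set x := 4^-1 ^+ k; nra.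
apply/cvgrPdist_le => e e0.
have : (fun k => (2 * D + 2) * 4^-1 ^+ k) @ \oo --> (0 : R).
  rewrite -(mulr0 (2 * D + 2)); apply: cvgM; first exact: cvg_cst.
  by apply: cvg_expr; rewrite ger0_norm// invf_lt1// ltr1n.
move=> /cvgrPdist_le/(_ (e ^+ 2)) [|k _ /(_ k (leqnn k)) h]; first by rewrite exprn_gt0.
exists (N k) => // n /= kn; rewrite sub0r normrN ger0_norm ?snorm_ge0//.
rewrite -(@ler_pXn2r _ 2) ?nnegrE ?snorm_ge0//; last exact: ltW.
apply: le_trans (bnd _ _ kn) _.
by apply: le_trans h; rewrite sub0r normrN; exact: ler_norm.
Qed.

Definition fpart F N : L := trigsum (fun n => fc F n%:Z) N.

(** Bessel's inequality feeds Riesz-Fischer, which produces some [W] as the limit of the partial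
    sums; [W] has the coefficients of [F], and uniqueness of coefficients identifies the two up to a
    null function. *)
Lemma fpart_cvg F : (forall n : int, n < 0 -> fc F n = 0) ->
  (fun N => snorm b (F - fpart F N)) @ \oo --> (0 : R).
Proof.
move=> F0.
have bessel N : \sum_(0 <= n < N) hn (fc F n%:Z) ^+ 2 <= snorm b F ^+ 2.
  rewrite -snorm_trigsum -/(fpart F N) -[F in leRHS](subrK (fpart F N)) addrC.
  rewrite snorm_pythagoras ?lerDl ?sqr_ge0//.
  rewrite {1}/fpart /trigsum sform_suml big1// => i _.
  rewrite sformC -ip_fc fcB fc_trigsum ltn_ord scale1r subrr.
  by rewrite dot_sform sform0l conjC0.
have [W WP] := riesz_fischer bessel.
suff FW : snorm b (F - W) = 0.
  apply: (@squeeze_cvgr _ _ _ _ (fun=> 0) (fun N => snorm b (W - fpart F N))) => //.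
    apply: nearW => N; rewrite snorm_ge0 /= -(subrK W F) -addrA.
    by apply: le_trans (snormD _ _ _) _; rewrite FW add0r.
  exact: cvg_cst.
apply: fc_eq0 => n; apply: ip_injl => x.
rewrite [in RHS]dot_sform sform0l ip_fc.
have eN N : (n < N%:Z) -> fc (F - fpart F N) n = 0.
  rewrite fcB; case: n => n nN.
    by rewrite fc_trigsum -ltz_nat nN scale1r subrr.
  by rewrite fc_trigsum_neg// F0// subrr.
(* The n-th coefficients agree only once [N] exceeds [n]; before that a crude value keeps the bound
   true for every [N]. *)
pose e N := if n < N%:Z then snorm b (W - fpart F N) else 1 + snorm b (F - W).
have eW : e @ \oo --> (0 : R).
  apply: cvg_trans WP; apply: near_eq_cvg.
  exists `|n|.+1 => // N /= nN; rewrite /e ifT//.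
  by apply: le_lt_trans (lez_abs n) _; rewrite ltz_nat.
apply: (eq0_of_cvg (M := snorm b (zshift n (cstL x))) eW) => N.
rewrite /e; case: ifPn => nN.
  rewrite (_ : F - W = (F - fpart F N) - (W - fpart F N)); last first.
    by rewrite opprB addrA subrK.
  rewrite sformBl -ip_fc eN// dot_sform sform0l sub0r normrN mulrC.
  exact: cauchy_schwarz.
apply: le_trans (cauchy_schwarz _ _ _) _.
by rewrite mulrC ler_wpM2l ?snorm_ge0// lerDr.
Qed.

End L2Operators.

(** * Operator-valued symbols, bounded functions and Hardy functions *)

Section OperatorFunctions.
Variables (R : realType) (H : vectType R[i]) (ip : {dot H for Num.conj}).
Local Notation m := (circle_leb R).
Local Notation T := (circle R).
Local Notation hn := (hnorm ip).
Local Notation L := (L2t ip).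
Local Notation b := (L2form ip).
Implicit Types (f g : T -> H) (x y v w : H) (F G : L) (B : 'End(H)) (Phi : T -> 'End(H)).

Lemma End_ip_linear x y : linear (fun B : 'End(H) => ip (B x) y : R[i]^o).
Proof. by move=> a B C; rewrite add_lfunE scale_lfunE linearPl. Qed.

Definition End_ip x y : {linear 'End(H) -> R[i]^o} :=
  HB.pack (fun B : 'End(H) => ip (B x) y : R[i]^o)
    (GRing.isLinear.Build _ _ _ _ _ (End_ip_linear x y)).

Lemma vmeasurable_op Phi f : vmeasurable Phi -> vmeasurable f ->
  vmeasurable (op_mul Phi f).
Proof.
move=> mP mf; apply/(vmeasurable_ip ip) => y; have [s sx] := parseval_frame ip.
rewrite (_ : (fun z => _) = (fun z => \sum_(v <- s) ip (f z) v * ip (Phi z v) y)).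
  apply: cmeasurable_sum => v; apply: cmeasurableM.
    by move: mf => /(vmeasurable_ip ip); exact.
  exact: (vmeasurable_linear (End_ip v y) mP).
apply/funext => z; rewrite /op_mul {1}(sx (f z)) linear_sum dot_sform sform_suml.
by apply: eq_bigr => v _; rewrite linearZ sformZl.
Qed.

Lemma rank1_linear v w : linear (fun x => ip x v *: w).
Proof. by move=> a x y; rewrite linearPl scalerDl scalerA. Qed.

Definition rank1 v w : 'End(H) := linfun (HB.pack (fun x => ip x v *: w)
    (GRing.isLinear.Build _ _ _ _ _ (rank1_linear v w)) : {linear H -> H}).

Lemma rank1E v w x : rank1 v w x = ip x v *: w.
Proof. by rewrite lfunE. Qed.

Lemma End_frame (s : seq H) : (forall x, x = \sum_(v <- s) ip x v *: v) ->
  forall B, B = \sum_(v <- s) \sum_(w <- s) ip (B v) w *: rank1 v w.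
Proof.
move=> sx B; apply/lfunP => x; rewrite sum_lfunE {1}(sx x) linear_sum.
apply: eq_bigr => v _; rewrite linearZ /= {1}(sx (B v)) scaler_sumr sum_lfunE.
by apply: eq_bigr => w _; rewrite scale_lfunE rank1E !scalerA mulrC.
Qed.

Lemma vcoord_End (s : seq H) : (forall x, x = \sum_(v <- s) ip x v *: v) ->
  forall i B, vcoord i B = \sum_(v <- s) \sum_(w <- s) ip (B v) w * vcoord i (rank1 v w).
Proof.
move=> sx i B; rewrite {1}(End_frame sx B) /vcoord linear_sum.
apply: eq_bigr => v _; rewrite linear_sum; apply: eq_bigr => w _.
by rewrite linearZ.
Qed.

(** The squared Hilbert-Schmidt norm is the sum of the squared norms of the columns over a frame, so
    symbols can be handled column by column. *)
Lemma L2opP Phi : L2op ip Phi <-> forall x, L2 ip (fun z => Phi z x).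
Proof.
have [s sx] := parseval_frame ip.
have mP : vmeasurable Phi <-> forall x, vmeasurable (fun z => Phi z x).
  split=> [h x|h i].
    apply/(vmeasurable_ip ip) => y; exact: (vmeasurable_linear (End_ip x y) h).
  rewrite -/(cmeasurable (fun z => vcoord i (Phi z))).
  under eq_fun do rewrite (vcoord_End sx).
  apply: cmeasurable_sum => v; apply: cmeasurable_sum => w.
  apply: (@cmeasurableM _ (fun z => ip (Phi z v) w)); last exact: cmeasurable_cst.
  by move: (h v) => /(vmeasurable_ip ip); exact.
split=> [[/mP h1 h2] x|h].
  split => //; apply: (integrable_le (h := fun z => hn x ^+ 2 * hsnorm ip (Phi z) ^+ 2)).
  - exact: measurable_hnorm2.
  - exact: integrable_scale.
  - move=> z; rewrite ger0_norm ?sqr_ge0// mulrC -exprMn.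
    by rewrite ler_pXn2r ?nnegrE ?mulr_ge0 ?sqrtr_ge0 ?hnorm_le_hsnorm.
split; first by apply/mP => x; case: (h x).
under eq_fun do rewrite (hsnorm_frame sx).
have [] := @integrable_sumr R H s (fun v z => hn (Phi z v) ^+ 2)
    (\sum_(v <- s) \int[m]_z (hn (Phi z v) ^+ 2)) => // v vs.
split; first by case: (h v).
rewrite (big_rem v)//= lerDl sumr_ge0// => w _.
by apply: Rintegral_ge0 => z _; exact: sqr_ge0.
Qed.

Lemma L2op_adjoint Phi : L2op ip Phi -> L2op ip (fun z => adjoint ip (Phi z)).
Proof.
move=> /L2opP h; apply/L2opP => x; have [s sx] := parseval_frame ip.
have mv : vmeasurable (fun z => adjoint ip (Phi z) x).
  apply/(vmeasurable_ip ip) => y.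
  under eq_fun do rewrite adjoint_ip dot_sformC.
  by apply: cmeasurableC; case: (h y) => /(vmeasurable_ip ip) + _; exact.
split => //.
apply: (integrable_le (h := fun z => \sum_(v <- s) hn x ^+ 2 * hn (Phi z v) ^+ 2)).
- exact: measurable_hnorm2.
- have [] := @integrable_sumr R H s (fun v z => hn x ^+ 2 * hn (Phi z v) ^+ 2)
    (\sum_(v <- s) \int[m]_z (hn x ^+ 2 * hn (Phi z v) ^+ 2)) => // v vs.
  split; first by apply: integrable_scale; case: (h v).
  rewrite (big_rem v)//= lerDl sumr_ge0// => w _.
  by apply: Rintegral_ge0 => z _; rewrite mulr_ge0 ?sqr_ge0.
- move=> z; rewrite ger0_norm ?sqr_ge0// (frame_hnorm sx); apply: ler_sum => v _.
  by rewrite adjoint_ip; exact: csq_ip_le.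
Qed.

Lemma L2op_add Phi Psi : L2op ip Phi -> L2op ip Psi ->
  L2op ip (fun z => Phi z + Psi z).
Proof.
move=> /L2opP h1 /L2opP h2; apply/L2opP => x.
have := L2_lin 1 (h1 x) (h2 x); congr (L2 ip); apply/funext => z.
by rewrite scale1r add_lfunE.
Qed.

Definition bounded F : Prop := ess_bounded hn F.

Lemma L2_op_bounded Phi F : L2op ip Phi -> bounded F -> L2 ip (op_mul Phi F).
Proof.
move=> [mP jP] [M FM]; split; first by apply: vmeasurable_op => //; case: (L2tP F).
apply: (integrable_le_ae (h := fun z => `|M| ^+ 2 * hsnorm ip (Phi z) ^+ 2)).
- by apply: measurable_hnorm2; apply: vmeasurable_op => //; case: (L2tP F).
- exact: integrable_scale.
- apply: filterS FM => z FzM; rewrite ger0_norm ?sqr_ge0// mulrC -exprMn.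
  rewrite ler_pXn2r ?nnegrE ?mulr_ge0 ?sqrtr_ge0//.
  apply: le_trans (hnorm_le_hsnorm _ _ _) _; apply: ler_wpM2l; first exact: sqrtr_ge0.
  exact: le_trans FzM (ler_norm _).
Qed.

(** Made total by the default 0; [opLE] shows that the default is not met for a symbol in [L2op] and
    a bounded function. *)
Definition opL Phi F : L :=
  if pselect (L2 ip (op_mul Phi F)) is left h then toL2 h else 0.

Lemma opLE Phi F : L2op ip Phi -> bounded F -> forall z, opL Phi F z = Phi z (F z).
Proof. by move=> hP bF z; rewrite /opL; case: pselect => // -[]; exact: L2_op_bounded. Qed.

Lemma bounded_lin (a : R[i]) F G : bounded F -> bounded G -> bounded (a *: F + G).
Proof.
move=> [M FM] [N GN]; exists (complex.Re `|a| * M + N).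
apply: filterS2 FM GN => z h1 h2; rewrite L2tD L2tZ !hnormE.
apply: le_trans (snormD _ _ _) _; rewrite snormZ lerD//.
by apply: ler_wpM2l => //; exact: cabs_ge0.
Qed.

Lemma bounded0 : bounded 0.
Proof. by exists 0; apply: aeW => z; rewrite hnormE snorm0. Qed.

Lemma boundedD F G : bounded F -> bounded G -> bounded (F + G).
Proof. by move=> hF hG; have := bounded_lin 1 hF hG; rewrite scale1r. Qed.

Lemma boundedB F G : bounded F -> bounded G -> bounded (F - G).
Proof. by move=> hF hG; have := bounded_lin (-1) hG hF; rewrite scaleN1r addrC. Qed.

Lemma bounded_sum (I : Type) (s : seq I) (A : I -> L) :
  (forall i, bounded (A i)) -> bounded (\sum_(i <- s) A i).
Proof.
move=> bA; elim: s => [|i s IH]; first by rewrite big_nil; exact: bounded0.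
by rewrite big_cons; exact: boundedD.
Qed.

Lemma bounded_zshift n F : bounded F -> bounded (zshift n F).
Proof.
move=> [M FM]; exists M; apply: filterS FM => z.
by rewrite /= !hnormE snormZ norm_exprz mul1r.
Qed.

Lemma bounded_cstL x : bounded (cstL ip x).
Proof. by exists (hn x); apply: aeW. Qed.

Lemma bounded_trigsum (y : nat -> H) N : bounded (trigsum ip y N).
Proof. by apply: bounded_sum => i; apply: bounded_zshift; exact: bounded_cstL. Qed.

Lemma sform_opL_adj Phi F G : L2op ip Phi -> bounded F -> bounded G ->
  b (opL Phi F) G = b F (opL (fun z => adjoint ip (Phi z)) G).
Proof.
move=> hP bF bG; rewrite !L2bE; congr cintegral; apply/funext => z.
by rewrite !opLE//; [exact: adjointP|exact: L2op_adjoint].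
Qed.

Lemma opL_lin Phi (a : R[i]) F G : L2op ip Phi -> bounded F -> bounded G ->
  opL Phi (a *: F + G) = a *: opL Phi F + opL Phi G.
Proof.
move=> hP bF bG; apply: L2t_eq => z; rewrite L2tD L2tZ !opLE//; last exact: bounded_lin.
by rewrite L2tD L2tZ linearP.
Qed.

Lemma opL_zshift Phi n F : L2op ip Phi -> bounded F -> opL Phi (zshift n F) = zshift n (opL Phi F).
Proof.
move=> hP bF; apply: L2t_eq => z; rewrite [RHS]/= !opLE//; last exact: bounded_zshift.
by rewrite linearZ.
Qed.

Definition hardy F : Prop := forall n : int, n < 0 -> fcoef n F = 0.

Lemma hardy_lin (a : R[i]) F G : hardy F -> hardy G -> hardy (a *: F + G).
Proof. by move=> hF hG n n0; rewrite fc_linear hF// hG// scaler0 addr0. Qed.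

Lemma hardy0 : hardy 0.
Proof. by move=> n _; exact: linear0. Qed.

Lemma hardyD F G : hardy F -> hardy G -> hardy (F + G).
Proof. by move=> hF hG; have := hardy_lin 1 hF hG; rewrite scale1r. Qed.

Lemma hardyB F G : hardy F -> hardy G -> hardy (F - G).
Proof. by move=> hF hG; have := hardy_lin (-1) hG hF; rewrite scaleN1r addrC. Qed.

Lemma hardy_sum (I : Type) (s : seq I) (A : I -> L) :
  (forall i, hardy (A i)) -> hardy (\sum_(i <- s) A i).
Proof.
move=> bA; elim: s => [|i s IH]; first by rewrite big_nil; exact: hardy0.
by rewrite big_cons; exact: hardyD.
Qed.

Lemma hardy_cstL x : hardy (cstL ip x).
Proof. by move=> n n0; rewrite fc_cstL lt_eqF// scale0r. Qed.

Lemma hardy_zshift (n : nat) F : hardy F -> hardy (zshift n%:Z F).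
Proof.
move=> hF k k0; rewrite fc_zshift hF//; rewrite subr_lt0.
by apply: lt_le_trans k0 _.
Qed.

Lemma hardy_trigsum (y : nat -> H) N : hardy (trigsum ip y N).
Proof. by move=> n n0; exact: fc_trigsum_neg. Qed.

Lemma hardy_lim (e : nat -> L) F : (forall n, hardy (e n)) ->
  (fun n => snorm b (F - e n)) @ \oo --> (0 : R) -> hardy F.
Proof.
move=> he ec n n0; apply: (ip_injl (ip := ip)) => x.
rewrite [in RHS]dot_sform sform0l ip_fc.
apply: (eq0_of_cvg (M := snorm b (zshift n (cstL ip x))) ec) => k.
rewrite (_ : b F _ = b (F - e k) (zshift n (cstL ip x))).
  by rewrite mulrC; exact: cauchy_schwarz.
by rewrite sformBl -[b (e k) _]ip_fc he// dot_sform sform0l subr0.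
Qed.

Lemma sform_hardy_anti F G : hardy F -> (forall n : nat, fcoef n%:Z G = 0) -> b F G = 0.
Proof.
move=> hF G0; apply: (eq0_of_cvg (M := snorm b G) (fpart_cvg hF)) => N.
rewrite (_ : b F G = b (F - fpart F N) G); first by rewrite mulrC; exact: cauchy_schwarz.
rewrite sformBl /fpart /trigsum sform_suml big1 ?subr0// => i _.
by rewrite sformC -ip_fc G0 dot_sform sform0l conjC0.
Qed.

End OperatorFunctions.

(** * The model space of an inner function *)

Section ModelSpace.
Variables (R : realType) (H : vectType R[i]) (ip : {dot H for Num.conj}).
Local Notation m := (circle_leb R).
Local Notation T := (circle R).
Local Notation hn := (hnorm ip).
Local Notation L := (L2t ip).
Local Notation b := (L2form ip).
Local Notation fc F n := (fcoef n F).
Variable Th : T -> 'End(H).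
Hypothesis hTh : inner ip Th.
Implicit Types (f g : T -> H) (x y v w : H) (F G : L).

Lemma inner_L2op : L2op ip Th.
Proof. by case: hTh => -[[]]. Qed.

Lemma inner_unitary : {ae m, forall z, unitary ip (Th z)}.
Proof. by case: hTh. Qed.

Lemma unitary_adjoint_hnorm (B : 'End(H)) x : unitary ip B -> hn (adjoint ip B x) = hn x.
Proof.
move=> [_ u]; rewrite /hnorm adjoint_ip -comp_lfunE u.
by rewrite id_lfunE.
Qed.

Lemma L2_inner F : L2 ip (op_mul Th F).
Proof.
apply: (L2_le (M := 1) _ (L2tP F)).
  by apply: (vmeasurable_op ip); [case: inner_L2op|case: (L2tP F)].
apply: filterS inner_unitary => z u.
by rewrite /op_mul unitary_hnorm// mul1r.
Qed.

Lemma L2_inner_adj F : L2 ip (op_mul (fun z => adjoint ip (Th z)) F).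
Proof.
apply: (L2_le (M := 1) _ (L2tP F)).
  by apply: (vmeasurable_op ip); [case: (L2op_adjoint inner_L2op)|case: (L2tP F)].
apply: filterS inner_unitary => z u.
by rewrite /op_mul unitary_adjoint_hnorm// mul1r.
Qed.

Definition mulTh F : L := toL2 (L2_inner F).

Definition mulThA F : L := toL2 (L2_inner_adj F).

Lemma mulTh_linear : linear mulTh.
Proof.
move=> a F G; apply: L2t_eq => z.
change (Th z (a *: F z + G z) = a *: Th z (F z) + Th z (G z)).
by rewrite linearP.
Qed.

HB.instance Definition _ := GRing.isLinear.Build R[i] L L _ mulTh mulTh_linear.

Lemma mulThB F G : mulTh (F - G) = mulTh F - mulTh G.
Proof. exact: linearB. Qed.

Lemma mulThA_linear : linear mulThA.
Proof.
move=> a F G; apply: L2t_eq => z.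
change (adjoint ip (Th z) (a *: F z + G z) =
  a *: adjoint ip (Th z) (F z) + adjoint ip (Th z) (G z)).
by rewrite linearP.
Qed.

HB.instance Definition _ := GRing.isLinear.Build R[i] L L _ mulThA mulThA_linear.

Lemma mulThAB F G : mulThA (F - G) = mulThA F - mulThA G.
Proof. exact: linearB. Qed.

Lemma mulTh_zshift n F : mulTh (zshift n F) = zshift n (mulTh F).
Proof. by apply: L2t_eq => z; rewrite /= /op_mul /= linearZ. Qed.

Lemma mulThA_zshift n F : mulThA (zshift n F) = zshift n (mulThA F).
Proof. by apply: L2t_eq => z; rewrite /= /op_mul /= linearZ. Qed.

Lemma sform_mulTh_adj F G : b (mulTh F) G = b F (mulThA G).
Proof. by rewrite !L2bE; congr cintegral; apply/funext => z; exact: adjointP. Qed.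

Lemma mulThA_mulTh F : ae_equal (mulThA (mulTh F)) F.
Proof.
apply: filterS inner_unitary => z [u _].
by rewrite /= /op_mul /= /op_mul -comp_lfunE u id_lfunE.
Qed.

Lemma sform_mulTh F G : b (mulTh F) (mulTh G) = b F G.
Proof. by rewrite sform_mulTh_adj sformC (ae_equal_sform _ (mulThA_mulTh G)) -sformC. Qed.

Lemma snorm_mulTh F : snorm b (mulTh F) = snorm b F.
Proof. by rewrite /snorm sform_mulTh. Qed.

Lemma fourier_inner n x : fourier Th n x = fc (mulTh (cstL ip x)) n.
Proof.
have [s sx] := parseval_frame ip.
have /L2opP hL := inner_L2op.
apply: (ip_injl (ip := ip)) => y; rewrite ip_fc -[LHS]/(End_ip ip x y _).
rewrite /fourier vintegral_linear.
  rewrite L2bE; congr cintegral; apply/funext => z.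
  by rewrite linearZ /= /op_mul [RHS]dot_sform sformZr circle_exprC.
move=> i.
have e (z : T) : vcoord i (sval z ^ (- n) *: Th z) = \sum_(v <- s) \sum_(w <- s)
    vcoord i (rank1 ip v w) * (sval z ^ (- n) * ip (Th z v) w).
  rewrite {1}/vcoord linearZ /= -/(vcoord i (Th z)) (vcoord_End sx) mulr_sumr.
  apply: eq_bigr => v _; rewrite mulr_sumr; apply: eq_bigr => w _.
  by rewrite mulrA mulrC.
rewrite (funext e).
apply: cintegrable_sum => v; apply: cintegrable_sum => w; apply: cintegrable_scale.
have := cintegrable_ip (hL v) (L2_exprz n (L2_cst ip w)); congr cintegrable.
by apply/funext => z; rewrite dot_sform sformZr circle_exprC.
Qed.

Lemma hardy_mulTh_cstL x : hardy (mulTh (cstL ip x)).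
Proof.
move=> n n0; rewrite -fourier_inner.
by have [[[_ ->]]] := hTh; rewrite ?zero_lfunE.
Qed.

(** True for monomials by analyticity of the columns of Theta, hence for polynomials; the isometry
    of [mulTh] passes it to limits. *)
Lemma hardy_mulTh F : hardy F -> hardy (mulTh F).
Proof.
move=> hF; apply: (hardy_lim (e := fun N => mulTh (fpart F N))).
  move=> N; rewrite /fpart /trigsum linear_sum; apply: hardy_sum => i.
  by rewrite /= mulTh_zshift; apply: hardy_zshift; exact: hardy_mulTh_cstL.
rewrite (_ : (fun N => _) = (fun N => snorm b (F - fpart F N))).
  exact: fpart_cvg.
by apply/funext => N; rewrite -mulThB snorm_mulTh.
Qed.

(** Dual to [hardy_mulTh_cstL]: multiplying a constant by Theta^* produces only nonpositive
    frequencies. *)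
Lemma fc_mulThA_cstL x (n : int) : 0 < n -> fc (mulThA (cstL ip x)) n = 0.
Proof.
move=> n0; apply: (ip_injl (ip := ip)) => y; rewrite [in RHS]dot_sform sform0l.
rewrite ip_fc sformC -sform_mulTh_adj mulTh_zshift sform_zshift_adj -[cstL ip x]zshift0.
rewrite zshift_add -[b _ _]ip_fc addr0 hardy_mulTh_cstL ?oppr_lt0//.
by rewrite dot_sform sform0l conjC0.
Qed.

(** Orthogonality to Theta H^2, moved across the adjoint: Theta^* F has no frequency >= 0. See
    [model_spaceP]. *)
Definition K F : Prop := hardy F /\ forall n : nat, fc (mulThA F) n%:Z = 0.

Lemma K_lin (a : R[i]) F G : K F -> K G -> K (a *: F + G).
Proof.
move=> [hF kF] [hG kG]; split; first exact: hardy_lin.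
by move=> n; rewrite mulThA_linear fc_linear kF kG scaler0 addr0.
Qed.

Lemma K0 : K 0.
Proof. by split; [exact: hardy0|move=> n; rewrite linear0 (linear0 (fcoef n%:Z))]. Qed.

Lemma KD F G : K F -> K G -> K (F + G).
Proof. by move=> hF hG; have := K_lin 1 hF hG; rewrite scale1r. Qed.

Lemma KB F G : K F -> K G -> K (F - G).
Proof. by move=> hF hG; have := K_lin (-1) hG hF; rewrite scaleN1r addrC. Qed.

Lemma K_sum (I : Type) (s : seq I) (A : I -> L) :
  (forall i, K (A i)) -> K (\sum_(i <- s) A i).
Proof.
move=> bA; elim: s => [|i s IH]; first by rewrite big_nil; exact: K0.
by rewrite big_cons; exact: KD.
Qed.

Lemma K_ortho F G : K F -> hardy G -> b F (mulTh G) = 0.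
Proof.
move=> [hF kF] hG; rewrite sformC sform_mulTh_adj.
by rewrite sform_hardy_anti ?conjC0.
Qed.

Lemma KP F : hardy F -> (forall G, hardy G -> b F (mulTh G) = 0) -> K F.
Proof.
move=> hF kF; split => // n; apply: (ip_injl (ip := ip)) => y.
rewrite [in RHS]dot_sform sform0l ip_fc sformC -sform_mulTh_adj -sformC kF//.
by apply: hardy_zshift; exact: hardy_cstL.
Qed.

Lemma H2P f : H2 ip f <-> exists hf : L2 ip f, hardy (toL2 hf).
Proof.
split=> [[hf h0]|[hf h0]]; first by exists hf.
by split => // n n0; exact: (h0 n n0).
Qed.

Lemma model_spaceP F : model_space ip Th F <-> K F.
Proof.
split=> [[/H2P[hF h0] o]|[hF kF]].
  have -> : F = toL2 hF by exact: L2t_eq.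
  apply: KP => // G hG; rewrite L2bE; apply: o.
  by exists (G : T -> H) => //; split; first exact: L2tP.
split.
  by split; [exact: L2tP|exact: hF].
move=> g [h /H2P[hh hh2] <-].
by have := K_ortho (conj hF kF) hh2; rewrite L2bE.
Qed.

Lemma model_space_L2 f : model_space ip Th f -> L2 ip f.
Proof. by case=> -[]. Qed.

Lemma model_space_infP F : model_space_inf ip Th F <-> K F /\ bounded F.
Proof.
split=> [[/model_spaceP kF [_ bF]]|[kF bF]]; first by split.
split; first exact/model_spaceP.
by split => //; split; [exact: L2tP|case: kF].
Qed.

Definition bshift F : L := zshift (-1) (F - cstL ip (fc F 0)).

Lemma bshift_linear : linear bshift.
Proof.
move=> a F G; rewrite /bshift -linearP /= fc_linear linearP /=.
by congr (zshift _ _); rewrite scalerBr opprD addrACA.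
Qed.

HB.instance Definition _ := GRing.isLinear.Build R[i] L L _ bshift bshift_linear.

Lemma bshiftB F G : bshift (F - G) = bshift F - bshift G.
Proof. exact: linearB. Qed.

Lemma bshift_sum (I : Type) (s : seq I) (c : I -> R[i]) (E : I -> L) :
  bshift (\sum_(i <- s) c i *: E i) = \sum_(i <- s) c i *: bshift (E i).
Proof.
rewrite linear_sum; apply: eq_bigr => i _.
exact: linearZ.
Qed.

Lemma hardy_bshift F : hardy F -> hardy (bshift F).
Proof.
move=> hF n n0; rewrite fc_zshift fcB fc_cstL opprK.
have [->|n1] := eqVneq (n + 1) 0; first by rewrite scale1r subrr.
rewrite scale0r subr0 hF// lt_neqAle n1 /=.
by rewrite lezD1.
Qed.

(** Subtracting the constant F(0) alters Theta^* F only at frequencies <= 0, whereas the nonnegative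
    frequencies after the shift come from those >= 1. *)
Lemma K_bshift F : K F -> K (bshift F).
Proof.
move=> [hF kF]; split; first exact: hardy_bshift.
move=> n; rewrite mulThA_zshift fc_zshift opprK mulThAB fcB.
by rewrite fc_mulThA_cstL// subr0 -[n%:Z + 1]/(n%:Z + 1%:Z) -PoszD addn1 kF.
Qed.

Lemma bshift_zshift F : fc F 0 = 0 -> bshift F = zshift (-1) F.
Proof. by move=> F0; rewrite /bshift F0 linear0 subr0. Qed.

Definition Th0 : 'End(H) := disk_value Th 0.

Lemma disk_value0 (V : vectType R[i]) (f : T -> V) : disk_value f 0 = fourier f 0.
Proof.
rewrite /disk_value /fourier; congr vintegral; apply/funext => z.
by rewrite mul0r subr0 invr1 oppr0 expr0z.
Qed.

Lemma Th0E x : Th0 x = fc (mulTh (cstL ip x)) 0.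
Proof. by rewrite /Th0 disk_value0 fourier_inner. Qed.

(** The reproducing kernel of the model space at the origin in the direction [x], as [sform_kern]
    shows; these functions make up [defect]. *)
Definition kern x : L := cstL ip x - mulTh (cstL ip (adjoint ip Th0 x)).

Lemma kern_linear : linear kern.
Proof.
move=> a x y.
have e : adjoint ip Th0 (a *: x + y) = a *: adjoint ip Th0 x + adjoint ip Th0 y.
  exact: linearP.
by rewrite /kern e !cstL_linear mulTh_linear scalerBr opprD addrACA.
Qed.

HB.instance Definition _ := GRing.isLinear.Build R[i] H L _ kern kern_linear.

Lemma kern_sum (I : Type) (s : seq I) (c : I -> R[i]) (B : 'End(H)) (E : I -> H) :
  kern (B (\sum_(i <- s) c i *: E i)) = \sum_(i <- s) c i *: kern (B (E i)).
Proof.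
have -> : B (\sum_(i <- s) c i *: E i) = \sum_(i <- s) c i *: B (E i).
  by rewrite linear_sum; apply: eq_bigr => i _; exact: linearZ.
by rewrite linear_sum; apply: eq_bigr => i _; exact: linearZ.
Qed.

(** Multiplied by Theta^*, it becomes Theta^* x minus the constant Theta(0)^* x almost everywhere.
    The first term has no positive frequency, and its constant term is exactly the second. *)
Lemma K_kern x : K (kern x).
Proof.
split; first by apply: hardyB; [exact: hardy_cstL|exact: hardy_mulTh_cstL].
move=> n; rewrite mulThAB fcB (fc_ae _ (mulThA_mulTh _)) fc_cstL.
case: n => [|n]; last by rewrite fc_mulThA_cstL// scale0r subrr.
rewrite scale1r; apply/eqP; rewrite subr_eq0; apply/eqP.
apply: (ip_injl (ip := ip)) => y; rewrite adjoint_ip Th0E ip_fc sformC.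
by rewrite -sform_mulTh_adj [in RHS]dot_sformC ip_fc !zshift0.
Qed.

Lemma bounded_mulTh F : bounded F -> bounded (mulTh F).
Proof.
move=> [M FM]; exists M; apply: filterS2 FM inner_unitary => z h u.
by rewrite /= /op_mul unitary_hnorm.
Qed.

Lemma bounded_kern x : bounded (kern x).
Proof. by apply: boundedB; [|apply: bounded_mulTh]; exact: bounded_cstL. Qed.

Lemma sform_kern F x : K F -> b F (kern x) = ip (fc F 0) x.
Proof.
move=> kF; rewrite /kern sformBr K_ortho ?subr0//; last exact: hardy_cstL.
by rewrite ip_fc zshift0.
Qed.

Lemma fc_kern x : fc (kern x) 0 = x - Th0 (adjoint ip Th0 x).
Proof. by rewrite /kern fcB fc_cstL scale1r -Th0E. Qed.

Lemma kernE x : kern x = (fun z => x - Th z (adjoint ip (disk_value Th 0) x)) :> (T -> H).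
Proof. by apply/funext => z; rewrite /kern L2tB. Qed.

Lemma defectP F : K F -> L2ortho ip F (defect ip Th) <-> fc F 0 = 0.
Proof.
move=> kF; split=> [h|F0 g [x ->]].
  apply: (ip_injl (ip := ip)) => x; rewrite [in RHS]dot_sform sform0l -(sform_kern x kF).
  by rewrite L2bE; apply: h; exists x; rewrite kernE.
by rewrite -kernE -L2bE sform_kern// F0 dot_sform sform0l.
Qed.

(** The part z^-1 Theta(0) x is orthogonal to H^2, so only z^-1 Theta x tests [F], that is, the
    coefficient -1 of Theta^* F. It is the one that multiplication by z would bring to frequency
    0. *)
Lemma codefectP F : hardy F -> L2ortho ip F (codefect Th) <-> fc (mulThA F) (-1) = 0.
Proof.
move=> hF.
have e x : b F (zshift (-1) (mulTh (cstL ip x) - cstL ip (Th0 x))) = ip (fc (mulThA F) (-1)) x.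
  rewrite zshiftB sformBr -[b F (zshift (-1) (cstL _ _))]ip_fc hF//.
  rewrite [X in _ - X]dot_sform sform0l subr0.
  by rewrite -mulTh_zshift sformC sform_mulTh_adj -sformC ip_fc.
have e2 x : (fun z : T => (sval z)^* *: (Th z x - disk_value Th 0 x)) =
    zshift (-1) (mulTh (cstL ip x) - cstL ip (Th0 x)).
  by apply/funext => z /=; rewrite -exprz_inv expr1z circle_inv.
split=> [h|F0 g [x ->]].
  apply: (ip_injl (ip := ip)) => x; rewrite [in RHS]dot_sform sform0l -e L2bE.
  by apply: h; exists x; rewrite e2.
by rewrite e2 -L2bE e F0 dot_sform sform0l.
Qed.

Lemma backward_shiftE F : backward_shift F = bshift F :> (T -> H).
Proof.
apply/funext => z; rewrite /backward_shift disk_value0 /=.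
by rewrite -exprz_inv expr1z circle_inv.
Qed.

Lemma forward_shiftE F : forward_shift F = zshift 1 F :> (T -> H).
Proof. by apply/funext => z; rewrite /forward_shift /= expr1z. Qed.

Lemma K_zshift F : K F -> fc (mulThA F) (-1) = 0 -> K (zshift 1 F).
Proof.
move=> [hF kF] F1; split; first exact: (hardy_zshift 1).
move=> [|n]; rewrite mulThA_zshift fc_zshift; first by rewrite sub0r.
by rewrite -[n.+1%:Z - 1]/(n.+1%:Z - 1%:Z) subzn// subSS subn0 kF.
Qed.

Lemma fc0_zshift1 F : hardy F -> fc (zshift 1 F) 0 = 0.
Proof. by move=> hF; rewrite fc_zshift hF. Qed.

Lemma fc_mulThA_bshift F : K F -> fc F 0 = 0 -> fc (mulThA (bshift F)) (-1) = 0.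
Proof. by move=> [_ kF] F0; rewrite bshift_zshift// mulThA_zshift fc_zshift opprK addNr kF. Qed.

Definition mono (n : nat) x : L := zshift n%:Z (cstL ip x).

Definition pmono (n : nat) x : L :=
  mono n x - mulTh (trigsum ip (fun k => fc (mulThA (mono n x)) k%:Z) n.+1).

Lemma K_pmono n x : K (pmono n x).
Proof.
have hm : hardy (mono n x) by apply: hardy_zshift; exact: hardy_cstL.
split; first by apply: hardyB => //; apply: hardy_mulTh; exact: hardy_trigsum.
move=> k; rewrite mulThAB fcB (fc_ae _ (mulThA_mulTh _)) fc_trigsum ltnS.
case: leqP => [kn|nk]; first by rewrite scale1r subrr.
rewrite scale0r subr0 /mono mulThA_zshift fc_zshift fc_mulThA_cstL//.
by rewrite subr_gt0 ltz_nat.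
Qed.

Lemma trigsum_linear n : linear (fun y : nat -> H => trigsum ip y n).
Proof.
move=> a y y'; rewrite /trigsum scaler_sumr -big_split /=; apply: eq_bigr => i _.
by rewrite -linearP -linearP.
Qed.

Lemma pmono_linear n : linear (pmono n).
Proof.
move=> a x y; rewrite /pmono /mono.
have e : zshift n (cstL ip (a *: x + y)) = a *: zshift n (cstL ip x) + zshift n (cstL ip y).
  by rewrite cstL_linear zshift_linear.
have -> : trigsum ip (fun k => fc (mulThA (zshift n (cstL ip (a *: x + y)))) k%:Z) n.+1 =
    a *: trigsum ip (fun k => fc (mulThA (zshift n (cstL ip x))) k%:Z) n.+1 +
    trigsum ip (fun k => fc (mulThA (zshift n (cstL ip y))) k%:Z) n.+1.
  rewrite -trigsum_linear; congr (trigsum ip _ _); apply/funext => k.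
  by rewrite e mulThA_linear fc_linear.
by rewrite e mulTh_linear scalerBr opprD addrACA.
Qed.

Lemma bounded_pmono n x : bounded (pmono n x).
Proof.
apply: boundedB; first by apply: bounded_zshift; exact: bounded_cstL.
by apply: bounded_mulTh; exact: bounded_trigsum.
Qed.

Definition ptrig (y : nat -> H) N : L := \sum_(n < N) pmono n (y n).

Lemma K_ptrig (y : nat -> H) N : K (ptrig y N).
Proof. by apply: K_sum => i; exact: K_pmono. Qed.

Lemma bounded_ptrig (y : nat -> H) N : bounded (ptrig y N).
Proof. by apply: bounded_sum => i; exact: bounded_pmono. Qed.

Lemma ptrigE (y : nat -> H) N : exists2 Q, hardy Q & trigsum ip y N = ptrig y N + mulTh Q.
Proof.
exists (\sum_(n < N) trigsum ip (fun k => fc (mulThA (mono n (y n))) k%:Z) n.+1).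
  by apply: hardy_sum => i; exact: hardy_trigsum.
rewrite linear_sum /= /ptrig /trigsum -big_split /=.
by apply: eq_bigr => i _; rewrite subrK.
Qed.

Lemma snorm_ptrig (y : nat -> H) N : snorm b (ptrig y N) <= snorm b (trigsum ip y N).
Proof.
have [Q hQ ->] := ptrigE y N; apply: snorm_le_orthoD.
by apply: K_ortho => //; exact: K_ptrig.
Qed.

(** [fpart] differs from [ptrig] by some Theta Q with Q in H^2, which is orthogonal to the element
    [F - ptrig] of the model space. *)
Lemma snorm_ptrigB F N : K F ->
  snorm b (F - ptrig (fun n => fc F n%:Z) N) <= snorm b (F - fpart F N).
Proof.
move=> kF; rewrite /fpart; have [Q hQ ->] := ptrigE (fun n => fc F n%:Z) N.
rewrite opprD addrA -linearN; apply: snorm_le_orthoD.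
apply: K_ortho; first by apply: KB => //; exact: K_ptrig.
by have := hardyB (@hardy0 _ _ ip) hQ; rewrite sub0r.
Qed.

Lemma ptrig_cvg F : K F ->
  (fun N => snorm b (F - ptrig (fun n => fc F n%:Z) N)) @ \oo --> (0 : R).
Proof.
move=> kF; apply: (@squeeze_cvgr _ _ _ _ (fun=> 0) (fun N => snorm b (F - fpart F N))).
- by apply: nearW => N; rewrite snorm_ge0 snorm_ptrigB.
- exact: cvg_cst.
- by apply: fpart_cvg; case: kF.
Qed.

(** The functional is composed with the projection of polynomials to the model space; its values on
    z^n x give, by finite-dimensional Riesz, the coefficients of the representing function in
    H^2. *)
Lemma K_riesz (phi : L -> R[i]) (M : R) :
  (forall (a : R[i]) F G, K F -> K G -> phi (a *: F + G) = a * phi F + phi G) ->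
  (forall F, K F -> complex.Re `|phi F| <= M * snorm b F) ->
  exists2 W, hardy W & forall F, K F -> phi F = b F W.
Proof.
move=> phiP phiM.
have phi0 : phi 0 = 0.
  have := phiP 1 0 0 K0 K0; rewrite scale1r mul1r addr0 => h.
  by apply: (addrI (phi 0)); rewrite -h addr0.
have phi_sum N (A : nat -> L) : (forall i, K (A i)) ->
    phi (\sum_(i < N) A i) = \sum_(i < N) phi (A i).
  move=> kA; elim: N => [|N IH]; first by rewrite !big_ord0.
  rewrite !big_ord_recr /= -IH -[X in phi (X + _)]scale1r phiP ?mul1r//.
  by apply: K_sum.
have ex n : exists y, forall x, ip x y = phi (pmono n x).
  have lin : linear (fun x => phi (pmono n x) : R[i]^o).
    by move=> a x y; rewrite pmono_linear phiP//; exact: K_pmono.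
  exact: (riesz ip (HB.pack (fun x => phi (pmono n x) : R[i]^o)
    (GRing.isLinear.Build _ _ _ _ _ lin) : {linear H -> R[i]^o})).
have [y yP] := choice ex.
have phi_ptrig (x : nat -> H) N : phi (ptrig x N) = b (trigsum ip x N) (trigsum ip y N).
  rewrite /ptrig (phi_sum N (fun i => pmono i (x i))); last by move=> i; exact: K_pmono.
  rewrite {1}/trigsum sform_suml; apply: eq_bigr => i _.
  by rewrite -yP sformC -ip_fc fc_trigsum ltn_ord scale1r dot_sformC.
have M0 : 0 <= `|M| by [].
(* Testing the functional on the coefficients [y] themselves yields the squared norm of their
   partial sum, bounded by |M| times that norm. *)
have bnd N : snorm b (trigsum ip y N) <= `|M|.
  have h1 : snorm b (trigsum ip y N) ^+ 2 <= `|M| * snorm b (trigsum ip y N).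
    rewrite snorm_sqr -phi_ptrig.
    apply: le_trans (le_trans (ler_norm _) (normr_Re _)) _.
    apply: le_trans (phiM _ (K_ptrig _ _)) _.
    apply: (@le_trans _ _ (`|M| * snorm b (ptrig y N))).
      by apply: ler_wpM2r; [exact: snorm_ge0|exact: ler_norm].
    by apply: ler_wpM2l => //; exact: snorm_ptrig.
  have := snorm_ge0 b (trigsum ip y N); rewrite le_eqVlt => /orP[/eqP <-//|s0].
  by move: h1; rewrite expr2 ler_pM2r.
have bnd2 N : \sum_(0 <= n < N) hn (y n) ^+ 2 <= `|M| ^+ 2.
  by rewrite -snorm_trigsum ler_pXn2r ?nnegrE ?snorm_ge0.
have [W WP] := riesz_fischer bnd2.
exists W; first by apply: hardy_lim WP => N; exact: hardy_trigsum.
move=> F kF; apply/eqP; rewrite -subr_eq0; apply/eqP.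
pose p N := ptrig (fun n => fc F n%:Z) N.
have c0 : (fun N => `|M| * snorm b (F - p N) + (`|M| * snorm b (F - fpart F N) +
    snorm b F * snorm b (W - trigsum ip y N))) @ \oo --> (0 : R).
  rewrite -[X in _ --> X](addr0 0) -[X in _ --> X + _](mulr0 `|M|).
  apply: cvgD; first by apply: cvgM; [exact: cvg_cst|exact: ptrig_cvg].
  rewrite -[X in _ --> X](addr0 0) -[X in _ --> X + _](mulr0 `|M|).
  rewrite -[X in _ --> _ + X](mulr0 (snorm b F)).
  apply: cvgD; apply: cvgM; try exact: cvg_cst => //.
  - by apply: fpart_cvg; case: kF.
  - exact: WP.
apply: (eq0_of_cvg (M := 1) c0) => N; rewrite mul1r.
(* Three errors: replacing [F] by its projected polynomial, [F] by its Fourier sum, and [W] by its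
   partial sum. *)
have -> : phi F - b F W = phi (F - p N) + (b (fpart F N - F) (trigsum ip y N) +
    b F (trigsum ip y N - W)).
  have -> : phi (F - p N) = phi F - phi (p N).
    have := phiP (-1) (p N) F (K_ptrig _ _) kF.
    by rewrite scaleN1r mulN1r addrC => ->; rewrite addrC.
  by rewrite phi_ptrig sformBl sformBr /fpart; ring.
apply: le_trans (cabsD _ _) _; apply: lerD.
  apply: le_trans (phiM _ (KB kF (K_ptrig _ _))) _.
  by apply: ler_wpM2r; [exact: snorm_ge0|exact: ler_norm].
apply: le_trans (cabsD _ _) _; apply: lerD.
  apply: le_trans (cauchy_schwarz _ _ _) _; rewrite snormB mulrC.
  by apply: ler_wpM2r; [exact: snorm_ge0|exact: bnd].
by apply: le_trans (cauchy_schwarz _ _ _) _; rewrite [snorm b (_ - W)]snormB.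
Qed.

End ModelSpace.

(** * Strict contractions *)

Section PureInner.
Variables (R : realType) (H : vectType R[i]) (ip : {dot H for Num.conj}).
Local Notation hn := (hnorm ip).
Implicit Types (x y : H) (B : 'End(H)).

(** The set defining [opnorm] is bounded above by the Hilbert-Schmidt norm, so its supremum is a
    genuine upper bound; a nonzero [x] is normalized. *)
Lemma hnorm_le_opnorm B x : hn (B x) <= opnorm ip B * hn x.
Proof.
have [x0|x0] := eqVneq (hn x) 0.
  by rewrite (hnorm_eq0 x0) linear0 !hnormE !snorm0 mulr0.
have xp : 0 < hn x by rewrite lt0r x0 sqrtr_ge0.
have sB : has_sup [set hn (B x) | x in [set x | hn x <= 1]].
  split; first by exists (hn (B 0)); exists 0 => //=; rewrite hnormE snorm0.
  exists (hsnorm ip B) => _ [y /= y1 <-].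
  apply: le_trans (hnorm_le_hsnorm _ _ _) _.
  by rewrite ler_piMr// sqrtr_ge0.
rewrite -ler_pdivrMr//.
have -> : hn (B x) / hn x = hn (B ((hn x)^-1%:C *: x)).
  by rewrite linearZ !hnormE snormZ cabs_real ?invr_ge0 ?snorm_ge0// mulrC.
apply: sup_upper_bound => //; exists ((hn x)^-1%:C *: x) => //.
change (hn ((hn x)^-1%:C *: x) <= 1).
rewrite [hn (_ *: _)]hnormE snormZ cabs_real ?invr_ge0 ?sqrtr_ge0//.
by rewrite -[X in _ * X](hnormE ip) mulVf.
Qed.

(* [1 - T T^*] is injective when [T] is a strict contraction. *)
Lemma strict_contraction_inverse B : opnorm ip B < 1 ->
  exists g : 'End(H), forall x, g x - B (adjoint ip B (g x)) = x.
Proof.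
move=> B1; pose C : 'End(H) := (\1 - (B \o adjoint ip B))%VF.
have CE x : C x = x - B (adjoint ip B x).
  by rewrite /C add_lfunE opp_lfunE comp_lfunE id_lfunE.
have C0 : lker C == 0%VS.
  apply/lker0P => x y exy; set w := x - y.
  have e : w = B (adjoint ip B w).
    have Cw : C w = C x - C y by exact: linearB.
    by apply/eqP; rewrite -subr_eq0 -CE Cw exy subrr.
  apply/eqP; rewrite -subr_eq0 -/w; apply/eqP.
  (* From w = T T^* w, the squared norm of T^* w equals that of w. Then w has norm at most [opnorm]
     times its own norm, which forces w = 0. *)
  have aw : hn (adjoint ip B w) = hn w.
    by rewrite /hnorm adjoint_ip -e.
  apply: (hnorm_eq0 (ip := ip)); apply/eqP; rewrite eq_le sqrtr_ge0 andbT.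
  have := hnorm_le_opnorm B (adjoint ip B w); rewrite -e aw.
  have := sqrtr_ge0 (complex.Re (ip w w)); rewrite -/(hn w).
  by set r := hn w; nra.
exists (C^-1)%VF => x; rewrite -CE -comp_lfunE lker0_compfV//.
by rewrite id_lfunE.
Qed.

End PureInner.

(** * Truncated Toeplitz operators and shift invariance *)

Section TruncatedToeplitz.
Variables (R : realType) (H : vectType R[i]) (ip : {dot H for Num.conj}).
Local Notation T := (circle R).
Local Notation L := (L2t ip).
Local Notation b := (L2form ip).
Local Notation fc F n := (fcoef n F).
Variables (Th1 Th2 : T -> 'End(H)) (A : (T -> H) -> (T -> H)).
Hypotheses (hTh1 : inner ip Th1) (hTh2 : inner ip Th2).
Hypothesis hA : bounded_operator ip Th1 Th2 A.
Hypotheses (p1 : pure ip Th1) (p2 : pure ip Th2).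
Local Notation K1 := (K hTh1).
Local Notation K2 := (K hTh2).
Implicit Types (F G X : L) (x y v w : H).

Definition opA F : L := if pselect (L2 ip (A F)) is left h then toL2 h else 0.

Lemma opAE F : K1 F -> opA F = A F :> (T -> H).
Proof.
move=> kF; rewrite /opA; case: pselect => // -[].
case: hA => + _ _ _; move=> /(_ F) h.
by apply: (@model_space_L2 _ _ _ Th2); apply: h; apply/(model_spaceP hTh1).
Qed.

Lemma K_opA F : K1 F -> K2 (opA F).
Proof.
move=> kF; apply/(model_spaceP hTh2); rewrite opAE//.
by case: hA => + _ _ _; apply; apply/(model_spaceP hTh1).
Qed.

(** [A] is linear only up to null sets, but the form does not see these: as a function of [F] in the
    model space it is exactly linear. *)
Definition formA F G : R[i] := b (opA F) G.

Lemma formA_lin (a : R[i]) F G X : K1 F -> K1 G ->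
  formA (a *: F + G) X = a * formA F X + formA G X.
Proof.
move=> kF kG; rewrite /formA -sformP; apply: ae_equal_sform.
case: hA => _ _ lin _; have := lin a F G.
move=> /(_ (proj2 (model_spaceP hTh1 F) kF) (proj2 (model_spaceP hTh1 G) kG)).
have kFG := K_lin a kF kG.
apply: filterS => z; rewrite L2tD L2tZ (opAE kF) (opAE kG) (opAE kFG) => <-.
by [].
Qed.

Lemma formA_bounded : exists2 M, 0 <= M &
  forall F G, K1 F -> complex.Re `|formA F G| <= M * snorm b F * snorm b G.
Proof.
case: hA => _ _ _ [M hM]; exists `|M| => // F G kF.
apply: le_trans (cauchy_schwarz _ _ _) _; apply: ler_wpM2r; first exact: snorm_ge0.
have := hM F (proj2 (model_spaceP hTh1 F) kF).
rewrite -(opAE kF) !L2norm_snorm => h; apply: le_trans h _.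
by apply: ler_wpM2r; [exact: snorm_ge0|exact: ler_norm].
Qed.

Lemma formAB F G X : K1 F -> K1 G -> formA (F - G) X = formA F X - formA G X.
Proof.
move=> kF kG; have := formA_lin (-1) X kG kF.
by rewrite scaleN1r mulN1r addrC => ->; rewrite addrC.
Qed.

Lemma formA0 X : formA 0 X = 0.
Proof.
have := formA_lin 1 X (K0 hTh1) (K0 hTh1); rewrite scale1r mul1r addr0 => h.
by apply: (addrI (formA 0 X)); rewrite -h addr0.
Qed.

Lemma formA_sum (s : seq H) (c : H -> R[i]) (E : H -> L) X : (forall v, K1 (E v)) ->
  formA (\sum_(v <- s) c v *: E v) X = \sum_(v <- s) c v * formA (E v) X.
Proof.
move=> kE; elim: s => [|v s IH]; first by rewrite !big_nil formA0.
rewrite !big_cons formA_lin// ?IH//; apply: K_sum => w.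
by have := K_lin (c w) (kE w) (K0 hTh1); rewrite addr0.
Qed.

Definition shift_invariant : Prop := forall F G, K1 F -> K2 G ->
  fc F 0 = 0 -> fc G 0 = 0 -> formA (zshift (-1) F) (zshift (-1) G) = formA F G.

Lemma backward_shiftK (Th : T -> 'End(H)) (h : inner ip Th) F : K h F -> fc F 0 = 0 ->
  [/\ K h (zshift (-1) F), fc (mulThA h (zshift (-1) F)) (-1) = 0 & zshift 1 (zshift (-1) F) = F].
Proof.
move=> kF F0; rewrite -bshift_zshift//; split; first exact: K_bshift.
  exact: fc_mulThA_bshift.
by rewrite bshift_zshift// zshift_add subrr zshift0.
Qed.

Lemma forward_shiftK (Th : T -> 'End(H)) (h : inner ip Th) F : K h F -> fc (mulThA h F) (-1) = 0 ->
  [/\ K h (zshift 1 F), fc (zshift 1 F) 0 = 0 & zshift (-1) (zshift 1 F) = F].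
Proof.
move=> kF F1; split; first exact: K_zshift.
  by apply: fc0_zshift1; case: kF.
by rewrite zshift_add addNr zshift0.
Qed.

Lemma backward_shift_zshift F : fc F 0 = 0 -> backward_shift F = zshift (-1) F :> (T -> H).
Proof. by move=> F0; rewrite backward_shiftE bshift_zshift. Qed.

Lemma shift_invariant_a : (forall f g, model_space ip Th1 f -> model_space ip Th2 g ->
    L2ortho ip f (defect ip Th1) -> L2ortho ip g (defect ip Th2) ->
    L2ip ip (A (backward_shift f)) (backward_shift g) = L2ip ip (A f) g)
  <-> shift_invariant.
Proof.
split=> [h F G kF kG F0 G0|h f g mf mg of_ og].
  have [kF' _ _] := backward_shiftK kF F0.
  have := h F G (proj2 (model_spaceP hTh1 F) kF) (proj2 (model_spaceP hTh2 G) kG)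
    (proj2 (defectP kF) F0) (proj2 (defectP kG) G0).
  by rewrite !backward_shift_zshift// -(opAE kF) -(opAE kF').
move: (model_space_L2 mf) (model_space_L2 mg) => lf lg.
have kF : K1 (toL2 lf) by apply/(model_spaceP hTh1).
have kG : K2 (toL2 lg) by apply/(model_spaceP hTh2).
have F0 : fc (toL2 lf) 0 = 0 by exact: (proj1 (defectP kF) of_).
have G0 : fc (toL2 lg) 0 = 0 by exact: (proj1 (defectP kG) og).
have [kF' _ _] := backward_shiftK kF F0.
have := h _ _ kF kG F0 G0; rewrite /formA !L2bE (opAE kF) (opAE kF').
by rewrite -(backward_shift_zshift F0) -(backward_shift_zshift G0).
Qed.

Lemma shift_invariant_b : (forall f g, model_space ip Th1 f -> model_space ip Th2 g ->
    L2ortho ip f (defect ip Th1) -> L2ortho ip g (codefect Th2) ->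
    L2ip ip (A (backward_shift f)) g = L2ip ip (A f) (forward_shift g))
  <-> shift_invariant.
Proof.
split=> [h F G kF kG F0 G0|h f g mf mg of_ og].
  have [kF' _ _] := backward_shiftK kF F0.
  have [kG' G1 GG] := backward_shiftK kG G0.
  have := h F (zshift (-1) G) (proj2 (model_spaceP hTh1 F) kF) (proj2 (model_spaceP hTh2 _) kG')
    (proj2 (defectP kF) F0) (proj2 (codefectP hTh2 (proj1 kG')) G1).
  by rewrite !backward_shift_zshift// forward_shiftE GG -(opAE kF) -(opAE kF').
move: (model_space_L2 mf) (model_space_L2 mg) => lf lg.
have kF : K1 (toL2 lf) by apply/(model_spaceP hTh1).
have kG : K2 (toL2 lg) by apply/(model_spaceP hTh2).
have F0 : fc (toL2 lf) 0 = 0 by exact: (proj1 (defectP kF) of_).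
have G0 : fc (mulThA hTh2 (toL2 lg)) (-1) = 0 by exact: (proj1 (codefectP hTh2 (proj1 kG)) og).
have [kF' _ _] := backward_shiftK kF F0.
have [kG' G1 GG] := forward_shiftK kG G0.
have := h _ _ kF kG' F0 G1; rewrite GG /formA !L2bE (opAE kF) (opAE kF').
by rewrite -(backward_shift_zshift F0) -forward_shiftE.
Qed.

Lemma shift_invariant_c : (forall f g, model_space ip Th1 f -> model_space ip Th2 g ->
    L2ortho ip f (codefect Th1) -> L2ortho ip g (codefect Th2) ->
    L2ip ip (A (forward_shift f)) (forward_shift g) = L2ip ip (A f) g)
  <-> shift_invariant.
Proof.
split=> [h F G kF kG F0 G0|h f g mf mg of_ og].
  have [kF' F1 FF] := backward_shiftK kF F0.
  have [kG' G1 GG] := backward_shiftK kG G0.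
  have := h (zshift (-1) F) (zshift (-1) G) (proj2 (model_spaceP hTh1 _) kF')
    (proj2 (model_spaceP hTh2 _) kG') (proj2 (codefectP hTh1 (proj1 kF')) F1)
    (proj2 (codefectP hTh2 (proj1 kG')) G1).
  by rewrite !forward_shiftE FF GG -(opAE kF) -(opAE kF').
move: (model_space_L2 mf) (model_space_L2 mg) => lf lg.
have kF : K1 (toL2 lf) by apply/(model_spaceP hTh1).
have kG : K2 (toL2 lg) by apply/(model_spaceP hTh2).
have F0 : fc (mulThA hTh1 (toL2 lf)) (-1) = 0 by exact: (proj1 (codefectP hTh1 (proj1 kF)) of_).
have G0 : fc (mulThA hTh2 (toL2 lg)) (-1) = 0 by exact: (proj1 (codefectP hTh2 (proj1 kG)) og).
have [kF' F1 FF] := forward_shiftK kF F0.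
have [kG' G1 GG] := forward_shiftK kG G0.
have := h _ _ kF' kG' F1 G1; rewrite FF GG /formA !L2bE (opAE kF) (opAE kF').
by rewrite -!forward_shiftE => ->.
Qed.

Lemma shift_invariant_d : (forall f g, model_space ip Th1 f -> model_space ip Th2 g ->
    L2ortho ip f (codefect Th1) -> L2ortho ip g (defect ip Th2) ->
    L2ip ip (A (forward_shift f)) g = L2ip ip (A f) (backward_shift g))
  <-> shift_invariant.
Proof.
split=> [h F G kF kG F0 G0|h f g mf mg of_ og].
  have [kF' F1 FF] := backward_shiftK kF F0.
  have := h (zshift (-1) F) G (proj2 (model_spaceP hTh1 _) kF')
    (proj2 (model_spaceP hTh2 _) kG) (proj2 (codefectP hTh1 (proj1 kF')) F1)
    (proj2 (defectP kG) G0).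
  by rewrite !forward_shiftE FF backward_shift_zshift// -(opAE kF) -(opAE kF').
move: (model_space_L2 mf) (model_space_L2 mg) => lf lg.
have kF : K1 (toL2 lf) by apply/(model_spaceP hTh1).
have kG : K2 (toL2 lg) by apply/(model_spaceP hTh2).
have F0 : fc (mulThA hTh1 (toL2 lf)) (-1) = 0 by exact: (proj1 (codefectP hTh1 (proj1 kF)) of_).
have G0 : fc (toL2 lg) 0 = 0 by exact: (proj1 (defectP kG) og).
have [kF' F1 FF] := forward_shiftK kF F0.
have := h _ _ kF' kG F1 G0; rewrite FF /formA !L2bE (opAE kF) (opAE kF').
by rewrite -forward_shiftE -(backward_shift_zshift G0) => ->.
Qed.

Definition symbol (Phi : T -> 'End(H)) : Prop := L2op ip Phi /\
  forall F G, K1 F -> bounded F -> K2 G -> b (opL Phi F) G = formA F G.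

(** Since A maps into the second model space, being the projection of Phi F amounts to the
    orthogonality of Phi F - A F to that space. *)
Lemma MTP : MT ip Th1 Th2 A <-> exists Phi, symbol Phi.
Proof.
have e Phi F : L2op ip Phi -> K1 F -> bounded F ->
    (fun z => op_mul Phi F z - A F z) = opL Phi F - opA F :> (T -> H).
  by move=> hP kF bF; apply/funext => z; rewrite L2tB opLE// opAE.
split=> [[_ [Phi hP hPhi]]|[Phi [hP hPhi]]].
  exists Phi; split; [exact: hP|move=> F G kF bF kG].
  have [_ o] := hPhi F (proj2 (model_space_infP hTh1 F) (conj kF bF)).
  apply/eqP; rewrite -subr_eq0 -sformBl; apply/eqP; rewrite L2bE -(e _ _ hP kF bF).
  by apply: o; apply/(model_spaceP hTh2).
split; [exact: hA|exists Phi; [exact: hP|move=> f mf]].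
have lf : L2 ip f by case: mf => /model_space_L2.
have [kF bF] := proj1 (model_space_infP hTh1 (toL2 lf)) mf.
split; first by case: hA => + _ _ _; apply; case: mf.
move=> g mg; have kG : K2 (toL2 (model_space_L2 mg)) by apply/(model_spaceP hTh2).
rewrite (e Phi (toL2 lf) hP kF bF) -[g]/(toL2 (model_space_L2 mg) : T -> H) -L2bE.
by rewrite sformBl hPhi// subrr.
Qed.

Section Projection.
Variables (Th : T -> 'End(H)) (h : inner ip Th) (g : 'End(H)).
Hypothesis gP : forall x, g x - Th0 Th (adjoint ip (Th0 Th) (g x)) = x.

(* On the model space this is the orthogonal projection onto the functions
   vanishing at the origin. *)
Definition vanish F : L := F - kern h (g (fc F 0)).

Lemma vanish_linear (a : R[i]) F G : vanish (a *: F + G) = a *: vanish F + vanish G.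
Proof.
rewrite /vanish fc_linear.
have e : g (a *: fc F 0 + fc G 0) = a *: g (fc F 0) + g (fc G 0) by exact: linearP.
rewrite e kern_linear; move: (kern h (g (fc F 0))) (kern h (g (fc G 0))) => X Y.
by rewrite scalerBr opprD addrACA.
Qed.

Lemma K_vanish F : K h F -> K h (vanish F).
Proof. by move=> kF; apply: KB => //; exact: K_kern. Qed.

Lemma fc_vanish F : fc (vanish F) 0 = 0.
Proof. by rewrite /vanish fcB fc_kern gP subrr. Qed.

Lemma snorm_vanish F : K h F -> snorm b (vanish F) <= snorm b F.
Proof.
move=> kF; rewrite -[F in leRHS](subrK (kern h (g (fc F 0)))).
apply: snorm_le_orthoD; rewrite sform_kern ?fc_vanish; last exact: K_vanish.
by rewrite dot_sform sform0l.
Qed.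

Lemma bounded_vanish F : bounded F -> bounded (vanish F).
Proof. by move=> bF; apply: boundedB => //; exact: bounded_kern. Qed.

End Projection.

Lemma symbol_shift_invariant Phi : symbol Phi -> shift_invariant.
Proof.
move=> [hP hPhi] F G kF kG F0 G0.
have [g gP] := strict_contraction_inverse p1.
pose d E := formA (zshift (-1) E) (zshift (-1) G) - formA E G.
suff : d F = 0 by move/eqP; rewrite subr_eq0 => /eqP.
have kZ E : K1 E -> fc E 0 = 0 -> K1 (zshift (-1) E).
  by move=> kE E0; case: (backward_shiftK kE E0).
have [kG' _ _] := backward_shiftK kG G0.
have d0 E : K1 E -> fc E 0 = 0 -> bounded E -> d E = 0.
  move=> kE E0 bE; rewrite /d -!hPhi//; [|exact: kZ|exact: bounded_zshift].
  by rewrite opL_zshift// sform_zshift subrr.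
have [M M0 hM] := formA_bounded.
(* Approximants that are bounded, lie in the model space and vanish at the origin. As [vanish] fixes
   [F], the error [F - e N] is [vanish] of the error of [ptrig], hence no larger. *)
pose e N := vanish hTh1 g (ptrig hTh1 (fun n => fc F n%:Z) N).
have eF N : F - e N = vanish hTh1 g (F - ptrig hTh1 (fun n => fc F n%:Z) N).
  have kern0 : kern hTh1 (g 0) = 0 by rewrite (linear0 g); exact: linear0.
  have vF : vanish hTh1 g F = F by rewrite /vanish F0 kern0 subr0.
  rewrite -{1}vF /e; have := vanish_linear hTh1 g (-1) (ptrig hTh1 (fun n => fc F n%:Z) N) F.
  by rewrite !scaleN1r ![- _ + _]addrC => ->.
have ke N : K1 (e N) by apply: K_vanish; exact: K_ptrig.
have fe N : fc (e N) 0 = 0 by exact: fc_vanish.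
apply: (eq0_of_cvg (M := 2 * M * snorm b G) (ptrig_cvg kF)) => N.
have kFe : K1 (F - e N) by exact: KB.
have fFe : fc (F - e N) 0 = 0 by rewrite fcB F0 fe subrr.
have -> : d F = d (F - e N).
  rewrite -[LHS]subr0 -(d0 (e N))//; last by apply: bounded_vanish; exact: bounded_ptrig.
  rewrite /d zshiftB (formAB _ (kZ _ kF F0) (kZ _ (ke N) (fe N))) (formAB _ kF (ke N)).
  by rewrite !opprB addrACA [RHS]addrACA [- _ + _]addrC.
rewrite /d; apply: le_trans (cabsB _ _) _.
have s1 : snorm b (F - e N) <= snorm b (F - ptrig hTh1 (fun n => fc F n%:Z) N).
  by rewrite eF; apply: snorm_vanish => //; apply: KB => //; exact: K_ptrig.
have a1 := hM _ (zshift (-1) G) (kZ _ kFe fFe); rewrite !snorm_zshift in a1.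
have a2 := hM _ G kFe.
have a3 : M * snorm b (F - e N) * snorm b G <=
    M * snorm b (F - ptrig hTh1 (fun n => fc F n%:Z) N) * snorm b G.
  by apply: ler_wpM2r; [exact: snorm_ge0|apply: ler_wpM2l].
by move: a1 a2 a3; lra.
Qed.

(** Each backward shift discards one more coefficient, so the norm of the N-th iterate is that of a
    Fourier tail. *)
Lemma iter_bshift F N : iter N (@bshift _ _ ip) F = zshift (- N%:Z) (F - fpart F N).
Proof.
elim: N => [|N IH].
  by rewrite /= /fpart /trigsum big_ord0 subr0 oppr0 zshift0.
rewrite iterS IH /bshift fc_zshift sub0r opprK fcB /fpart fc_trigsum ltnn scale0r subr0.
rewrite trigsumS opprD addrA !zshiftB !zshift_add.
congr (_ - _); last by rewrite -[N.+1]addn1 PoszD opprD addrAC addNr add0r.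
by congr (_ - _); rewrite -[N.+1]addn1 PoszD opprD addrC.
Qed.

Lemma snorm_iter_bshift F N : snorm b (iter N (@bshift _ _ ip) F) = snorm b (F - fpart F N).
Proof. by rewrite iter_bshift snorm_zshift. Qed.

Lemma fc_iter_bshift F N : fc (iter N (@bshift _ _ ip) F) 0 = fc F N%:Z.
Proof.
by rewrite iter_bshift fc_zshift sub0r opprK fcB /fpart fc_trigsum ltnn scale0r subr0.
Qed.

(** On H^2 the adjoint of the N-th backward shift is multiplication by z^N: the discarded polynomial
    has frequencies below N and is orthogonal to z^N X. *)
Lemma sform_iter_bshift X G N : hardy X -> b X (iter N (@bshift _ _ ip) G) = b (zshift N%:Z X) G.
Proof.
move=> hX; rewrite iter_bshift -sform_zshift_adj sformBr [X in _ - X](_ : _ = 0) ?subr0//.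
rewrite /fpart /trigsum sform_sumr big1// => i _; rewrite -ip_fc fc_zshift hX.
  by rewrite dot_sform sform0l.
by rewrite subr_lt0 ltz_nat.
Qed.

(** Turns a family of L^2 functions, one for each frame vector, into a symbol; applied to a constant
    [x] it gives [frame_ext s P x]. *)
Definition rank_sum (s : seq H) (P : H -> L) : T -> 'End(H) :=
  fun z => \sum_(v <- s) rank1 ip v (P v z).

Definition frame_ext (s : seq H) (P : H -> L) x : L := \sum_(v <- s) ip x v *: P v.

Lemma rank_sumE s P z x : rank_sum s P z x = frame_ext s P x z.
Proof.
rewrite /rank_sum sum_lfunE /frame_ext L2t_sum.
by apply: eq_bigr => v _; rewrite rank1E L2tZ.
Qed.

Lemma L2op_rank_sum s P : L2op ip (rank_sum s P).
Proof.
apply/L2opP => x; rewrite (_ : (fun z => _) = frame_ext s P x); first exact: L2tP.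
by apply/funext => z; rewrite rank_sumE.
Qed.

Lemma opL_rank_sum_cstL s P x : opL (rank_sum s P) (cstL ip x) = frame_ext s P x.
Proof.
apply: L2t_eq => z; rewrite opLE ?rank_sumE//; [exact: L2op_rank_sum|exact: bounded_cstL].
Qed.

Lemma opL_fpartS s P F N : opL (rank_sum s P) (fpart F N.+1) =
  opL (rank_sum s P) (fpart F N) + zshift N%:Z (frame_ext s P (fc F N%:Z)).
Proof.
have hP := L2op_rank_sum s P.
have bC x : bounded (zshift N%:Z (cstL ip x)) by apply: bounded_zshift; exact: bounded_cstL.
rewrite /fpart trigsumS -[X in opL _ (X + _)]scale1r opL_lin//; last exact: bounded_trigsum.
by rewrite scale1r opL_zshift ?opL_rank_sum_cstL//; exact: bounded_cstL.
Qed.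

Lemma shift_invariant_symbol : shift_invariant -> exists Phi, symbol Phi.
Proof.
move=> inv.
have [g1 g1P] := strict_contraction_inverse p1.
have [g2 g2P] := strict_contraction_inverse p2.
have [s sx] := parseval_frame ip.
have [M M0 hM] := formA_bounded.
pose t F G := formA F G - formA (bshift F) (bshift G).
pose Q1 := vanish hTh1 g1.
have t_subr F G G' : t F (G - G') = t F G - t F G'.
  rewrite /t bshiftB /formA !sformBr.
  by rewrite !opprB addrACA [RHS]addrACA [- _ + _]addrC.
have t_sumr F (c : H -> R[i]) (E : H -> L) :
    t F (\sum_(v <- s) c v *: E v) = \sum_(v <- s) (c v)^* * t F (E v).
  rewrite /t /formA bshift_sum !sform_sumr -sumrB; apply: eq_bigr => v _.
  by rewrite !sformZr mulrBr.
have t_suml G (c : H -> R[i]) (E : H -> L) : (forall v, K1 (E v)) ->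
    t (\sum_(v <- s) c v *: E v) G = \sum_(v <- s) c v * t (E v) G.
  move=> kE; rewrite /t bshift_sum.
  rewrite !formA_sum//; last by move=> v; exact: K_bshift.
  by rewrite -sumrB; apply: eq_bigr => v _; rewrite mulrBr.
have t_linl (a : R[i]) F F' G : K1 F -> K1 F' -> t (a *: F + F') G = a * t F G + t F' G.
  move=> kF kF'; rewrite /t bshift_linear (formA_lin a _ kF kF').
  by rewrite (formA_lin a _ (K_bshift kF) (K_bshift kF')) mulrBr opprD addrACA.
(* From <A S^* k, S^* G> = <z A S^* k, G>, for k the kernel whose value at the origin is [v]. *)
pose Psi0 v := opA (kern hTh1 (g1 v)) - zshift 1 (opA (bshift (kern hTh1 (g1 v)))).
have Psi0P v G : K2 G -> t (kern hTh1 (g1 v)) G = b (Psi0 v) G.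
  move=> kG; rewrite /t /formA /Psi0 sformBl; congr (_ - _).
  rewrite -[bshift G]/(iter 1 (@bshift _ _ ip) G) sform_iter_bshift//.
  by case: (K_opA (K_bshift (K_kern hTh1 (g1 v)))).
have hPsi0 v : hardy (Psi0 v).
  apply: hardyB; first by case: (K_opA (K_kern hTh1 (g1 v))).
  by apply: (hardy_zshift 1); case: (K_opA (K_bshift (K_kern hTh1 (g1 v)))).
(* On functions vanishing at the origin S^* is isometric and [vanish] is contractive, so the
   functional has norm at most M times the sum of the norms of k and S^* k. *)
have exX v : exists W, hardy W /\ forall F, K1 F -> t (Q1 F) (kern hTh2 (g2 v)) = b F W.
  set k := kern _ _.
  suff [W hW WP] : exists2 W, hardy W & forall F, K1 F -> t (Q1 F) k = b F W by exists W.
  apply: (@K_riesz _ _ ip Th1 hTh1 _ (M * (snorm b k + snorm b (bshift k)))).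
    move=> a F F' kF kF'; rewrite /Q1 vanish_linear t_linl//; exact: K_vanish.
  move=> F kF; rewrite /t; apply: le_trans (cabsB _ _) _.
  have kQ : K1 (Q1 F) by exact: K_vanish.
  have Q0 : fc (Q1 F) 0 = 0 by exact: fc_vanish.
  have a1 := hM _ k kQ; have a2 := hM _ (bshift k) (K_bshift kQ).
  rewrite (bshift_zshift Q0) snorm_zshift in a2 *.
  have sQ : snorm b (Q1 F) <= snorm b F by exact: snorm_vanish.
  have a3 : M * snorm b (Q1 F) * snorm b k <= M * snorm b F * snorm b k.
    by apply: ler_wpM2r; [exact: snorm_ge0|exact: ler_wpM2l].
  have a4 : M * snorm b (Q1 F) * snorm b (bshift k) <= M * snorm b F * snorm b (bshift k).
    by apply: ler_wpM2r; [exact: snorm_ge0|exact: ler_wpM2l].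
  by move: a1 a2 a3 a4; lra.
have [X0 X0P] := choice exX.
pose PsiL := frame_ext s Psi0; pose XL := frame_ext s X0.
have hardy_ext P : (forall v, hardy (P v)) -> forall x, hardy (frame_ext s P x).
  move=> hP x; apply: hardy_sum => v.
  by have := hardy_lin (ip x v) (hP v) (@hardy0 _ _ ip); rewrite addr0.
have tP F G : K1 F -> K2 G -> t F G = b (PsiL (fc F 0)) G + b F (XL (fc G 0)).
  move=> kF kG.
  have kQ1 : K1 (Q1 F) by exact: K_vanish.
  have -> : t F G = t (kern hTh1 (g1 (fc F 0))) G + t (Q1 F) G.
    have := t_linl 1 (kern hTh1 (g1 (fc F 0))) (Q1 F) G (K_kern hTh1 _) kQ1.
    by rewrite scale1r mul1r => <-; rewrite /Q1 /vanish addrCA subrr addr0.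
  congr (_ + _).
    have -> : kern hTh1 (g1 (fc F 0)) = \sum_(v <- s) ip (fc F 0) v *: kern hTh1 (g1 v).
      by rewrite {1}(sx (fc F 0)) kern_sum.
    rewrite t_suml; last by move=> v; exact: K_kern.
    rewrite /PsiL /frame_ext sform_suml; apply: eq_bigr => v _.
    by rewrite sformZl Psi0P.
  (* The difference in the second slot is [vanish] of [G]; both arguments then vanish at the origin
     and the invariance makes [t] zero. *)
  have -> : t (Q1 F) G = t (Q1 F) (kern hTh2 (g2 (fc G 0))).
    apply/eqP; rewrite -subr_eq0; apply/eqP.
    rewrite -t_subr -/(vanish hTh2 g2 G).
    have [Q10 Q20] : fc (Q1 F) 0 = 0 /\ fc (vanish hTh2 g2 G) 0 = 0.
      by split; exact: fc_vanish.
    by rewrite /t (bshift_zshift Q10) (bshift_zshift Q20)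
      (inv _ _ kQ1 (K_vanish g2 kG) Q10 Q20) subrr.
  have -> : kern hTh2 (g2 (fc G 0)) = \sum_(v <- s) ip (fc G 0) v *: kern hTh2 (g2 v).
    by rewrite {1}(sx (fc G 0)) kern_sum.
  rewrite t_sumr /XL /frame_ext sform_sumr; apply: eq_bigr => v _.
  by rewrite sformZr (X0P v).2.
pose PhiP := rank_sum s Psi0; pose PhiX := rank_sum s X0.
have LP : L2op ip PhiP by exact: L2op_rank_sum.
have LX : L2op ip PhiX by exact: L2op_rank_sum.
have K_iter N F (Th : T -> 'End(H)) (h : inner ip Th) : K h F -> K h (iter N (@bshift _ _ ip) F).
  by move=> kF; elim: N => [//|N IH]; exact: K_bshift.
have telescope N F G : K1 F -> K2 G -> formA F G =
    formA (iter N (@bshift _ _ ip) F) (iter N (@bshift _ _ ip) G) +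
    (b (opL PhiP (fpart F N)) G + b F (opL PhiX (fpart G N))).
  move=> kF kG; elim: N => [|N ->].
    have o0 (P : H -> L) (E : L) : opL (rank_sum s P) (fpart E 0) = 0.
      rewrite (_ : fpart E 0 = 0) ?/fpart /trigsum ?big_ord0//.
      apply: L2t_eq => z; rewrite (opLE (L2op_rank_sum s P) (bounded0 ip)).
      exact: linear0.
    by rewrite !o0 sform0l sform0r !addr0.
  (* Formula [tP] at the N-th iterates. Moved to the other slot, they become z^N in front of Psi and
     X applied to N-th coefficients, the terms added to [fpart] at step N. *)
  have := tP _ _ (K_iter N _ _ _ kF) (K_iter N _ _ _ kG).
  rewrite /t -!iterS !fc_iter_bshift sform_iter_bshift; last exact: hardy_ext.
  rewrite [b _ (XL _)]sformC sform_iter_bshift; last by apply: hardy_ext => v; case: (X0P v).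
  rewrite -[(b (zshift _ (XL _)) F)^*]sformC => e.
  rewrite /PhiP /PhiX !opL_fpartS sformDl sformDr -/PsiL -/XL.
  have -> : formA (iter N (@bshift _ _ ip) F) (iter N (@bshift _ _ ip) G) =
      formA (iter N.+1 (@bshift _ _ ip) F) (iter N.+1 (@bshift _ _ ip) G) +
      (b (zshift N%:Z (PsiL (fc F N%:Z))) G + b F (zshift N%:Z (XL (fc G N%:Z)))).
    by rewrite -e addrC subrK.
  ring.
exists (fun z => PhiP z + adjoint ip (PhiX z)).
have LA := L2op_adjoint LX.
have LPhi := L2op_add LP LA.
split; [exact: LPhi|move=> F G kF bF kG].
have cF := fpart_cvg (proj1 kF).
have opE : opL (fun z => PhiP z + adjoint ip (PhiX z)) F =
    opL PhiP F + opL (fun z => adjoint ip (PhiX z)) F.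
  by apply: L2t_eq => z; rewrite L2tD !opLE// add_lfunE.
(* Boundedness of [G'] lets the symbol Psi be moved onto it. For a symbol that is only L^2, its
   product with [fpart F N] need not converge in norm, but [fpart F N] itself does. *)
have bK G' : K2 G' -> bounded G' ->
    b (opL (fun z => PhiP z + adjoint ip (PhiX z)) F) G' = formA F G'.
  move=> kG' bG'; apply/esym/eqP; rewrite -subr_eq0; apply/eqP.
  have cG := fpart_cvg (proj1 kG').
  pose F' := opL (fun z => adjoint ip (PhiX z)) F.
  pose G'' := opL (fun z => adjoint ip (PhiP z)) G'.
  have c0 : (fun N => (M * snorm b (F - fpart F N)) * snorm b (G' - fpart G' N) +
     (snorm b G'' * snorm b (F - fpart F N) + snorm b F' * snorm b (G' - fpart G' N)))
       @ \oo --> (0 : R).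
    have c1 (k : R) u : u @ \oo --> (0 : R) -> (fun N : nat => k * u N) @ \oo --> (0 : R).
      move=> cu; rewrite -(mulr0 k); apply: cvgM; [exact: cvg_cst|exact: cu].
    rewrite -[X in _ --> X](addr0 0) -[X in _ --> X + _](mulr0 0).
    apply: cvgD; first by apply: cvgM; [exact: c1|exact: cG].
    by rewrite -[X in _ --> X](addr0 0); apply: cvgD; exact: c1.
  apply: (eq0_of_cvg (M := 1) c0) => N; rewrite mul1r.
  have bp E : bounded (fpart E N : L) by exact: bounded_trigsum.
  rewrite opE sformDl (telescope N F G' kF kG').
  have -> : b (opL PhiP F) G' = b F G'' by rewrite sform_opL_adj.
  have -> : b (opL PhiP (fpart F N)) G' = b (fpart F N) G'' by rewrite sform_opL_adj.
  have -> : b F (opL PhiX (fpart G' N)) = b F' (fpart G' N).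
    by rewrite sformC sform_opL_adj// -sformC.
  rewrite (_ : _ - _ = formA (iter N (@bshift _ _ ip) F) (iter N (@bshift _ _ ip) G') -
      (b (F - fpart F N) G'' + b F' (G' - fpart G' N))); last first.
    by rewrite sformBl sformBr; ring.
  apply: le_trans (cabsB _ _) _; apply: lerD.
    by rewrite -!snorm_iter_bshift; exact: hM (K_iter N _ _ _ kF).
  apply: le_trans (cabsD _ _) _; apply: lerD; last exact: cauchy_schwarz.
  by rewrite mulrC; exact: cauchy_schwarz.
apply/eqP; rewrite -subr_eq0 -sformBl; apply/eqP.
(* [D] is orthogonal to the bounded elements of the second model space, and [ptrig] approximates [G]
   by such elements. *)
set D := opL _ F - opA F.
apply: (eq0_of_cvg (M := snorm b D) (ptrig_cvg kG)) => N.
have -> : b D G = b D (G - ptrig hTh2 (fun n => fc G n%:Z) N).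
  rewrite sformBr [X in _ - X](_ : _ = 0) ?subr0// /D sformBl bK ?subrr//.
    exact: K_ptrig.
  exact: bounded_ptrig.
exact: cauchy_schwarz.
Qed.

End TruncatedToeplitz.

Theorem theorem6p1 (R : realType) (H : vectType R[i])
    (ip : {dot H for Num.conj}) (Th1 Th2 : circle R -> 'End(H))
    (A : (circle R -> H) -> (circle R -> H)) :
  inner ip Th1 -> pure ip Th1 -> inner ip Th2 -> pure ip Th2 ->
  bounded_operator ip Th1 Th2 A ->
  [/\ MT ip Th1 Th2 A <->
        (forall f g, model_space ip Th1 f -> model_space ip Th2 g ->
           L2ortho ip f (defect ip Th1) -> L2ortho ip g (defect ip Th2) ->
           L2ip ip (A (backward_shift f)) (backward_shift g)
           = L2ip ip (A f) g),
      MT ip Th1 Th2 A <->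
        (forall f g, model_space ip Th1 f -> model_space ip Th2 g ->
           L2ortho ip f (defect ip Th1) -> L2ortho ip g (codefect Th2) ->
           L2ip ip (A (backward_shift f)) g = L2ip ip (A f) (forward_shift g)),
      MT ip Th1 Th2 A <->
        (forall f g, model_space ip Th1 f -> model_space ip Th2 g ->
           L2ortho ip f (codefect Th1) -> L2ortho ip g (codefect Th2) ->
           L2ip ip (A (forward_shift f)) (forward_shift g) = L2ip ip (A f) g)
    & MT ip Th1 Th2 A <->
        (forall f g, model_space ip Th1 f -> model_space ip Th2 g ->
           L2ortho ip f (codefect Th1) -> L2ortho ip g (defect ip Th2) ->
           L2ip ip (A (forward_shift f)) g = L2ip ip (A f) (backward_shift g))].
Proof.
move=> h1 p1 h2 p2 hA.
have key : MT ip Th1 Th2 A <-> shift_invariant A h1 h2.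
  rewrite (MTP h1 h2 hA); split=> [[Phi hPhi]|hS].
    exact: (symbol_shift_invariant hA p1 hPhi).
  exact: (shift_invariant_symbol hA p1 p2 hS).
split; apply: (iff_trans key); apply: iff_sym.
- exact: shift_invariant_a.
- exact: shift_invariant_b.
- exact: shift_invariant_c.
- exact: shift_invariant_d.
Qed.
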